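(* Let $Z=(X^+,X^-)$ be the piecewise linear vector field on $\mathbb{R}^3$ with $$X^+(x,y,z)=(a^+x+b^+z,\;c^+y+d^+z-1,\;y)\ \text{ for } z>0,\qquad X^-(x,y,z)=(a^-x+b^-z+m,\;c^-y+d^-z+1,\;y)\ \text{ for } z<0,$$ where $a^\pm,b^\pm,c^\pm,d^\pm,m\in\mathbb{R}$. The following statements hold. (1) If $(a^+)^2+(a^-)^2=0$ or $Z$ has no invariant cylinder, then $Z$ has no limit cycles. (2) If $(a^+)^2+(a^-)^2\neq0$ and $Z$ has at most a unique invariant cylinder, then $Z$ has at most a unique limit cycle in this cylinder. (3) If $(a^+)^2+(a^-)^2\neq0$, $a^+a^-\ge0$ and $Z$ has infinitely many invariant cylinders, then there is an invariant surface formed of periodic orbits of $Z$, where each periodic orbit is contained in an invariant cylinder.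
   Context: Let $h(x,y,z)=z$, $\Sigma=\{z=0\}$, $\Sigma^\pm=\{\pm z>0\}$. Orbits of $Z$ follow $X^+$ in $\Sigma^+$ and $X^-$ in $\Sigma^-$, and are concatenated at points of $\Sigma$. Here $X^\pm h(x,y,0)=y$; the sewing region is $\Sigma_S=\{p\in\Sigma: X^+h(p)X^-h(p)>0\}=\{y\neq0,z=0\}$, and the line $y=z=0$ consists of invisible fold points. Periodic orbit: a closed orbit $\gamma$ of $Z$ with $\gamma\cap\Sigma_S\ne\emptyset$. Limit cycle: an isolated periodic orbit of $Z$. Invariant cylinder: for $y_0>0$ and $y_1<0$ let $r_i=\{(x,y,z):y=y_i,z=0\}$, $i=0,1$. If the flow of $X^+$ carries $r_0$ through $\Sigma^+$ to $r_1$ (every orbit starting on $r_0$ stays in $\Sigma^+$ until it first hits $\Sigma$, on $r_1$, after a positive time $\tau$ common to all orbits) and the flow of $X^-$ carries $r_1$ through $\Sigma^-$ to $r_0$ in the same sense (in time $\overline\tau>0$), the union of these orbit arcs is an invariant cylinder of $Z$. *)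

(* Defs.v *)
From mathcomp Require Import all_boot all_order all_algebra.
From mathcomp Require Import all_classical all_reals all_analysis.

Set Implicit Arguments.
Unset Strict Implicit.
Unset Printing Implicit Defensive.

Import Order.TTheory GRing.Theory Num.Theory.
Import numFieldNormedType.Exports.

Local Open Scope classical_set_scope.
Local Open Scope ring_scope.

Notation space3 R := (R * R * R)%type.

Definition Xplus (R : realType) (a b c d : R) (p : space3 R) : space3 R :=
  let: (x, y, z) := p in (a * x + b * z, c * y + d * z - 1, y).

Definition Xminus (R : realType) (a b c d m : R) (p : space3 R) : space3 R :=
  let: (x, y, z) := p in (a * x + b * z + m, c * y + d * z + 1, y).

(* A piecewise vector field is a pair: the first component acts on SigmaP,
   the second one on SigmaM. *)
Definition pwfield (R : realType) : Type :=
  ((space3 R -> space3 R) * (space3 R -> space3 R))%type.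

Definition height (R : realType) (p : space3 R) : R := p.2.

Definition Sigma (R : realType) : set (space3 R) := [set p | height p = 0].
Definition SigmaP (R : realType) : set (space3 R) := [set p | 0 < height p].
Definition SigmaM (R : realType) : set (space3 R) := [set p | height p < 0].

(* 'D_(X p) height p is the Lie derivative X(height)(p). *)
Definition sewing (R : realType) (Z : pwfield R) : set (space3 R) :=
  [set p | Sigma p /\ 0 < 'D_(Z.1 p) (@height R) p * 'D_(Z.2 p) (@height R) p].

Definition integral_curve (R : realType) (X : space3 R -> space3 R)
    (u : R -> space3 R) : Prop :=
  forall t : R, is_derive t 1 u (X (u t)).

(* Orbits are concatenations of arcs, so a trajectory leaves Sigma at once, both
   forwards and backwards in time. For Z = (Xplus, Xminus) this means that Sigma
   is only met at sewing points: both folds on y = z = 0 are invisible, so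
   neither field has an arc in its own half-space that starts or ends on that
   line. Sliding along the line y = z = 0 never meets the sewing region and is
   not considered. *)
Definition trajectory (R : realType) (Z : pwfield R) (u : R -> space3 R) : Prop :=
  [/\ continuous u,
      forall t : R, SigmaP (u t) -> is_derive t 1 u (Z.1 (u t)),
      forall t : R, SigmaM (u t) -> is_derive t 1 u (Z.2 (u t)) &
      forall t : R, Sigma (u t) -> \forall s \near t^', ~ Sigma (u s)].

Definition periodic_orbit (R : realType) (Z : pwfield R)
    (gamma : set (space3 R)) : Prop :=
  (exists (u : R -> space3 R) (T : R),
     [/\ trajectory Z u, 0 < T, forall t, u (t + T) = u t & gamma = range u]) /\
  gamma `&` sewing Z !=set0.

Definition limit_cycle (R : realType) (Z : pwfield R)
    (gamma : set (space3 R)) : Prop :=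
  periodic_orbit Z gamma /\
  exists U : set (space3 R), [/\ open U, gamma `<=` U &
    forall gamma', periodic_orbit Z gamma' -> gamma' `<=` U -> gamma' = gamma].

Definition xline (R : realType) (y : R) : set (space3 R) :=
  [set p | p.1.2 = y /\ p.2 = 0].

Definition carries (R : realType) (X : space3 R -> space3 R) (S : set (space3 R))
    (tau y y' : R) : Prop :=
  forall p, xline y p -> exists u : R -> space3 R,
    [/\ integral_curve X u, u 0 = p,
        forall t, 0 < t < tau -> S (u t) & xline y' (u tau)].

Definition arcs (R : realType) (X : space3 R -> space3 R) (tau y : R) :
    set (space3 R) :=
  [set q | exists (u : R -> space3 R) (t : R),
     [/\ integral_curve X u, xline y (u 0), 0 <= t <= tau & q = u t]].

Definition invariant_cylinder (R : realType) (Z : pwfield R)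
    (C : set (space3 R)) : Prop :=
  exists y0 y1 tau tau' : R,
    [/\ 0 < y0 /\ y1 < 0, 0 < tau /\ 0 < tau',
        carries Z.1 (@SigmaP R) tau y0 y1,
        carries Z.2 (@SigmaM R) tau' y1 y0 &
        C = arcs Z.1 tau y0 `|` arcs Z.2 tau' y1].

(* Nonempty embedded topological 2-manifold without boundary. Smoothness is not
   required: a surface made of orbits of Z usually has an edge along Sigma. *)
Definition surface (R : realType) (S : set (space3 R)) : Prop :=
  S !=set0 /\
  forall p, S p -> exists (U : set (space3 R)) (V : set (R * R)%type)
      (f : R * R -> space3 R) (g : space3 R -> R * R),
    [/\ open U /\ U p, open V,
        {within V, continuous f}, {within S `&` U, continuous g} &
        f @` V = S `&` U /\ (forall v, V v -> g (f v) = v)].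

Definition invariant_set (R : realType) (Z : pwfield R) (S : set (space3 R)) : Prop :=
  forall u, trajectory Z u -> S (u 0) -> forall t, S (u t).

(* Main.v *)
Require Import Defs.
From mathcomp Require Import all_boot all_order all_algebra.
From mathcomp Require Import all_classical all_reals all_analysis.
From mathcomp Require Import ring lra.
Set Implicit Arguments.
Unset Strict Implicit.
Unset Printing Implicit Defensive.
Import Order.TTheory GRing.Theory Num.Theory.
Import numFieldNormedType.Exports.
Local Open Scope classical_set_scope.
Local Open Scope ring_scope.

(** The equations of y and z do not involve x. On either side of the plane z = 0
  they describe flights: a solution of z'' = c z' + d z - 1 (up to the symmetry
  of the two sides) thrown from z = 0 upwards. As functions of the duration t of
  the flight, the launch speed is launch c d t and, by time reversal, the landing
  speed is launch (- c) d t; both increase with t. So the half-return of each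
  side is a monotone curve in the plane of pairs of speeds, and the invariant
  cylinders are the common points of the two curves (invariant_cylinderP).

  A periodic orbit lies on a cylinder: since the half-returns are monotone, its
  upward crossing of highest speed is a fixed point of the planar return map
  (orbit_planar_cycle), and as distinct trajectories over the same planar motion
  do not meet, it closes up after one turn (orbit_cycle). In particular there is
  no periodic orbit without a cylinder. The x equation being affine, a periodic
  orbit is not isolated as soon as the linear part of that equation has a nonzero
  periodic solution along it (not_limit_cycle). A constant is such a solution if a
  vanishes on both sides; and the difference of the x coordinates is one for two
  periodic orbits on the same cylinder. This proves the first two statements.

  For the third one, the essential point is that the two curves meet finitely
  often unless they overlap (common_flight_finite). At a common point, the sign
  of the difference of their slopes is that of a polynomial of bidegree one in
  the two speeds, which changes sign at most once along a flight curve. So if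
  there are infinitely many cylinders, the closed orbits of the planar system
  fill an open set. If a+ and a- do not have opposite signs and are not both zero,
  the return map of x over each closed orbit is affine with slope different from 1,
  hence has one fixed point, which depends continuously on the orbit. The
  corresponding periodic orbits form the graph of a continuous function x of
  (y, z) over an open set, which is a surface (surf_graph, surf_near). *)

(** * Calculus on the real line *)

Section calculus.
Variable R : realType.
Implicit Types (f g : R -> R) (t a b : R).

Lemma is_derive_addf t f g a b : is_derive t 1 f a -> is_derive t 1 g b ->
  is_derive t 1 (fun s => f s + g s) (a + b).
Proof. by move=> ? ?; apply: is_deriveD. Qed.

Lemma is_derive_oppf t f a : is_derive t 1 f a ->
  is_derive t 1 (fun s => - f s) (- a).
Proof. by move=> ?; apply: is_deriveN. Qed.

Lemma is_derive_mulf t f g a b : is_derive t 1 f a -> is_derive t 1 g b ->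
  is_derive t 1 (fun s => f s * g s) (a * g t + f t * b).
Proof.
move=> fa gb; apply: is_derive_eq (is_deriveM fa gb) _.
by rewrite /GRing.scale /= addrC mulrC.
Qed.

Lemma is_derive_sqrf t f a : is_derive t 1 f a ->
  is_derive t 1 (fun s => f s ^+ 2) (2 * f t * a).
Proof.
move=> fa; apply: is_derive_eq (is_derive_mulf fa fa) _; ring.
Qed.

Lemma is_derive_scalef t f a k : is_derive t 1 f a ->
  is_derive t 1 (fun s => k * f s) (k * a).
Proof.
move=> fa; apply: is_derive_eq (is_derive_mulf (is_derive_cst k _ _) fa) _.
by rewrite mul0r add0r.
Qed.

Lemma is_derive_invf t f a : f t != 0 -> is_derive t 1 f a ->
  is_derive t 1 (fun s => (f s)^-1) (- a / f t ^+ 2).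
Proof.
move=> f0 fa; apply: is_derive_eq (is_deriveV f0 fa) _.
by rewrite /GRing.scale /= !mulNr mulrC.
Qed.

Lemma is_derive_expRM t c :
  is_derive t 1 (fun s => expR (c * s)) (c * expR (c * t)).
Proof.
have H := is_derive_scalef c (is_derive_id t 1).
by apply: is_derive_eq (is_derive1_comp (is_derive_expR (c * t)) H) _; rewrite mulr1 mulrC.
Qed.

Lemma is_derive_shiftf t f a h : is_derive (h + t) 1 f a ->
  is_derive t 1 (fun s => f (h + s)) a.
Proof.
move=> H.
have H1 := is_derive_addf (is_derive_cst h t 1) (is_derive_id t 1).
by apply: is_derive_eq (is_derive1_comp H H1) _; rewrite add0r mulr1.
Qed.

Lemma is_derive_oppv t f a : is_derive (- t) 1 f a ->
  is_derive t 1 (fun s => f (- s)) (- a).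
Proof.
move=> H; have H1 := is_derive_oppf (is_derive_id t 1).
by apply: is_derive_eq (is_derive1_comp H H1) _; rewrite mulrN1.
Qed.

End calculus.

(* The refinements below must not trigger instance resolution, which would
   rewrite the function into an unreadable derivative. *)
Ltac derive_step := first
  [ eassumption
  | notypeclasses refine (is_derive_id _ _)
  | notypeclasses refine (is_derive_cst _ _ _)
  | notypeclasses refine (is_derive_addf _ _)
  | notypeclasses refine (is_derive_oppf _)
  | notypeclasses refine (is_derive_expRM _ _)
  | notypeclasses refine (is_derive_sqrf _)
  | notypeclasses refine (is_derive_scalef _ _)
  | notypeclasses refine (is_derive_mulf _ _) ].
Ltac derive_val :=
  simple notypeclasses refine (is_derive_eq _ _);
  [| solve [repeat derive_step] |]; cbv beta.


Section comps.
Variable R : realType.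

Lemma is_deriveP_cvg (V : normedModType R) (f : R -> V) (t : R) (a : V) :
  is_derive t 1 f a <->
  h^-1 *: ((f \o shift t) (h *: 1) - f t) @[h --> 0^'] --> a.
Proof.
split=> [fa|fa].
  by case: fa => ex_f <-; exact: ex_f.
apply: DeriveDef; first by apply/cvg_ex; exists a.
exact/cvg_lim.
Qed.

Lemma is_derive_pairP (V W : normedModType R) (u : R -> V * W) (t : R) v :
  is_derive t 1 u v <->
  is_derive t 1 (fun s => (u s).1) v.1 /\ is_derive t 1 (fun s => (u s).2) v.2.
Proof.
rewrite !is_deriveP_cvg; split => [uv|[u1 u2]].
  split.
    have := cvg_comp _ _ uv (@cvg_fst _ _ (nbhs v.1) (nbhs v.2) _); exact.
  have := cvg_comp _ _ uv (@cvg_snd _ _ (nbhs v.1) (nbhs v.2) _); exact.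
rewrite [v]surjective_pairing; exact: cvg_pair u1 u2.
Qed.

Lemma is_derive3P (u : R -> space3 R) (t : R) (v : space3 R) :
  is_derive t 1 u v <->
  [/\ is_derive t 1 (fun s => (u s).1.1) v.1.1,
      is_derive t 1 (fun s => (u s).1.2) v.1.2 &
      is_derive t 1 (fun s => (u s).2) v.2].
Proof.
rewrite is_derive_pairP (is_derive_pairP (fun s => (u s).1)).
by split=> [[[? ?] ?]|[? ? ?]].
Qed.

Lemma space3_eq (q q' : space3 R) : q.1.1 = q'.1.1 -> q.1.2 = q'.1.2 ->
  q.2 = q'.2 -> q = q'.
Proof. by case: q q' => [[? ?] ?] [[? ?] ?] /= -> -> ->. Qed.

Lemma cvg_pairP (T : Type) (F : set_system T) (FF : Filter F)
    (V W : topologicalType) (u : T -> V * W) (p : V * W) :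
  u @ F --> p <-> (fun s => (u s).1) @ F --> p.1 /\ (fun s => (u s).2) @ F --> p.2.
Proof.
split=> [up|[u1 u2]].
  split.
    have := cvg_comp _ _ up (@cvg_fst _ _ (nbhs p.1) (nbhs p.2) _); exact.
  have := cvg_comp _ _ up (@cvg_snd _ _ (nbhs p.1) (nbhs p.2) _); exact.
have -> : u = (fun s => ((u s).1, (u s).2)).
  by apply/funext => s; rewrite -surjective_pairing.
rewrite [p]surjective_pairing; exact: (@cvg_pair _ _ _ _ (nbhs p.1) (nbhs p.2)).
Qed.

Lemma continuous3P (T : topologicalType) (u : T -> space3 R) :
  continuous u <->
  [/\ continuous (fun s => (u s).1.1), continuous (fun s => (u s).1.2) &
      continuous (fun s => (u s).2)].
Proof.
split=> [cu|[c1 c2 c3] t].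
  by split=> t; have /cvg_pairP[/cvg_pairP[]] := cu t.
apply/cvg_pairP; split; last exact: c3.
by apply/cvg_pairP; split; [exact: c1|exact: c2].
Qed.

Lemma MVT_oo (f df : R -> R) (a b : R) : a < b -> continuous f ->
  (forall x, a < x < b -> is_derive x 1 f (df x)) ->
  exists2 c, a < c < b & f b - f a = df c * (b - a).
Proof.
move=> ab cf dfE.
have dfE' x : x \in `]a, b[ -> is_derive x 1 f (df x).
  by rewrite in_itv; exact: dfE.
have [c cab fE] := MVT ab dfE' (continuous_subspaceT cf).
by exists c => //; move: cab; rewrite in_itv.
Qed.

Lemma derive_gt0_lt (f df : R -> R) (a b : R) : a < b -> continuous f ->
  (forall x, a < x < b -> is_derive x 1 f (df x)) ->
  (forall x, a < x < b -> 0 < df x) -> f a < f b.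
Proof.
move=> ab cf dfE df0; have [c cab fE] := MVT_oo ab cf dfE.
by rewrite -subr_gt0 fE mulr_gt0 ?df0// subr_gt0.
Qed.

Lemma is_derive_continuous (f df : R -> R) :
  (forall x : R, is_derive x 1 f (df x)) -> continuous f.
Proof.
move=> fE x; apply/differentiable_continuous/derivable1_diffP.
by have := fE x.
Qed.

Lemma IVT_eq0 (f : R -> R) (a b : R) : a <= b -> continuous f ->
  f a <= 0 <= f b \/ f b <= 0 <= f a -> exists2 c, a <= c <= b & f c = 0.
Proof.
move=> ab cf fab.
have fab0 : Num.min (f a) (f b) <= 0 <= Num.max (f a) (f b).
  by rewrite ge_min le_max; case: fab => /andP[-> ->]; rewrite ?orbT.
have [c cab fc] := IVT ab (continuous_subspaceT cf) fab0.
by exists c => //; move: cab; rewrite in_itv.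
Qed.

(** The square E of the norm of a solution satisfies E' <= K E, so that
  E exp (- K t) does not increase. *)
Lemma linear_ode_zero (a b c d : R) (x y z : R -> R) (t0 t1 : R) :
  continuous x -> continuous y -> continuous z ->
  (forall t, t0 < t < t1 -> is_derive t 1 x (a * x t + b * z t)) ->
  (forall t, t0 < t < t1 -> is_derive t 1 y (c * y t + d * z t)) ->
  (forall t, t0 < t < t1 -> is_derive t 1 z (y t)) ->
  x t0 = 0 -> y t0 = 0 -> z t0 = 0 ->
  forall t, t0 <= t <= t1 -> [/\ x t = 0, y t = 0 & z t = 0].
Proof.
move=> cx cy cz dx dy dz x0 y0 z0 t /andP[t0t tt1].
move: t0t; rewrite le_eqVlt => /predU1P[<-//|t0t].
pose K := 2 * (`|a| + `|b| + `|c| + `|d| + 1).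
pose E s := x s ^+ 2 + y s ^+ 2 + z s ^+ 2.
pose h s := E s * expR (- K * s).
have cE : continuous E.
  move=> s; rewrite /E; apply: cvgD; first apply: cvgD.
  - by rewrite expr2; apply: cvgM; exact: cx.
  - by rewrite expr2; apply: cvgM; exact: cy.
  - by rewrite expr2; apply: cvgM; exact: cz.
have ch : continuous h.
  move=> s; apply: cvgM; first exact: cE.
  have := @is_derive_continuous _ _ (fun s => is_derive_expRM s (- K)).
  by move=> /(_ s); apply.
pose dE s := 2 * x s * (a * x s + b * z s) + 2 * y s * (c * y s + d * z s)
  + 2 * z s * y s.
have dh s : t0 < s < t -> is_derive s 1 h ((dE s - K * E s) * expR (- K * s)).
  move=> /andP[t0s st]; have ts1 : t0 < s < t1 by rewrite t0s (lt_le_trans st).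
  have ? := dx _ ts1; have ? := dy _ ts1; have ? := dz _ ts1.
  rewrite /h /E; derive_val; rewrite /dE /E; ring.
have [s _ hE] := MVT_oo t0t ch dh.
have dEK : dE s <= K * E s.
  have B (w u v : R) : 2 * (w * (u * v)) <= `|w| * (u ^+ 2 + v ^+ 2).
    have [w0|w0] := leP 0 w.
      rewrite ger0_norm//; have : 0 <= w * (u - v) ^+ 2 by rewrite mulr_ge0 ?sqr_ge0.
      by lra.
    rewrite ltr0_norm//.
    have : 0 <= - w * (u + v) ^+ 2 by rewrite mulr_ge0 ?sqr_ge0// oppr_ge0 ltW.
    by lra.
  have := B a (x s) (x s); have := B b (x s) (z s); have := B c (y s) (y s).
  have := B d (y s) (z s); have := B 1 (z s) (y s); rewrite normr1.
  rewrite /dE /K /E.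
  set A := `|a|; set A2 := `|b|; set A3 := `|c|; set A4 := `|d|.
  (* K E exceeds the sum of the bounds B by the following terms *)
  have P1 : 0 <= A * (y s ^+ 2 + z s ^+ 2) 
    by rewrite mulr_ge0 ?addr_ge0 ?sqr_ge0 ?normr_ge0.
  have P2 : 0 <= A2 * (x s ^+ 2 + y s ^+ 2 + y s ^+ 2 + z s ^+ 2) 
    by rewrite mulr_ge0 ?addr_ge0 ?sqr_ge0 ?normr_ge0.
  have P3 : 0 <= A3 * (x s ^+ 2 + z s ^+ 2) 
    by rewrite mulr_ge0 ?addr_ge0 ?sqr_ge0 ?normr_ge0.
  have P4 : 0 <= A4 * (x s ^+ 2 + x s ^+ 2 + y s ^+ 2 + z s ^+ 2) 
    by rewrite mulr_ge0 ?addr_ge0 ?sqr_ge0 ?normr_ge0.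
  have P5 : 0 <= x s ^+ 2 + x s ^+ 2 + y s ^+ 2 + z s ^+ 2.
    by rewrite ?addr_ge0 ?sqr_ge0.
  by lra.
have ht : h t <= h t0.
  rewrite -subr_le0 hE mulr_le0_ge0 ?subr_ge0 ?(ltW t0t)//.
  by rewrite mulr_le0_ge0 ?subr_le0 ?expR_ge0.
have {}ht : E t <= 0.
  move: ht; rewrite {2}/h /E x0 y0 z0 !expr0n /= !add0r mul0r /h.
  by rewrite pmulr_lle0 ?expR_gt0.
have Et := sqr_ge0 (x t); have Et1 := sqr_ge0 (y t); have Et2 := sqr_ge0 (z t).
by split; apply/eqP; rewrite -sqrf_eq0 eq_le; apply/andP; split=> //; rewrite /E in ht; lra.
Qed.

Lemma planar_ode_zero (c d : R) (y z : R -> R) :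
  (forall r : R, is_derive r 1 y (c * y r + d * z r)) ->
  (forall r : R, is_derive r 1 z (y r)) -> y 0 = 0 -> z 0 = 0 ->
  forall t, 0 <= t -> y t = 0 /\ z t = 0.
Proof.
move=> dy dz y0 z0 t t0.
have cy := is_derive_continuous dy; have cz := is_derive_continuous dz.
have dx (s : R) : is_derive s 1 (cst 0 : R -> R) (0 * cst (0 : R) s + 0 * z s).
  by rewrite !mul0r add0r; exact: is_derive_cst.
have cx := is_derive_continuous dx.
have := @linear_ode_zero 0 0 c d _ _ _ 0 t cx cy cz (fun s _ => dx s)
  (fun s _ => dy s) (fun s _ => dz s) erefl y0 z0 t.
by rewrite t0 lexx => /(_ isT)[].
Qed.

Lemma is_derive_shift3 (u : R -> space3 R) (h t : R) (l : space3 R) :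
  is_derive (h + t) 1 u l -> is_derive t 1 (fun r => u (h + r)) l.
Proof.
move=> /is_derive3P[H1 H2 H3]; apply/is_derive3P.
by split; [exact: (is_derive_shiftf H1)|exact: (is_derive_shiftf H2)
  |exact: (is_derive_shiftf H3)].
Qed.

Lemma continuous_shift (V : topologicalType) (u : R -> V) (h : R) : continuous u ->
  continuous (fun r => u (h + r)).
Proof.
move=> cu t; apply: continuous_comp; last exact: cu.
by apply: cvgD; [exact: cvg_cst|exact: cvg_id].
Qed.

(** Arcs are glued along the times of crossing. *)
Lemma glue_continuous (V : topologicalType) (f g h : R -> V) (t : R) :
  (\forall r \near t, (r <= t -> h r = f r) /\ (t <= r -> h r = g r)) ->
  {for t, continuous f} -> {for t, continuous g} -> {for t, continuous h}.
Proof.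
move=> E cf cg A hA.
have [hf hg] := nbhs_singleton E.
have fA : nbhs (f t) A by rewrite -hf.
have gA : nbhs (g t) A by rewrite -hg.
have nf : \forall r \near t, A (f r) := cf _ fA.
have ng : \forall r \near t, A (g r) := cg _ gA.
change (\forall r \near t, A (h r)).
near=> r.
have [Ef Eg] : (r <= t -> h r = f r) /\ (t <= r -> h r = g r) by near: r.
have [rt|tr] := leP r t.
  by rewrite Ef//; near: r.
by rewrite Eg ?ltW//; near: r.
Unshelve. all: by end_near. Qed.

End comps.

(** * Exponential generating series *)

(** Linear equations with constant coefficients are solved on the whole line by
  series: differentiation is the shift of the coefficient sequence. *)

Section egf.
Variable R : realType.
Implicit Types (al be : nat -> R) (t a x : R).

Definition geometrically_bounded al :=
  exists K M : R, [/\ 0 <= K, 0 <= M & forall n, `|al n| <= K * M ^+ n].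

Definition egf al (t : R) : R := limn (pseries (fun n => al n / n`!%:R) t).

Lemma cvg_egf al x : geometrically_bounded al ->
  cvgn (pseries (fun n => al n / n`!%:R) x).
Proof.
move=> [K [M [K0 M0 alKM]]]; apply: normed_cvg.
have KM n : 0 <= (K *: exp_coeff (M * `|x|)) n.
  by rewrite /GRing.scale /= mulr_ge0// exp_coeff_ge0// mulr_ge0.
apply: (series_le_cvg _ KM) => [n|n|] /=.
- by rewrite normr_ge0.
- rewrite !normrM /GRing.scale /= /exp_coeff /= normfV (ger0_norm (ler0n _ _)) normrX.
  have -> : K *: ((M * `|x|) ^+ n / n`!%:R) = K * M ^+ n / n`!%:R * `|x| ^+ n.
    by rewrite /GRing.scale /= exprMn; ring.
  by rewrite ler_wpM2r ?exprn_ge0// ler_wpM2r ?invr_ge0.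
- apply: is_cvg_seriesZ; exact: is_cvg_series_exp_coeff.
Qed.

Lemma geometrically_bounded_shift al : geometrically_bounded al ->
  geometrically_bounded (fun n => al n.+1).
Proof.
move=> [K [M [K0 M0 alKM]]]; exists (K * M), M; split=> // [|n].
  by rewrite mulr_ge0.
by rewrite (le_trans (alKM _))// exprS mulrA.
Qed.

Lemma is_derive_egf al t : geometrically_bounded al ->
  is_derive t 1 (egf al) (egf (fun n => al n.+1) t).
Proof.
move=> gal; have E be : pseries_diffs (fun n => be n / n`!%:R) =
    (fun n => be n.+1 / n`!%:R :> R).
  apply/funext => n; rewrite /pseries_diffs factS natrM invfM.
  by rewrite [_ * (_^-1 * _)]mulrCA mulVKf// pnatr_eq0.
have gal1 := geometrically_bounded_shift gal.
rewrite /egf -E.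
apply: (@pseries_snd_diffs _ _ (`|t| + 1)); rewrite ?E.
- exact: cvg_egf.
- exact: cvg_egf gal1.
- exact: cvg_egf (geometrically_bounded_shift gal1).
- by rewrite (@ger0_norm _ (_ + 1)) ?addr_ge0// ltrDl.
Qed.

Lemma egf0 al : egf al 0 = al 0%N.
Proof.
rewrite /egf; apply: lim_near_cst => //; near=> n.
have n0 : (0 < n)%N by near: n; exact: nbhs_infty_gt.
rewrite -(prednK n0) /pseries /series /= big_nat_recl//= big1 => [|i _].
  by rewrite expr0 fact0 divr1 mulr1 addr0.
by rewrite expr0n mulr0.
Unshelve. all: by end_near. Qed.

Lemma egf_lin al be (a b t : R) : geometrically_bounded al -> geometrically_bounded be ->
  egf (fun n => a * al n + b * be n) t = a * egf al t + b * egf be t.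
Proof.
move=> gal gbe; rewrite /egf.
have -> : pseries (fun n => (a * al n + b * be n) / n`!%:R) t =
   a *: pseries (fun n => al n / n`!%:R) t + b *: pseries (fun n => be n / n`!%:R) t.
  apply/funext => n; rewrite /pseries/= fctE /GRing.scale /= /GRing.scale /=.
  rewrite !mulr_sumr -big_split/=.
  by apply: eq_bigr => i _; ring.
apply/cvg_lim => //; apply: cvgD; apply: cvgZr.
all: exact: cvg_egf.
Qed.

(** Coefficients of the solution of x' = a x + f started at 0. *)
Fixpoint forced_coef (a : R) al n : R :=
  if n is n'.+1 then a * forced_coef a al n' + al n' else 0.

Lemma geometrically_bounded_forced a al : geometrically_bounded al ->
  geometrically_bounded (forced_coef a al).
Proof.
move=> [K [M [K0 M0 alKM]]]; exists K, (M + `|a| + 1).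
have N0 : 0 <= M + `|a| + 1 by rewrite !addr_ge0.
split=> //; elim=> [|n IH] /=; first by rewrite normr0 mulr_ge0.
rewrite (le_trans (ler_normD _ _))// normrM.
have H1 : `|a| * `|forced_coef a al n| <= `|a| * (K * (M + `|a| + 1) ^+ n) by rewrite ler_wpM2l.
have H2 : `|al n| <= K * (M + `|a| + 1) ^+ n.
  rewrite (le_trans (alKM n))// ler_wpM2l// lerXn2r// ?nnegrE//.
  by rewrite -addrA lerDl addr_ge0.
rewrite (le_trans (lerD H1 H2))// exprS.
have : 0 <= M * (K * (M + `|a| + 1) ^+ n) by rewrite !mulr_ge0// exprn_ge0.
by lra.
Qed.

Lemma is_derive_forced a al t : geometrically_bounded al ->
  is_derive t 1 (egf (forced_coef a al)) (a * egf (forced_coef a al) t + egf al t).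
Proof.
move=> gal; have gf := geometrically_bounded_forced a gal.
apply: is_derive_eq (is_derive_egf t gf) _ => /=.
rewrite -[in RHS](mul1r (egf al t)) -egf_lin//.
by congr (egf _ t); apply/funext => n; rewrite mul1r.
Qed.

Lemma continuous_egf al : geometrically_bounded al -> continuous (egf al).
Proof. by move=> gal; apply: is_derive_continuous => t; exact: is_derive_egf. Qed.

End egf.

(** * Flights over the plane z = 0 *)

Section flight.
Variable R : realType.
Implicit Types (a c d t s : R).

Fixpoint flight_coef c d n : R * R :=
  if n is n'.+1 then
    (c * (flight_coef c d n').1 + d * (flight_coef c d n').2 + (n' == 0)%:R,
     (flight_coef c d n').1)
  else (0, 0).

Definition phi_coef c d n := (flight_coef c d n).1.
Definition psi_coef c d n := (flight_coef c d n).2.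
Definition one_coef (n : nat) : R := (n == 0)%:R.

(** The solution (y, z) = (phi, psi) of y' = c y + d z + 1, z' = y at rest at
  time 0. The solution of z'' = c z' + d z - 1 thrown from z = 0 with speed y
  is z = y phi - psi, so everything about flights is expressed by phi and
  psi. *)
Definition phi c d t := egf (phi_coef c d) t.
Definition psi c d t := egf (psi_coef c d) t.
Definition chi c d t := 1 + d * psi c d t.

Lemma flight_coef_bound c d n :
  `|phi_coef c d n| <= (`|c| + `|d| + 1) ^+ n /\
  `|psi_coef c d n| <= (`|c| + `|d| + 1) ^+ n.
Proof.
have M1 : 1 <= `|c| + `|d| + 1 by rewrite lerDr addr_ge0.
rewrite /phi_coef /psi_coef; elim: n => [|n [IH1 IH2]] /=.
  by rewrite normr0.
have Mn : 1 <= (`|c| + `|d| + 1) ^+ n by rewrite exprn_ege1.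
have n1 : `|(n == 0)%:R : R| <= 1 by case: n {IH1 IH2 Mn} => [|n]; rewrite ?normr1 ?normr0.
split; last by rewrite (le_trans IH1)// exprS ler_peMl// (le_trans _ Mn).
rewrite (le_trans (ler_normD _ _))//.
rewrite (le_trans (lerD (ler_normD _ _) n1))// !normrM exprS.
have H1 := ler_wpM2l (normr_ge0 c) IH1; have H2 := ler_wpM2l (normr_ge0 d) IH2.
by lra.
Qed.

Lemma phi_geo c d : geometrically_bounded (phi_coef c d).
Proof.
exists 1, (`|c| + `|d| + 1); split=> [//||n]; first by rewrite !addr_ge0.
by move: n; move=> n; rewrite mul1r; have [] := flight_coef_bound c d n.
Qed.

Lemma psi_geo c d : geometrically_bounded (psi_coef c d).
Proof.
exists 1, (`|c| + `|d| + 1); split=> [//||n]; first by rewrite !addr_ge0.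
by move: n; move=> n; rewrite mul1r; have [] := flight_coef_bound c d n.
Qed.

Lemma one_geo : geometrically_bounded one_coef.
Proof.
exists 1, 1; split=> // n; rewrite expr1n mulr1 /one_coef.
by case: n => [|n]; rewrite ?normr1 ?normr0.
Qed.

Lemma egf_one t : egf one_coef t = 1.
Proof.
rewrite /egf; apply: lim_near_cst => //; near=> n.
have n0 : (0 < n)%N by near: n; exact: nbhs_infty_gt.
rewrite -(prednK n0) /pseries /series /= big_nat_recl//= big1 => [|i _].
  by rewrite expr0 fact0 divr1 mulr1 addr0.
by rewrite !mul0r.
Unshelve. all: by end_near. Qed.

Lemma phi0 c d : phi c d 0 = 0. Proof. exact: egf0. Qed.
Lemma psi0 c d : psi c d 0 = 0. Proof. exact: egf0. Qed.

Lemma is_derive_psi c d t : is_derive t 1 (psi c d) (phi c d t).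
Proof. exact: is_derive_eq (is_derive_egf t (psi_geo c d)) _. Qed.

Lemma is_derive_phi c d t :
  is_derive t 1 (phi c d) (c * phi c d t + chi c d t).
Proof.
apply: is_derive_eq (is_derive_egf t (phi_geo c d)) _.
have g1 : geometrically_bounded (fun n => c * phi_coef c d n + d * psi_coef c d n).
  exists (`|c| + `|d|), (`|c| + `|d| + 1); split; rewrite ?addr_ge0// => n.
  have [b1 b2] := flight_coef_bound c d n.
  rewrite (le_trans (ler_normD _ _))// !normrM mulrDl.
  by rewrite lerD ?ler_wpM2l.
rewrite (_ : (fun n => _) = (fun n => 1 * (c * phi_coef c d n + d * psi_coef c d n)
  + 1 * one_coef n)); last by apply/funext => n; rewrite !mul1r.
rewrite (egf_lin _ _ _ g1 one_geo) (egf_lin _ _ _ (phi_geo c d) (psi_geo c d)).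
by rewrite egf_one /chi /phi /psi; ring.
Qed.

Lemma continuous_phi c d : continuous (phi c d).
Proof. exact: is_derive_continuous (is_derive_phi c d). Qed.
Lemma continuous_psi c d : continuous (psi c d).
Proof. exact: is_derive_continuous (is_derive_psi c d). Qed.

Lemma is_derive_chi c d t : is_derive t 1 (chi c d) (d * phi c d t).
Proof.
have H := is_derive_psi c d t.
by rewrite /chi; derive_val; rewrite add0r.
Qed.

Lemma continuous_chi c d : continuous (chi c d).
Proof. exact: is_derive_continuous (is_derive_chi c d). Qed.

(** The Wronskian of the fundamental solutions phi and chi. *)
Lemma wronskian c d t :
  expR (c * t) = chi c d t ^+ 2 + c * chi c d t * phi c d t - d * phi c d t ^+ 2.
Proof.
pose Q s := (chi c d s ^+ 2 + c * chi c d s * phi c d s - d * phi c d s ^+ 2).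
pose f s := Q s * expR (- c * s).
have df s : is_derive s 1 f 0.
  have H1 := is_derive_phi c d s; have H2 := is_derive_chi c d s.
  by rewrite /f /Q; derive_val; ring.
have := @is_derive_0_is_cst _ f 0 t df.
rewrite /f mulr0 expR0 /Q phi0 {1 2}/chi psi0 -/(Q t) => fE.
have -> : Q t = Q t * expR (- c * t) * expR (c * t).
  by rewrite -mulrA mulNr -expRD addNr expR0 mulr1.
by rewrite -fE; ring.
Qed.

(** The reversed motion has friction - c. *)
Lemma flight_rev c d t : 0 <= t ->
  phi (- c) d t = expR (- c * t) * phi c d t /\
  psi (- c) d t = expR (- c * t) *
    (phi c d t ^+ 2 - (c * phi c d t + chi c d t) * psi c d t).
Proof.
move=> t0.
pose y s := phi (- c) d s - expR (- c * s) * phi c d s.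
pose z s := psi (- c) d s - expR (- c * s) *
    (phi c d s ^+ 2 - (c * phi c d s + chi c d s) * psi c d s).
have dz s : is_derive s 1 z (y s).
  have H1 := is_derive_phi c d s; have H2 := is_derive_chi c d s.
  have H3 := is_derive_psi c d s; have H4 := is_derive_psi (- c) d s.
  rewrite /z /y; derive_val.
  rewrite /chi; ring.
have dy s : is_derive s 1 y (- c * y s + d * z s).
  have H1 := is_derive_phi c d s; have H4 := is_derive_phi (- c) d s.
  rewrite /z /y; derive_val.
  have := wronskian c d s.
  have E1 : expR (- c * s) * expR (c * s) = 1.
    by rewrite mulNr -expRD addNr expR0.
  move=> W; rewrite W in E1.
  have -> : - c * phi (- c) d s + chi (- c) d s - (- c * expR (- c * s) * phi c d s +
      expR (- c * s) * (c * phi c d s + chi c d s)) =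
    (- c * phi (- c) d s + d * psi (- c) d s + 1 - expR (- c * s) * chi c d s).
    by rewrite /chi; ring.
  rewrite -E1 /chi; ring.
have y0 : y 0 = 0 by rewrite /y !phi0 mulr0 subrr.
have z0 : z 0 = 0 by rewrite /z !phi0 !psi0 expr0n/= !mulr0 subrr mulr0 subrr.
have [/eqP + /eqP] := planar_ode_zero dy dz y0 z0 t0.
by rewrite /y /z !subr_eq0 => /eqP + /eqP.
Qed.

(** The durations of the flights that return to z = 0: for z = y phi - psi to
  vanish at t for the first time, phi must be positive on the way. *)
Definition flight c d t := 0 < t /\ forall s, 0 < s <= t -> 0 < phi c d s.

(** The speed at which a flight of duration t leaves z = 0; by time reversal it
  comes back with speed launch (- c) d t. *)
Definition launch c d t := psi c d t / phi c d t.

Lemma flight_gt0 c d t : flight c d t -> 0 < t.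
Proof. by case. Qed.

Lemma flight_phi c d t : flight c d t -> 0 < phi c d t.
Proof. by case=> t0 /(_ t); apply; rewrite t0 lexx. Qed.

Lemma flight_le c d s t : flight c d t -> 0 < s <= t -> flight c d s.
Proof.
move=> [t0 phit] /andP[s0 st]; split=> // r /andP[r0 rs].
by apply: phit; rewrite r0 (le_trans rs).
Qed.

Lemma flightN c d t : flight c d t -> flight (- c) d t.
Proof.
move=> [t0 phit]; split=> // s /andP[s0 st].
by rewrite (flight_rev c d (ltW s0)).1 mulr_gt0 ?expR_gt0// phit// s0.
Qed.

Lemma psi_gt0 c d t : flight c d t -> 0 < psi c d t.
Proof.
move=> [t0 phit]; rewrite -(psi0 c d).
apply: (@derive_gt0_lt _ _ (phi c d) _ _ t0 (@continuous_psi c d)).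
  by move=> s _; exact: is_derive_psi.
by move=> s /andP[s0 st]; apply: phit; rewrite s0 ltW.
Qed.

Lemma launch_gt0 c d t : flight c d t -> 0 < launch c d t.
Proof. by move=> Jt; rewrite divr_gt0 ?psi_gt0 ?flight_phi. Qed.

Lemma launch_rev c d t : flight c d t -> launch (- c) d t =
  (phi c d t ^+ 2 - (c * phi c d t + chi c d t) * psi c d t) / phi c d t.
Proof.
move=> Jt; have t0 := ltW (flight_gt0 Jt); rewrite /launch.
have [-> ->] := flight_rev c d t0.
by rewrite -mulf_div divff ?mul1r// gt_eqF// expR_gt0.
Qed.

Lemma is_derive_launch c d t : flight c d t ->
  is_derive t 1 (launch c d) (launch (- c) d t / phi c d t).
Proof.
move=> Jt; have ph := flight_phi Jt; have ph0 : phi c d t != 0 by rewrite gt_eqF.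
have H1 := is_derive_phi c d t; have H2 := is_derive_psi c d t.
have H3 := is_derive_invf ph0 H1.
rewrite launch_rev// /launch; derive_val.
by field.
Qed.

Lemma expRc_rev c d t : flight c d t ->
  phi c d t = expR (c * t) * phi (- c) d t.
Proof.
move=> Jt; have [-> _] := flight_rev c d (ltW (flight_gt0 Jt)).
by rewrite mulrA -expRD mulNr subrr expR0 mul1r.
Qed.

Lemma near_flight c d t : flight c d t -> \near t, flight c d t.
Proof.
move=> Jt; have ph := flight_phi Jt; have [t0 phit] := Jt.
have /cvgrPdist_lt/(_ _ ph)/nbhs_ballP[e /= e0 He] := @continuous_phi c d t.
near=> u; split; first by near: u; exact: lt_nbhsr.
have ue : u < t + e by near: u; apply: lt_nbhsl; rewrite ltrDl.
move=> s /andP[s0 su]; have [st|ts] := leP s t; first by apply: phit; rewrite s0.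
have /= : ball t e s by rewrite /ball /= ltr_norml; apply/andP; split; lra.
by move=> /He; rewrite ltr_norml => /andP[]; lra.
Unshelve. all: by end_near. Qed.

(** Faster launches fly longer: the derivative of the launch speed is the
  landing speed divided by phi. *)
Lemma launch_lt c d s t : flight c d t -> 0 < s < t -> launch c d s < launch c d t.
Proof.
move=> Jt /andP[s0 st].
have J r : s <= r <= t -> flight c d r.
  by move=> /andP[sr rt]; apply: flight_le Jt _; rewrite (lt_le_trans s0).
have dl r : r \in `]s, t[ -> is_derive r 1 (launch c d) (launch (- c) d r / phi c d r).
  by rewrite in_itv /= => /andP[/ltW sr /ltW rt]; apply/is_derive_launch/J/andP.
have cl : {within `[s, t], continuous (launch c d)}.
  apply: derivable_within_continuous => r; rewrite in_itv /= => /J Jr.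
  by have := is_derive_launch Jr.
have [r] := MVT st dl cl.
rewrite in_itv /= => /andP[/ltW sr /ltW rt] E; rewrite -subr_gt0 E.
have Jr : flight c d r by apply/J/andP.
by rewrite mulr_gt0 ?subr_gt0// divr_gt0 ?flight_phi// launch_gt0//; exact: flightN.
Qed.

Lemma launch_inj c d s t : flight c d s -> flight c d t ->
  launch c d s = launch c d t -> s = t.
Proof.
move=> Js Jt E; have [st|ts|//] := ltgtP s t.
  have := launch_lt Jt; move=> /(_ s); rewrite (flight_gt0 Js) st E ltxx => H.
  by have := H isT.
have := launch_lt Js; move=> /(_ t); rewrite (flight_gt0 Jt) ts E ltxx => H.
by have := H isT.
Qed.

(** Short flights have a small launch speed: psi t = t phi(s) <= t phi t. *)
Lemma launch_small c d (e : R) : 0 < e ->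
  exists2 t, flight c d t & t < e /\ launch c d t < e.
Proof.
move=> e0.
pose dphi s := c * phi c d s + chi c d s.
have cd' : continuous dphi.
  move=> s; apply: cvgD; last exact: continuous_chi.
  by apply: cvgM; [exact: cvg_cst|exact: continuous_phi].
have dphi0 : 0 < dphi 0 by rewrite /dphi phi0 /chi psi0 !mulr0 add0r addr0.
have /cvgrPdist_lt/(_ _ dphi0)/nbhs_ballP[r /= r0 Hr] := cd' 0.
have pos s : 0 <= s < r -> 0 < dphi s.
  move=> /andP[s0 sr]; have /= : ball 0 r s by rewrite /ball/= ltr_norml; lra.
  by move=> /Hr; rewrite ltr_norml => /andP[]; lra.
have inc s u : 0 <= s -> s < u -> u < r -> phi c d s < phi c d u.
  move=> s0 su ur.
  apply: (@derive_gt0_lt _ _ dphi _ _ su (@continuous_phi c d)) => v /andP[sv vu].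
    exact: is_derive_phi.
  by apply: pos; rewrite (le_trans s0 (ltW sv)) (lt_trans vu).
pose t := Num.min (r / 2) (e / 2).
have t0 : 0 < t by rewrite lt_min !divr_gt0.
have tr : t < r by rewrite gt_min; apply/orP; left; lra.
have te : t < e by rewrite gt_min; apply/orP; right; lra.
have Jt : flight c d t.
  split=> // s /andP[s0 st]; rewrite -(phi0 c d); apply: inc => //.
  exact: le_lt_trans tr.
exists t => //; split => //; rewrite ltr_pdivrMr ?flight_phi//.
have [s /andP[s0 st]] := MVT_oo t0 (@continuous_psi c d) (fun s _ => is_derive_psi c d s).
rewrite psi0 !subr0 => ->.
have := inc _ _ (ltW s0) st tr; have := flight_phi Jt.
move=> p1 p2; rewrite mulrC (lt_trans (y := t * phi c d t))// ?ltr_pM2l// ltr_pM2r//.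
Qed.

(** The determinant of the vector field (c y + d z - 1, y) with its derivative
  along itself is multiplied by exp (c t) in time t; on z = 0 it is the
  quadratic 1 - c y - d y^2. *)
Lemma launch_quad c d t : flight c d t ->
  1 - c * launch c d t - d * launch c d t ^+ 2 =
  (psi c d t + expR (c * t) * psi (- c) d t) / phi c d t ^+ 2.
Proof.
move=> Jt; have t0 := ltW (flight_gt0 Jt).
have ph0 : phi c d t != 0 by rewrite gt_eqF ?flight_phi.
have [_ ->] := flight_rev c d t0.
rewrite mulrA -expRD mulNr subrr expR0 mul1r /launch /chi; field.
exact: ph0.
Qed.

Lemma launch_quad_gt0 c d t : flight c d t ->
  0 < 1 - c * launch c d t - d * launch c d t ^+ 2.
Proof.
move=> Jt; rewrite launch_quad// divr_gt0 ?exprn_gt0 ?flight_phi//.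
by rewrite addr_gt0 ?psi_gt0// mulr_gt0 ?expR_gt0// psi_gt0//; exact: flightN.
Qed.

Lemma launch_quad_rev c d t : flight c d t ->
  1 + c * launch (- c) d t - d * launch (- c) d t ^+ 2 =
  expR (c * t) * (1 - c * launch c d t - d * launch c d t ^+ 2).
Proof.
move=> Jt; have E := launch_quad (flightN Jt); rewrite !mulNr !opprK in E.
rewrite E (launch_quad Jt).
have ph0 : phi (- c) d t != 0 by rewrite gt_eqF// flight_phi//; exact: flightN.
have E1 : expR (c * t) * expR (- (c * t)) = 1 by rewrite -expRD subrr expR0.
have e0 : expR (c * t) != 0 by rewrite gt_eqF ?expR_gt0.
rewrite (expRc_rev Jt); apply: (mulfI e0).
rewrite [in LHS]mulrA mulrDr [expR (c * t) * (_ * psi c d t)]mulrA E1.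
by field; rewrite ph0 e0.
Qed.

(** Add the launch quadratic, multiplied by the landing speed, to the landing
  quadratic, multiplied by the launch speed. *)
Lemma launch_mul_lt c d t : flight c d t ->
  0 < 1 - d * launch c d t * launch (- c) d t.
Proof.
move=> Jt; have Jn := flightN Jt.
have P := launch_gt0 Jt; have Q := launch_gt0 Jn.
have W1 := launch_quad_gt0 Jt.
have := launch_quad_rev Jt.
have W2 := mulr_gt0 (expR_gt0 (c * t)) W1.
move=> E; rewrite -E in W2; move: P Q W1 W2.
set p := launch c d t; set q := launch (- c) d t => P Q W1 W2.
have S := addr_gt0 P Q; rewrite -(pmulr_rgt0 _ S).
have := mulr_gt0 Q W1; have := mulr_gt0 P W2; lra.
Qed.

(** The sign of c tells whether flights are accelerated or slowed down: with
  psi' for - c, the derivative of e^(ct) psi' - psi is c e^(ct) psi'. *)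
Lemma launch_rev_sub c d t : flight c d t ->
  exists2 k, 0 < k & launch (- c) d t - launch c d t = c * k.
Proof.
move=> Jt; have [t0 _] := Jt.
pose w s := phi c d s ^+ 2 - (c * phi c d s + chi c d s) * psi c d s.
pose f s := w s - psi c d s.
have df s : is_derive s 1 f (c * w s).
  have H1 := is_derive_phi c d s; have H2 := is_derive_chi c d s.
  have H3 := is_derive_psi c d s.
  rewrite /f /w; derive_val; rewrite /chi /=; ring.
have [s /andP[s0 st]] := MVT_oo t0 (is_derive_continuous df) (fun s _ => df s).
have Js : flight c d s by apply: flight_le Jt _; rewrite s0 ltW.
have ws : 0 < w s.
  have := launch_gt0 (flightN Js); rewrite launch_rev// -/(w s).
  by rewrite pmulr_lgt0// invr_gt0 flight_phi.
rewrite subr0 {2}/f /w phi0 psi0 expr0n /= mulr0 !subr0 => E.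
exists (w s * t / phi c d t); first by rewrite !mulr_gt0// invr_gt0 flight_phi.
rewrite launch_rev// -/(w t) /launch -mulrBl -/(f t) E. rewrite -/(w s); ring.
Qed.
End flight.

(** * Functions that cross zero upwards only *)

Section zeros.
Variable R : realType.
Implicit Types (c d t s : R) (f : R -> R).

Lemma near_derive_gt0 f t l : is_derive t 1 f l -> 0 < l -> f t = 0 ->
  exists2 e, 0 < e & forall s, `|s| < e -> s != 0 -> 0 < s * f (t + s).
Proof.
move=> /is_deriveP_cvg H l0 ft0.
have /cvgrPdist_lt/(_ _ l0) := H.
move=> /nbhs_ballP[e /= e0 He]; exists e => // s se s0.
have /= := He s; rewrite /ball /= sub0r normrN => /(_ se s0).
rewrite ft0 subr0 /GRing.scale /= mulr1 [s + t]addrC ltr_norml => /andP[_].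
rewrite ltrBlDr ltrDl => H2.
have s2 : 0 < s ^+ 2 by rewrite exprn_even_gt0.
suff -> : s * f (t + s) = s ^+ 2 * (s^-1 * f (t + s)) by rewrite mulr_gt0.
by rewrite mulrA expr2 mulfK.
Qed.

(** Between two successive zeros crossed upwards there would be one crossed
  downwards. *)
Lemma crossing_zeros_subset1 (D : set R) f :
  is_interval D -> (forall t, D t -> {for t, continuous f}) ->
  (forall t, D t -> f t = 0 -> exists2 l, is_derive t 1 f l & 0 < l) ->
  is_subset1 [set t | D t /\ f t = 0].
Proof.
move=> Ditv cf df.
suff H a b : D a -> f a = 0 -> D b -> f b = 0 -> ~ a < b.
  move=> a b [Da fa] [Db fb]; apply/eqP; rewrite eq_le.
  by apply/andP; split; rewrite leNgt; apply/negP; exact: H.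
move=> Da fa Db fb ab.
have Dab s : a <= s <= b -> D s by move=> sab; exact: Ditv sab.
have [l1 dfa l10] := df _ Da fa.
have [e e0 He] := near_derive_gt0 dfa l10 fa.
pose A := [set t | a < t <= b /\ f t <= 0].
have Ab : A b by split; rewrite ?ab ?lexx ?fb.
have hA : has_inf A.
  by split; [exists b|exists a => t [/andP[/ltW]]].
pose s := inf A.
have sb : s <= b by apply: ge_inf; [case: hA|].
have pos t : a < t < s -> 0 < f t.
  move=> /andP[at_ ts]; rewrite ltNge; apply/negP => ft.
  have : s <= t.
    apply: ge_inf; first by case: hA.
    by split=> //; rewrite at_ (le_trans (ltW ts)).
  by rewrite leNgt ts.
have as_ : a < s.
  apply: (@lt_le_trans _ _ (a + Num.min (e / 2) (b - a))).
    by rewrite ltrDl lt_min divr_gt0// subr_gt0.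
  apply: lb_le_inf; first by exists b.
  move=> t [/andP[at_ tb] ft]; rewrite leNgt; apply/negP => ta.
  have /He : `|t - a| < e.
    rewrite ger0_norm; last by rewrite subr_ge0 ltW.
    move: ta; rewrite -ltrBlDl lt_min => /andP[]; lra.
  rewrite subr_eq0 gt_eqF// => /(_ isT); rewrite [a + _]addrC subrK.
  by rewrite pmulr_rgt0 ?subr_gt0// ltNge ft.
have Ds : D s by apply: Dab; rewrite ltW.
have fs0 : f s = 0.
  apply/eqP; rewrite eq_le; apply/andP; split; rewrite leNgt; apply/negP => fs.
    have /cvgrPdist_lt/(_ _ fs)/nbhs_ballP[r /= r0 Hr] := cf _ Ds.
    have [t At tr] := inf_adherent r0 hA.
    have st : s <= t by apply: ge_inf => //; case: hA.
    have /Hr /= : ball s r t by rewrite /ball /= ltr_norml; rewrite -/s in tr; lra.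
    case: At => _ ft; rewrite ltr_norml => /andP[]; lra.
  have nfs : 0 < - f s by rewrite oppr_gt0.
  have /cvgrPdist_lt/(_ _ nfs)/nbhs_ballP[r /= r0 Hr] := cf _ Ds.
  pose t := s - Num.min (r / 2) ((s - a) / 2).
  have m0 : 0 < Num.min (r / 2) ((s - a) / 2).
    by rewrite lt_min !divr_gt0 ?subr_gt0.
  have mr : Num.min (r / 2) ((s - a) / 2) < r by rewrite gt_min; apply/orP; left; lra.
  have ma : Num.min (r / 2) ((s - a) / 2) < s - a by rewrite gt_min; apply/orP; right; lra.
  have /pos ft : a < t < s by rewrite /t; apply/andP; split; lra.
  have /Hr /= : ball s r t by rewrite /ball /= ltr_norml /t; lra.
  rewrite ltr_norml => /andP[]; lra.
have [l2 dfs l20] := df _ Ds fs0.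
have [r r0 Hr] := near_derive_gt0 dfs l20 fs0.
pose m := Num.min (r / 2) ((s - a) / 2).
have m0 : 0 < m by rewrite lt_min !divr_gt0 ?subr_gt0.
have mr : m < r by rewrite gt_min; apply/orP; left; lra.
have ma : m < s - a by rewrite gt_min; apply/orP; right; lra.
have := Hr (- m); rewrite normrN gtr0_norm// => /(_ mr).
rewrite oppr_eq0 gt_eqF// => /(_ isT).
have /pos : a < s - m < s by apply/andP; split; lra.
by rewrite nmulr_rgt0 ?oppr_lt0// => /lt_trans H /H; rewrite ltxx.
Qed.

Definition launch_inv c d (y : R) : R :=
  xget 0 [set u | flight c d u /\ launch c d u = y].

Lemma launch_invK c d u : flight c d u -> launch_inv c d (launch c d u) = u.
Proof.
move=> Ju; rewrite /launch_inv; case: xgetP => [v _ [Jv /launch_inj]|/(_ u)].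
  exact.
by case.
Qed.

Lemma continuous_launch c d u : flight c d u -> {for u, continuous (launch c d)}.
Proof.
move=> Ju; apply/differentiable_continuous/derivable1_diffP.
by have := is_derive_launch Ju.
Qed.

Lemma is_derive_launch_inv c d u : flight c d u ->
  is_derive (launch c d u) 1 (launch_inv c d) (phi c d u / launch (- c) d u).
Proof.
move=> Ju; have ph := flight_phi Ju; have la := launch_gt0 (flightN Ju).
rewrite -[_ / _]invrK invf_div; apply: is_derive_inverse.
- near=> v; apply: launch_invK; near: v; exact: near_flight.
- near=> v; apply: continuous_launch; near: v; exact: near_flight.
- exact: is_derive_launch.
- by rewrite mulf_neq0 ?invr_neq0// gt_eqF.
Unshelve. all: by end_near. Qed.

Lemma launch_onto c d u (y : R) : flight c d u -> 0 < y <= launch c d u ->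
  exists2 v, flight c d v & launch c d v = y /\ v <= u.
Proof.
move=> Ju /andP[y0 yu].
have [s Js [_ sy]] := launch_small c d y0.
have su : s <= u.
  rewrite leNgt; apply/negP => us.
  have := launch_lt Js; move=> /(_ u); rewrite (flight_gt0 Ju) us => /(_ isT); lra.
have cl : {within `[s, u], continuous (launch c d)}.
  apply: continuous_in_subspaceT => r; rewrite inE/= in_itv /= => /andP[sr ru].
  by apply/continuous_launch/(flight_le Ju); rewrite (lt_le_trans (flight_gt0 Js)).
have [|v] := @IVT _ _ s u y su cl.
  by rewrite ge_min le_max (ltW sy) yu orbT.
rewrite in_itv /= => /andP[sv vu] vy; exists v => //.
by apply: (flight_le Ju); rewrite vu (lt_le_trans (flight_gt0 Js)).
Qed.

End zeros.

(** * Intersections of two flight curves *)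

(** The curve of (c, d) consists of the pairs (launch speed, landing speed) of the
  flights; its slope at (P, Q) is P (1 + c Q - d Q^2) / (Q (1 - c P - d P^2)).
  At a common point of two curves the sign of the difference of the slopes is
  that of slope_cmp, a polynomial of bidegree (1, 1) in P and Q. The curve of
  slope_cmp is crossed in one direction only by a flight curve, and between two
  crossings the flight curves cross each other in one direction only. *)

Lemma finite_set_subset1 (T : choiceType) (D : set T) : is_subset1 D -> finite_set D.
Proof.
move=> D1; have [->|/set0P[x Dx]] := eqVneq D set0; first exact: finite_set0.
by apply: sub_finite_set (finite_set1 x) => y Dy; exact: D1.
Qed.

Section intersections.
Variable R : realType.
Variables c1 d1 c2 d2 : R.
Implicit Types t u : R.

Let P t := launch c1 d1 t.
Let Q t := launch (- c1) d1 t.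
Let P2 t := launch c2 d2 t.
Let Q2 t := launch (- c2) d2 t.

(** The first curve meets the second one at its point of parameter t. *)
Definition common_flight t := flight c1 d1 t /\
  exists u, [/\ flight c2 d2 u, P t = P2 u & Q t = Q2 u].

Let A := c1 - c2.
Let B := d1 - d2.
Let C := c1 * d2 - c2 * d1.

Let slope_cmp t := A + B * (P t - Q t) - C * P t * Q t.

Let dP t : flight c1 d1 t -> is_derive t 1 P (Q t / phi c1 d1 t).
Proof. exact: is_derive_launch. Qed.

Let dQ t : flight c1 d1 t -> is_derive t 1 Q (P t * expR (c1 * t) / phi c1 d1 t).
Proof.
move=> Jt; have Jn := flightN Jt.
apply: is_derive_eq (is_derive_launch Jn) _; rewrite opprK -/(P t) (expRc_rev Jt).
have e0 : expR (c1 * t) != 0 by rewrite gt_eqF ?expR_gt0.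
have p0 : phi (- c1) d1 t != 0 by rewrite gt_eqF ?flight_phi.
by field; rewrite p0 e0.
Qed.

Let d_slope_cmp t : flight c1 d1 t -> is_derive t 1 slope_cmp
  (B * (Q t / phi c1 d1 t - P t * expR (c1 * t) / phi c1 d1 t)
   - C * (Q t / phi c1 d1 t * Q t + P t * (P t * expR (c1 * t) / phi c1 d1 t))).
Proof.
move=> Jt; have H1 := dP Jt; have H2 := dQ Jt.
by rewrite /slope_cmp; derive_val; ring.
Qed.

(** Where slope_cmp vanishes, the sign of its derivative along the first curve is
  that of B (B^2 - A C) (Q - P) (1 - d1 P Q), and Q - P has the sign of c1. If
  B = 0, slope_cmp is A (1 - d1 P Q); if B^2 = A C, it is
  (A + B P) (A - B Q) / A, where - A / B is a root of 1 - c1 X - d1 X^2; in both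
  cases it does not vanish. *)
Lemma slope_cmp_crossing : c1 != 0 -> A != 0 \/ B != 0 ->
  exists2 k, k != 0 & forall t, flight c1 d1 t -> slope_cmp t = 0 ->
    exists2 l, is_derive t 1 slope_cmp l & 0 < k * l.
Proof.
move=> c10 AB.
have [B0|B0] := eqVneq B 0.
  have A0 : A != 0 by case: AB => //; rewrite B0 eqxx.
  exists 1; rewrite ?oner_eq0// => t Jt; have := launch_mul_lt Jt.
  rewrite -/(P t) -/(Q t) /slope_cmp B0 mul0r addr0.
  have -> : C = A * d1.
    have E2 : d2 = d1 - B by rewrite /B; ring.
    by rewrite /C E2 B0 /A; ring.
  have -> : A - A * d1 * P t * Q t = A * (1 - d1 * P t * Q t) by ring.
  move=> M /eqP; rewrite mulf_eq0 (negPf A0)/= => /eqP E.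
  by rewrite E ltxx in M.
have [E|E0] := eqVneq (B ^+ 2) (A * C).
  have A0 : A != 0.
    by apply: contra_neq B0 => A0; apply/eqP; rewrite -sqrf_eq0 E A0 mul0r.
  exists 1; rewrite ?oner_eq0// => t Jt Gt.
  have CE : C = A * d1 - c1 * B by rewrite /C /A /B; ring.
  have : (A + B * P t) * (A - B * Q t) = 0.
    have -> : (A + B * P t) * (A - B * Q t) =
      A * slope_cmp t + (A * C - B ^+ 2) * P t * Q t by rewrite /slope_cmp; ring.
    by rewrite Gt E subrr; ring.
  have W1 := launch_quad_gt0 Jt; have W2 := launch_quad_rev Jt.
  have {}W2 : 0 < 1 + c1 * Q t - d1 * Q t ^+ 2.
    by rewrite W2 mulr_gt0 ?expR_gt0.
  rewrite CE in E; have B2 : 0 < B ^+ 2 by rewrite exprn_even_gt0.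
  move/eqP; rewrite mulf_eq0 => /orP[]/eqP H.
    have : 0 < B ^+ 2 * (1 - c1 * P t - d1 * P t ^+ 2) by rewrite mulr_gt0.
    have -> : B ^+ 2 * (1 - c1 * P t - d1 * P t ^+ 2) =
       (B ^+ 2 - A * (A * d1 - c1 * B)) + (A + B * P t) * (d1 * (A - B * P t) - c1 * B).
      by ring.
    by rewrite H mul0r addr0 E subrr ltxx.
  have : 0 < B ^+ 2 * (1 + c1 * Q t - d1 * Q t ^+ 2) by rewrite mulr_gt0.
  have -> : B ^+ 2 * (1 + c1 * Q t - d1 * Q t ^+ 2) =
     (B ^+ 2 - A * (A * d1 - c1 * B)) + (A - B * Q t) * (d1 * (A + B * Q t) - c1 * B).
    by ring.
  by rewrite H mul0r addr0 E subrr ltxx.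
exists (c1 * B * (B ^+ 2 - A * C)).
  by rewrite !mulf_neq0// subr_eq0.
move=> t Jt Gt; exists (B * (Q t / phi c1 d1 t - P t * expR (c1 * t) / phi c1 d1 t)
   - C * (Q t / phi c1 d1 t * Q t + P t * (P t * expR (c1 * t) / phi c1 d1 t))).
  exact: d_slope_cmp.
have W1 := launch_quad_gt0 Jt; have W2 := launch_quad_rev Jt.
have M1 := launch_mul_lt Jt.
have ph := flight_phi Jt.
have [k k0 Ek] := launch_rev_sub Jt.
move: W1 W2 M1 Ek; rewrite -/(P t) -/(Q t).
set e := expR _; set p := P t in Gt *; set q := Q t in Gt *; set f := phi _ _ _ in ph *.
set W := 1 - c1 * p - d1 * p ^+ 2 => W1 W2 M1 Ek.
have CE : C = A * d1 - c1 * B by rewrite /C /A /B; ring.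
have GE : A = C * p * q - B * (p - q).
  by rewrite -[LHS]subr0 -Gt /slope_cmp -/p -/q; ring.
have fW : 0 < f * W by rewrite mulr_gt0.
rewrite -(pmulr_rgt0 _ fW).
have -> : f * W * (c1 * B * (B ^+ 2 - A * C) *
    (B * (q / f - p * e / f) - C * (q / f * q + p * (p * e / f)))) =
  c1 * (B ^+ 2 - A * C) * (B * (B * (q * W - p * (e * W)) - C * (q ^+ 2 * W + p ^+ 2 * (e * W)))).
  by field; rewrite gt_eqF.
have -> : B * (B * (q * W - p * (e * W)) - C * (q ^+ 2 * W + p ^+ 2 * (e * W))) =
  (q - p) * (B ^+ 2 - A * C) * (1 - d1 * p * q).
  have GE' : A + B * (p - q) - C * p * q = 0 by rewrite {1}GE; ring.
  rewrite -W2 /W -[RHS]subr0 -(mulr0 ((p - q) * C + 2 * p * q * d1 * B)) -GE' CE.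
  by ring.
rewrite Ek.
have -> : c1 * (B ^+ 2 - A * C) * (c1 * k * (B ^+ 2 - A * C) * (1 - d1 * p * q)) =
  c1 ^+ 2 * (B ^+ 2 - A * C) ^+ 2 * k * (1 - d1 * p * q) by ring.
have s1 : 0 < c1 ^+ 2 by rewrite exprn_even_gt0.
have s2 : 0 < (B ^+ 2 - A * C) ^+ 2 by rewrite exprn_even_gt0//= subr_eq0.
by rewrite mulr_gt0// mulr_gt0// mulr_gt0.
Qed.

Let dom t := flight c1 d1 t /\ exists2 u, flight c2 d2 u & P t = P2 u.
(** The height of the first curve over the second one, at the abscissa of the
  point of parameter t. *)
Let gap t := Q t - Q2 (launch_inv c2 d2 (P t)).

Let dom_interval : is_interval dom.
Proof.
move=> s t [Js _] [Jt [u Ju E]] r /andP[sr rt].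
have Jr : flight c1 d1 r.
  by apply: (flight_le Jt); rewrite rt (lt_le_trans (flight_gt0 Js)).
split=> //; have [|v Jv [vE _]] := @launch_onto _ _ _ _ (P r) Ju.
  rewrite launch_gt0//= -/(P2 u) -E; move: rt; rewrite le_eqVlt => /predU1P[->//|rt].
  by apply/ltW/launch_lt; rewrite ?rt ?(flight_gt0 Jr).
by exists v.
Qed.

Let gapE t u : flight c2 d2 u -> P t = P2 u -> gap t = Q t - Q2 u.
Proof. by move=> Ju E; rewrite /gap E launch_invK. Qed.

Let is_derive_gap t u : flight c1 d1 t -> flight c2 d2 u -> P t = P2 u ->
  is_derive t 1 gap (P t * expR (c1 * t) / phi c1 d1 t -
    P2 u * expR (c2 * u) / Q2 u * (Q t / phi c1 d1 t)).
Proof.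
move=> Jt Ju E; rewrite /gap.
have H1 := dP Jt; have H2 := is_derive_launch_inv Ju.
have H3 : is_derive (P t) 1 (launch_inv c2 d2) (phi c2 d2 u / launch (- c2) d2 u).
  by rewrite E.
have H4 := is_derive1_comp H3 H1.
have H5 : is_derive (launch_inv c2 d2 (P t)) 1 Q2 (P2 u * expR (c2 * u) / phi c2 d2 u).
  rewrite E launch_invK//.
  have Jn := flightN Ju.
  apply: is_derive_eq (is_derive_launch Jn) _; rewrite opprK -/(P2 u) (expRc_rev Ju).
  have e0 : expR (c2 * u) != 0 by rewrite gt_eqF ?expR_gt0.
  have p0 : phi (- c2) d2 u != 0 by rewrite gt_eqF ?flight_phi.
  by field; rewrite p0 e0.
have H6 := @is_derive1_comp _ Q2 (launch_inv c2 d2 \o P) t _ _ H5 H4.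
have H7 := dQ Jt.
have H8 := is_derive_addf H7 (is_derive_oppf H6).
apply: is_derive_eq H8 _ => /=; congr (_ - _).
have p0 : phi c2 d2 u != 0 by rewrite gt_eqF ?flight_phi.
have q0 : Q2 u != 0 by rewrite gt_eqF// launch_gt0//; exact: flightN.
have p1 : phi c1 d1 t != 0 by rewrite gt_eqF ?flight_phi.
by rewrite -/(Q2 u); field; rewrite p0 p1 q0.
Qed.

Let dom_gap_zero t : dom t /\ gap t = 0 <-> common_flight t.
Proof.
split=> [[[Jt [u Ju E]] g0]|[Jt [u [Ju E E2]]]].
  split=> //; exists u; split=> //.
  by apply/eqP; rewrite -subr_eq0 -(gapE Ju E) g0.
by split; [split=> //; exists u|rewrite (gapE Ju E) E2 subrr].
Qed.

(** Since 1 + c Q - d Q^2 = exp (c t) (1 - c P - d P^2) on a flight curve, the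
  slope difference is a multiple of the difference of two products of such
  quadratics, which is divisible by P + Q. *)
Let gap_slope t : dom t -> gap t = 0 ->
  exists2 k, 0 < k & is_derive t 1 gap (k * slope_cmp t).
Proof.
move=> [Jt [u Ju E]] g0.
have E2 : Q t = Q2 u by apply/eqP; rewrite -subr_eq0 -(gapE Ju E) g0.
have W1 := launch_quad_gt0 Jt; have W2 := launch_quad_gt0 Ju.
have V1 := launch_quad_rev Jt; have V2 := launch_quad_rev Ju.
have p0 := launch_gt0 Jt; have q0 := launch_gt0 (flightN Jt).
have ph := flight_phi Jt.
have := is_derive_gap Jt Ju E.
rewrite -E -E2.
move: W1 W2 V1 V2 p0 q0.
rewrite -/(P2 u) -/(Q2 u) -E -E2 -/(P t) -/(Q t).
set p := P t; set q := Q t; set f := phi _ _ _ in ph *.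
set e1 := expR (c1 * t); set e2 := expR (c2 * u).
set w1 := 1 - c1 * p - _; set w2 := 1 - c2 * p - _ => W1 W2 V1 V2 p0 q0 H.
exists (p * (p + q) / (f * w1 * w2)).
  have pq := addr_gt0 p0 q0.
  by rewrite divr_gt0//; [exact: mulr_gt0|rewrite mulr_gt0// mulr_gt0].
apply: is_derive_eq H _.
have -> : p * e1 / f - p * e2 / q * (q / f) = p * (e1 * w1 * w2 - e2 * w2 * w1) / (f * w1 * w2).
  by field; rewrite !gt_eqF.
rewrite -V1 -V2 /w1 /w2 /slope_cmp -/p -/q /A /B /C; ring.
Qed.

Let gap_continuous t : dom t -> {for t, continuous gap}.
Proof.
move=> [Jt [u Ju E]]; apply/differentiable_continuous/derivable1_diffP.
by have := is_derive_gap Jt Ju E.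
Qed.

Let slope_cmp_continuous t : flight c1 d1 t -> {for t, continuous slope_cmp}.
Proof.
move=> Jt; apply/differentiable_continuous/derivable1_diffP.
by have := d_slope_cmp Jt.
Qed.

(** While slope_cmp keeps its sign, gap crosses zero in one direction. *)
Let common_flight_subset1 (D : set R) : is_interval D -> D `<=` flight c1 d1 ->
  (forall t, D t -> slope_cmp t != 0) ->
  is_subset1 [set t | D t /\ common_flight t].
Proof.
move=> Ditv DJ G0.
have sgG s t : D s -> D t -> s < t -> 0 < slope_cmp s * slope_cmp t.
  move=> Ds Dt st; rewrite ltNge; apply/negP => sg.
  have Dst r : s <= r <= t -> D r by exact: Ditv.
  have cG : {within `[s, t], continuous slope_cmp}.
    apply: continuous_in_subspaceT => r; rewrite inE/= in_itv /= => rst.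
    by apply/slope_cmp_continuous/DJ/Dst.
  have [|r] := @IVT _ _ s t 0 (ltW st) cG.
    rewrite ge_min le_max; move: sg; have := G0 _ Ds; have := G0 _ Dt.
    case: (ltgtP (slope_cmp s) 0) => // s0; case: (ltgtP (slope_cmp t) 0) => // t0 _ _.
      by rewrite leNgt nmulr_rgt0// t0.
    by rewrite leNgt mulr_gt0.
  by rewrite in_itv /= => /Dst Dr /eqP; apply/negP/G0.
have sgG' s t : D s -> D t -> 0 < slope_cmp s * slope_cmp t.
  move=> Ds Dt; have [st|ts|->] := ltgtP s t; first exact: sgG.
    by rewrite mulrC; exact: sgG.
  by rewrite -expr2 exprn_even_gt0//= G0.
move=> s t [Ds /dom_gap_zero[doms gs]] [Dt /dom_gap_zero[domt gt_]].
have itv : is_interval [set r | D r /\ dom r].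
  move=> r1 r2 [Dr1 dr1] [Dr2 dr2] r rr; split; first exact: Ditv rr.
  exact: dom_interval rr.
apply: (crossing_zeros_subset1 (f := fun r => slope_cmp s * gap r) itv).
- move=> r [_ dr]; apply: cvgM; first exact: cvg_cst.
  exact: gap_continuous.
- move=> r [Dr dr] /eqP; rewrite mulf_eq0 (negPf (G0 _ Ds)) => /eqP gr.
  have [k k0 H] := gap_slope dr gr; exists (slope_cmp s * (k * slope_cmp r)).
    exact: is_derive_scalef.
  by rewrite mulrCA mulr_gt0// sgG'.
- by split=> //; rewrite gs mulr0.
- by split=> //; rewrite gt_ mulr0.
Qed.

(** If c1 = 0 the first curve is the diagonal, which the second one avoids unless
  c2 = 0. Otherwise, unless the two systems are equal, slope_cmp vanishes at most
  once, so there are at most three common points. *)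
Lemma common_flight_finite :
  finite_set common_flight \/ (c1 = 0 /\ c2 = 0) \/ (c1 = c2 /\ d1 = d2).
Proof.
have [c10|c10] := eqVneq c1 0.
  have [c20|c20] := eqVneq c2 0; first by right; left.
  left; rewrite (_ : common_flight = set0); first exact: finite_set0.
  apply/seteqP; split=> // t [Jt [u [Ju E1 E2]]].
  have [k k0] := launch_rev_sub Jt; have [k' k0'] := launch_rev_sub Ju.
  rewrite -/(P t) -/(Q t) -/(P2 u) -/(Q2 u) E1 E2 c10 mul0r => -> H.
  by have := mulf_neq0 c20 (lt0r_neq0 k0'); rewrite -H eqxx.
have [/andP[/eqP A0 /eqP B0]|] := boolP ((A == 0) && (B == 0)).
  by right; right; split; apply/eqP; rewrite -subr_eq0; apply/eqP.
rewrite negb_and => /orP AB; left.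
have [k k0 Hk] := slope_cmp_crossing c10 AB.
have Jitv : is_interval (flight c1 d1).
  move=> s t Js Jt r /andP[sr rt]; apply: (flight_le Jt).
  by rewrite rt (lt_le_trans (flight_gt0 Js)).
have G1 : is_subset1 [set t | flight c1 d1 t /\ slope_cmp t = 0].
  have := crossing_zeros_subset1 (f := fun r => k * slope_cmp r) Jitv.
  move=> H s t [Js Gs] [Jt Gt]; apply: H.
  - move=> r Jr; apply: cvgM; [exact: cvg_cst|exact: slope_cmp_continuous].
  - move=> r Jr /eqP; rewrite mulf_eq0 (negPf k0) => /eqP Gr.
    by have [l Hl kl] := Hk _ Jr Gr; exists (k * l) => //; exact: is_derive_scalef.
  - by split=> //; rewrite Gs mulr0.
  - by split=> //; rewrite Gt mulr0.
have [[z [Jz Gz]]|noz] := pselect (exists z, flight c1 d1 z /\ slope_cmp z = 0).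
  pose D1 := [set t | flight c1 d1 t /\ t < z].
  pose D2 := [set t | flight c1 d1 t /\ z < t].
  apply: (@sub_finite_set _ _ ([set t | D1 t /\ common_flight t] `|`
    [set t | D2 t /\ common_flight t] `|` [set z])).
    move=> t Ct; have Jt := Ct.1.
    have [tz|zt|->] := ltgtP t z; [left; left|left; right|right] => //.
  rewrite !finite_setU; split; [split|exact: finite_set1];
    apply/finite_set_subset1/common_flight_subset1.
  - move=> s t [Js sz] [Jt tz] r rr; split; first exact: Jitv rr.
    by case/andP: rr => _ /le_lt_trans; apply.
  - by move=> t [].
  - move=> t [Jt tz]; apply/eqP => Gt.
    by have E := G1 t z (conj Jt Gt) (conj Jz Gz); rewrite E ltxx in tz.
  - move=> s t [Js sz] [Jt tz] r rr; split; first exact: Jitv rr.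
    by case/andP: rr => sr _; exact: lt_le_trans sr.
  - by move=> t [].
  - move=> t [Jt tz]; apply/eqP => Gt.
    by have E := G1 t z (conj Jt Gt) (conj Jz Gz); rewrite E ltxx in tz.
apply/finite_set_subset1 => s t Cs Ct.
apply: (common_flight_subset1 Jitv) => //.
- by move=> r Jr; apply/eqP => Gr; apply: noz; exists r.
- by split=> //; case: Cs.
- by split=> //; case: Ct.
Qed.

End intersections.

(** * Arcs and trajectories of piecewise linear fields *)

Section arcs.
Variable R : realType.
Implicit Types (s : bool) (t r : R).

(** The side s of z = 0 is the half-space sgn s * z > 0. The symmetry
  (y, z) -> (- y, - z) exchanges the sides, which makes it possible to treat them
  together. *)
Definition sgn s : R := if s then 1 else -1.

Lemma sgnM s : sgn s * sgn s = 1.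
Proof. by case: s; rewrite /sgn ?mulr1// mulrNN mulr1. Qed.

Lemma sgn_neq0 s : sgn s != 0.
Proof. by case: s; rewrite /sgn ?oppr_eq0 oner_eq0. Qed.

Lemma sgnK s t : sgn s * (sgn s * t) = t.
Proof. by rewrite mulrA sgnM mul1r. Qed.

Lemma sgn_side t : t != 0 -> exists s, 0 < sgn s * t.
Proof.
case: (ltgtP t 0) => // t0 _; [exists false|exists true].
  by rewrite mulN1r oppr_gt0.
by rewrite mul1r.
Qed.

(** Both sides have a constant term in the x equation, so that the class of these
  systems is closed under the exchange of the sides. *)
Record params := Params {
  pa : bool -> R; pb : bool -> R; pc : bool -> R; pd : bool -> R; pm : bool -> R }.

Variable p : params.

Definition field s (q : space3 R) : space3 R :=
  (pa p s * q.1.1 + pb p s * q.2 + pm p s,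
   pc p s * q.1.2 + pd p s * q.2 - sgn s, q.1.2).

Definition traj (u : R -> space3 R) : Prop :=
  [/\ continuous u,
      forall s t, 0 < sgn s * (u t).2 -> is_derive t 1 u (field s (u t)) &
      forall t, (u t).2 = 0 -> \forall r \near t^', (u r).2 <> 0].

(** The integral curve of the field of side s through (x, y, 0), by variation of
  constants. *)
Definition arc s (x y t : R) : space3 R :=
  (expR (pa p s * t) * x
   + y * pb p s * egf (forced_coef (pa p s) (phi_coef (pc p s) (pd p s))) t
   - sgn s * pb p s * egf (forced_coef (pa p s) (psi_coef (pc p s) (pd p s))) t
   + pm p s * egf (forced_coef (pa p s) (one_coef R)) t,
   y * (pc p s * phi (pc p s) (pd p s) t + chi (pc p s) (pd p s) t)
   - sgn s * phi (pc p s) (pd p s) t,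
   y * phi (pc p s) (pd p s) t - sgn s * psi (pc p s) (pd p s) t).

Lemma arc0 s x y : arc s x y 0 = (x, y, 0).
Proof.
rewrite /arc !egf0 /= phi0 /chi psi0 mulr0 expR0 mul1r !mulr0 !subr0 !addr0 add0r.
by rewrite mulr1.
Qed.

Lemma arc_integral s x y : integral_curve (field s) (arc s x y).
Proof.
move=> t; apply/is_derive3P; rewrite /arc /field /=; split.
- have H1 := is_derive_forced (pa p s) t (phi_geo (pc p s) (pd p s)).
  have H2 := is_derive_forced (pa p s) t (psi_geo (pc p s) (pd p s)).
  have H3 := is_derive_forced (pa p s) t (one_geo R).
  rewrite egf_one in H3.
  derive_val; rewrite -/(phi _ _ t) -/(psi _ _ t); ring.
- have H1 := is_derive_phi (pc p s) (pd p s) t.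
  have H2 := is_derive_chi (pc p s) (pd p s) t.
  derive_val; rewrite /chi; ring.
- have H1 := is_derive_phi (pc p s) (pd p s) t.
  have H2 := is_derive_psi (pc p s) (pd p s) t.
  by derive_val; ring.
Qed.

Lemma integral_curve_continuous (X : space3 R -> space3 R) u :
  integral_curve X u -> continuous u.
Proof.
move=> iu t; apply/differentiable_continuous/derivable1_diffP.
by have := iu t.
Qed.

Lemma arc_unique s (u v : R -> space3 R) t0 t1 : continuous u -> continuous v ->
  (forall t, t0 < t < t1 -> is_derive t 1 u (field s (u t))) ->
  (forall t, t0 < t < t1 -> is_derive t 1 v (field s (v t))) ->
  u t0 = v t0 -> forall t, t0 <= t <= t1 -> u t = v t.
Proof.
move=> /continuous3P[cu1 cu2 cu3] /continuous3P[cv1 cv2 cv3] du dv uv0 t tt.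
pose x r := (u r).1.1 - (v r).1.1.
pose y r := (u r).1.2 - (v r).1.2.
pose z r := (u r).2 - (v r).2.
suff [] : [/\ x t = 0, y t = 0 & z t = 0].
  rewrite /x /y /z => /eqP + /eqP + /eqP.
  by rewrite !subr_eq0 => /eqP E1 /eqP E2 /eqP E3; exact: space3_eq.
apply: (@linear_ode_zero R (pa p s) (pb p s) (pc p s) (pd p s) x y z t0 t1).
- by move=> r; apply: cvgB; [exact: cu1|exact: cv1].
- by move=> r; apply: cvgB; [exact: cu2|exact: cv2].
- by move=> r; apply: cvgB; [exact: cu3|exact: cv3].
- move=> r /[dup] /du /is_derive3P[H1 _ _] /dv /is_derive3P[H2 _ _].
  by rewrite /x /z /field /= in H1 H2 *; derive_val; ring.
- move=> r /[dup] /du /is_derive3P[_ H1 _] /dv /is_derive3P[_ H2 _].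
  by rewrite /y /z /field /= in H1 H2 *; derive_val; ring.
- move=> r /[dup] /du /is_derive3P[_ _ H1] /dv /is_derive3P[_ _ H2].
  by rewrite /y /z /field /= in H1 H2 *; derive_val.
- by rewrite /x uv0 subrr.
- by rewrite /y uv0 subrr.
- by rewrite /z uv0 subrr.
- exact: tt.
Qed.

(** An orbit arc that stays on one side between two zeros of z is a flight. That
  phi stays positive is forced: while z > 0, psi < K phi with K the launch speed,
  hence psi exp (- t / K) increases. *)
Lemma flight_arc s (u : R -> space3 R) t0 t1 : continuous u -> t0 < t1 ->
  (forall t, t0 < t < t1 -> is_derive t 1 u (field s (u t))) ->
  (forall t, t0 < t < t1 -> 0 < sgn s * (u t).2) ->
  (u t0).2 = 0 -> (u t1).2 = 0 ->
  [/\ flight (pc p s) (pd p s) (t1 - t0),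
      sgn s * (u t0).1.2 = launch (pc p s) (pd p s) (t1 - t0),
      sgn s * (u t1).1.2 = - launch (- pc p s) (pd p s) (t1 - t0) &
      forall r, 0 <= r <= t1 - t0 -> u (t0 + r) = arc s (u t0).1.1 (u t0).1.2 r].
Proof.
move=> cu t01 du zu z0 z1.
set x0 := (u t0).1.1; set y0 := (u t0).1.2; set T := t1 - t0.
have T0 : 0 < T by rewrite subr_gt0.
have uE r : 0 <= r <= T -> u (t0 + r) = arc s x0 y0 r.
  apply: (@arc_unique s (fun r => u (t0 + r)) (arc s x0 y0) 0 T).
  - move=> q; apply: continuous_comp; last exact: cu.
    by apply: cvgD; [exact: cvg_cst|exact: cvg_id].
  - exact: integral_curve_continuous (arc_integral s x0 y0).
  - move=> q /andP[q0 qT]; apply/is_derive_shift3/du.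
    by rewrite /T in qT; apply/andP; split; lra.
  - by move=> q _; exact: arc_integral.
  - rewrite addr0 arc0 /x0 /y0 -z0; by case: (u t0) => -[].
have zE r : 0 <= r <= T -> sgn s * (u (t0 + r)).2 =
    sgn s * y0 * phi (pc p s) (pd p s) r - psi (pc p s) (pd p s) r.
  by move=> /uE ->; rewrite /arc /= mulrBr sgnK mulrA.
set K := sgn s * y0 in zE *.
have pos r : 0 < r < T -> psi (pc p s) (pd p s) r < K * phi (pc p s) (pd p s) r.
  move=> /andP[r0 rT]; have := zE r; rewrite (ltW r0) (ltW rT) => /(_ isT).
  have : 0 < sgn s * (u (t0 + r)).2.
    by apply: zu; rewrite /T in rT; apply/andP; split; lra.
  by move=> + E; rewrite E subr_gt0.
have K0 : 0 < K.
  have [r Jr [rT _]] := launch_small (pc p s) (pd p s) T0.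
  have := pos r; rewrite (flight_gt0 Jr) rT => /(_ isT) /(lt_trans (psi_gt0 Jr)).
  by rewrite pmulr_lgt0// flight_phi.
have zT : K * phi (pc p s) (pd p s) T = psi (pc p s) (pd p s) T.
  apply/eqP; rewrite -subr_eq0 -zE ?(ltW T0) ?lexx//.
  by rewrite /T (addrC t0) subrK z1 mulr0.
have JT : flight (pc p s) (pd p s) T.
  split=> // r /andP[r0 rT].
  have [q Jq [qr _]] := launch_small (pc p s) (pd p s) r0.
  pose h r := psi (pc p s) (pd p s) r * expR (- K^-1 * r).
  have dh r' : is_derive r' 1 h
    ((phi (pc p s) (pd p s) r' - K^-1 * psi (pc p s) (pd p s) r') * expR (- K^-1 * r')).
    have H := is_derive_psi (pc p s) (pd p s) r'.
    by rewrite /h; derive_val; ring.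
  have hqr : h q < h r.
    apply: (derive_gt0_lt qr (is_derive_continuous dh) (fun r' _ => dh r')).
    move=> r' /andP[qr' r'r]; rewrite mulr_gt0 ?expR_gt0// subr_gt0.
    rewrite mulrC ltr_pdivrMr// mulrC pos// (lt_trans (flight_gt0 Jq))//=.
    exact: lt_le_trans rT.
  have psr : 0 < psi (pc p s) (pd p s) r.
    have hq : 0 < h q by rewrite mulr_gt0 ?expR_gt0// psi_gt0.
    by have := lt_trans hq hqr; rewrite pmulr_lgt0 ?expR_gt0.
  have : psi (pc p s) (pd p s) r <= K * phi (pc p s) (pd p s) r.
    move: rT; rewrite le_eqVlt => /predU1P[->|rT]; first by rewrite zT.
    by apply/ltW/pos; rewrite r0.
  by move=> /(lt_le_trans psr); rewrite pmulr_rgt0.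
have ph : phi (pc p s) (pd p s) T != 0 by rewrite gt_eqF// flight_phi.
have KE : K = launch (pc p s) (pd p s) T by rewrite /launch -zT mulfK.
split=> //.
have -> : t1 = t0 + T by rewrite /T addrC subrK.
rewrite uE ?lexx ?(ltW T0)// /arc /= mulrBr sgnK mulrA -/K KE launch_rev// /launch.
by field.
Qed.

Lemma arc_flight s x t : flight (pc p s) (pd p s) t ->
  let y := sgn s * launch (pc p s) (pd p s) t in
  (forall r, 0 < r < t -> 0 < sgn s * (arc s x y r).2) /\
  (arc s x y t).2 = 0 /\
  (arc s x y t).1.2 = - sgn s * launch (- pc p s) (pd p s) t.
Proof.
move=> Jt y; have ph := flight_phi Jt.
have ph0 : phi (pc p s) (pd p s) t != 0 by rewrite gt_eqF.
rewrite /y /arc /=; split=> [r rt|].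
  have Jr : flight (pc p s) (pd p s) r.
    by apply: (flight_le Jt); case/andP: rt => -> /ltW.
  have -> : sgn s * (sgn s * launch (pc p s) (pd p s) t * phi (pc p s) (pd p s) r -
    sgn s * psi (pc p s) (pd p s) r) = (sgn s * sgn s) * phi (pc p s) (pd p s) r *
    (launch (pc p s) (pd p s) t - launch (pc p s) (pd p s) r).
    by rewrite {3}/launch; field; rewrite gt_eqF// flight_phi.
  by rewrite sgnM mul1r mulr_gt0 ?flight_phi// subr_gt0 launch_lt.
split; first by rewrite /launch; field.
by rewrite launch_rev// /launch; field.
Qed.

End arcs.

Section zeros_of_trajectories.
Variable R : realType.
Implicit Types (s : bool) (t r : R) (z : R -> R).

Lemma ball_cont (f : R -> R) t (e : R) : {for t, continuous f} -> 0 < e ->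
  exists2 r, 0 < r & forall t', `|t - t'| < r -> `|f t - f t'| < e.
Proof.
by move=> cf e0; have /cvgrPdist_lt/(_ _ e0)/nbhs_ballP[r r0 H] := cf; exists r.
Qed.

Lemma sgn_const z s t0 t1 t : continuous z ->
  (forall r, t0 < r < t1 -> z r != 0) -> t0 < t < t1 -> 0 < sgn R s * z t ->
  forall r, t0 < r < t1 -> 0 < sgn R s * z r.
Proof.
move=> cz z0 /andP[tt0 tt1] zt r /andP[rt0 rt1].
rewrite ltNge; apply/negP => zr.
pose f q := sgn R s * z q.
have cf : continuous f by move=> q; apply: cvgM; [exact: cvg_cst|exact: cz].
have [q qrt fq] : exists2 q, t0 < q < t1 & f q = 0.
  have [tr|rt] := leP t r.
    have [|q /andP[tq qr] fq] := @IVT_eq0 R f t r tr cf.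
      by right; rewrite /f zr ltW.
    by exists q; rewrite ?(lt_le_trans tt0 tq) ?(le_lt_trans qr).
  have [|q /andP[rq qt] fq] := @IVT_eq0 R f r t (ltW rt) cf.
    by left; rewrite /f zr ltW.
  by exists q; rewrite ?(lt_le_trans rt0 rq) ?(le_lt_trans qt).
have := z0 _ qrt; move/eqP: fq; rewrite mulf_eq0 (negPf (sgn_neq0 R s)) /= => ->.
by [].
Qed.

Lemma next_zero z t0 t2 : continuous z ->
  (forall t, z t = 0 -> \forall r \near t^', z r <> 0) ->
  t0 < t2 -> z t0 = 0 -> z t2 = 0 ->
  exists s t1, [/\ t0 < t1 <= t2, z t1 = 0 &
    forall r, t0 < r < t1 -> 0 < sgn R s * z r].
Proof.
move=> cz iz t02 z0 z2.
pose A := [set t | t0 < t <= t2 /\ z t = 0].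
have A2 : A t2 by split; rewrite ?t02 ?lexx.
have hA : has_inf A by split; [exists t2|exists t0 => t [/andP[/ltW]]].
pose t1 := inf A.
have lbA t : A t -> t1 <= t by move=> At; apply: ge_inf => //; case: hA.
have t12 : t1 <= t2 by exact: lbA.
have isol t : z t = 0 -> exists2 e, 0 < e & forall r, `|t - r| < e -> r != t -> z r <> 0.
  by move=> /iz/nbhs_ballP[e e0 H]; exists e.
have t01 : t0 < t1.
  have [e e0 He] := isol _ z0; apply: (@lt_le_trans _ _ (t0 + e)).
    by rewrite ltrDl.
  apply: lb_le_inf; first by exists t2.
  move=> t [/andP[t0t _] zt]; rewrite leNgt; apply/negP => te.
  by apply: (He t) zt; rewrite ?gt_eqF// ltr_norml; apply/andP; split; lra.
have z1 : z t1 = 0.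
  apply/eqP/negPn/negP => z1; have a0 : 0 < `|z t1| by rewrite normr_gt0.
  have [e e0 He] := ball_cont (cz t1) a0.
  have [t At te] := inf_adherent e0 hA; have t1t := lbA _ At.
  have /He : `|t1 - t| < e by rewrite ltr_norml; rewrite -/t1 in te; apply/andP; split; lra.
  by case: At => _ ->; rewrite subr0 ltxx.
have nz r : t0 < r < t1 -> z r != 0.
  move=> /andP[r0 r1]; apply/eqP => zr.
  have : A r by split=> //; rewrite r0 (le_trans (ltW r1)).
  by move=> /lbA; rewrite leNgt r1.
pose q := (t0 + t1) / 2.
have qq : t0 < q < t1 by rewrite /q; apply/andP; split; lra.
have [s sq] := sgn_side (nz _ qq).
by exists s, t1; split; [rewrite t01|exact: z1|exact: sgn_const cz nz qq sq].
Qed.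

Lemma prev_zero z t0 t2 : continuous z ->
  (forall t, z t = 0 -> \forall r \near t^', z r <> 0) ->
  t0 < t2 -> z t0 = 0 -> z t2 = 0 ->
  exists s t1, [/\ t0 <= t1 < t2, z t1 = 0 &
    forall r, t1 < r < t2 -> 0 < sgn R s * z r].
Proof.
move=> cz iz t02 z0 z2.
have [|||||s [t1 [t1t z1 H]]] := @next_zero (fun t => z (- t)) (- t2) (- t0).
- by move=> t; apply: continuous_comp; [exact: opp_continuous|exact: cz].
- move=> t /iz/nbhs_ballP[e e0 He]; apply/nbhs_ballP; exists e => // r tr rt.
  apply: He; last by rewrite eqr_opp.
  by move: tr; rewrite /ball /= -opprD normrN.
- by rewrite ltrN2.
- by rewrite opprK.
- by rewrite opprK.
exists s, (- t1); split=> //; first by apply/andP; split; lra.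
by move=> r rt; rewrite -[r]opprK; apply: H; apply/andP; split; lra.
Qed.

Variable p : params R.
Variable u : R -> space3 R.
Hypothesis u_traj : traj p u.

Lemma traj_z_continuous : continuous (fun t => (u t).2).
Proof. by case: u_traj => /continuous3P[]. Qed.

Lemma traj_isolated t : (u t).2 = 0 -> \forall r \near t^', (u r).2 <> 0.
Proof. by case: u_traj => _ _ /(_ t). Qed.

Lemma traj_dz t : (u t).2 != 0 -> is_derive t 1 (fun t => (u t).2) (u t).1.2.
Proof.
move=> /sgn_side[s st]; case: u_traj => _ /(_ s t st) /is_derive3P[_ _].
exact.
Qed.

(** Since z' = y on both sides and z has isolated zeros, the sign of y decides on
  which side a trajectory leaves z = 0. *)
Lemma traj_crossing s t : (u t).2 = 0 -> 0 < sgn R s * (u t).1.2 ->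
  exists2 e, 0 < e & forall r, t < r < t + e -> 0 < sgn R s * (u r).2.
Proof.
move=> zt yt; have [/continuous3P[_ cy cz] _ _] := u_traj.
have [e1 e10 H1] := ball_cont (cy t) (yt : 0 < _).
have /nbhs_ballP[e2 /= e20 H2] := traj_isolated zt.
exists (Num.min e1 e2); first by rewrite lt_min e10.
move=> r /andP[tr]; rewrite -ltrBlDl lt_min => /andP[r1 r2].
have nz q : t < q < r -> (u q).2 != 0.
  move=> /andP[tq qr]; apply/eqP/H2; last by rewrite gt_eqF.
  by rewrite /ball /= ltr_norml; apply/andP; split; lra.
have dz q : t < q < r -> is_derive q 1 (fun t => (u t).2) (u q).1.2.
  by move=> /nz; exact: traj_dz.
have [q /andP[tq qr]] := MVT_oo tr cz dz.
rewrite zt subr0 => ->.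
have : `|t - q| < e1 by rewrite ltr_norml; apply/andP; split; lra.
move=> /H1; rewrite mulrA => yq; apply: mulr_gt0; last by rewrite subr_gt0.
move: yq yt {H1}; case: s; rewrite /sgn ?mul1r ?mulN1r ltr_norml => /andP[]; lra.
Qed.

End zeros_of_trajectories.

Section uniqueness.
Variable R : realType.
Implicit Types (s : bool) (t r : R) (p : params R) (u v : R -> space3 R).

Lemma traj_side p u s t : traj p u -> 0 < sgn R s * (u t).2 ->
  exists2 e, 0 < e & forall r, t < r < t + e -> 0 < sgn R s * (u r).2.
Proof.
move=> tu zt; have cz := traj_z_continuous tu.
pose f q := sgn R s * (u q).2.
have cf : continuous f by move=> q; apply: cvgM; [exact: cvg_cst|exact: cz].
have [e e0 He] := ball_cont (cf t) (zt : 0 < f t).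
exists e => // r /andP[tr re].
have /He : `|t - r| < e by rewrite ltr_norml; apply/andP; split; lra.
by rewrite ltr_norml -/(f r) => /andP[]; lra.
Qed.

(** On either side the field is Lipschitz, and away from the fold line y = z = 0
  the point of z = 0 determines the side entered next. *)
Lemma traj_unique p u v t0 : traj p u -> traj p v ->
  (forall t, t0 <= t -> (v t).2 = 0 -> (v t).1.2 != 0) -> u t0 = v t0 ->
  forall t, t0 <= t -> u t = v t.
Proof.
move=> tu tv nofold uv0.
have [cu du _] := tu; have [cv dv _] := tv.
have step t : t0 <= t -> u t = v t ->
    exists2 e, 0 < e & forall r, t <= r <= t + e -> u r = v r.
  move=> t0t uvt.
  have [s [e1 e10 H1] [e2 e20 H2]] : exists2 s,
      exists2 e, 0 < e & forall r, t < r < t + e -> 0 < sgn R s * (u r).2 &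
      exists2 e, 0 < e & forall r, t < r < t + e -> 0 < sgn R s * (v r).2.
    have [zt|/sgn_side[s st]] := eqVneq (v t).2 0.
      have /sgn_side[s st] := nofold _ t0t zt.
      exists s; last exact: (traj_crossing tv).
      by apply: (traj_crossing tu); rewrite uvt.
    exists s; last exact: (traj_side tv).
    by apply: (traj_side tu); rewrite uvt.
  exists (Num.min e1 e2); first by rewrite lt_min e10.
  apply: (arc_unique (p := p) (s := s) cu cv) => // r /andP[tr].
    by rewrite -ltrBlDl lt_min !ltrBlDl => /andP[r1 r2]; apply: du; apply: H1; rewrite tr.
  by rewrite -ltrBlDl lt_min !ltrBlDl => /andP[r1 r2]; apply: dv; apply: H2; rewrite tr.
move=> t t0t; apply: contrapT => uvt.
pose A := [set r | t0 <= r /\ u r <> v r].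
have hA : has_inf A by split; [exists t|exists t0 => r []].
pose q := inf A.
have lbA r : A r -> q <= r by move=> Ar; apply: ge_inf => //; case: hA.
have t0q : t0 <= q by apply: lb_le_inf => [|r []//]; exists t.
have bef r : t0 <= r < q -> u r = v r.
  move=> /andP[t0r rq]; apply: contrapT => uvr.
  have : A r by [].
  by move=> /lbA; rewrite leNgt rq.
have uvq : u q = v q.
  move: t0q; rewrite le_eqVlt => /predU1P[<-//|t0q].
  have cuv : continuous (fun r => u r - v r).
    by move=> r; apply: cvgB; [exact: cu|exact: cv].
  apply: contrapT => /eqP; rewrite -subr_eq0 -normr_gt0 => H.
  have /cvgrPdist_lt/(_ _ H)/nbhs_ballP[e /= e0 He] := cuv q.
  pose r := q - Num.min (e / 2) ((q - t0) / 2).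
  have m0 : 0 < Num.min (e / 2) ((q - t0) / 2).
    by rewrite lt_min !divr_gt0 ?subr_gt0.
  have mr : Num.min (e / 2) ((q - t0) / 2) < e by rewrite gt_min; apply/orP; left; lra.
  have ma : Num.min (e / 2) ((q - t0) / 2) < q - t0 by rewrite gt_min; apply/orP; right; lra.
  have /He : ball q e r by rewrite /ball /= ltr_norml /r; apply/andP; split; lra.
  have -> : u r = v r by apply: bef; rewrite /r; apply/andP; split; lra.
  by rewrite subrr subr0 ltxx.
have [e e0 He] := step q t0q uvq.
have [r Ar re] := inf_adherent e0 hA.
by case: (Ar) => _; apply; apply: He; rewrite lbA//= ltW.
Qed.

(** Time reversal followed by y -> - y, which preserves the class of systems. *)
Definition rev_params p : params R :=
  Params (fun s => - pa p s) (fun s => - pb p s) (fun s => - pc p s) (pd p)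
    (fun s => - pm p s).

Definition rev u t : space3 R := ((u (- t)).1.1, - (u (- t)).1.2, (u (- t)).2).

Lemma traj_rev p u : traj p u -> traj (rev_params p) (rev u).
Proof.
move=> [/continuous3P[c1 c2 c3] du iu]; split.
- have co f : continuous f -> continuous (fun t : R => f (- t) : R).
    by move=> cf t; apply: continuous_comp; [exact: opp_continuous|exact: cf].
  apply/continuous3P; split; [exact: (co _ c1)| |exact: (co _ c3)].
  by move=> t; apply: cvgN; exact: (co _ c2).
- move=> s t /(du s)/is_derive3P[H1 H2 H3].
  have {}H1 := is_derive_oppv H1; have {}H2 := is_derive_oppf (is_derive_oppv H2).
  have {}H3 := is_derive_oppv H3.
  apply/is_derive3P; rewrite /field /rev /= in H1 H2 H3 *; split => //.
    by apply: is_derive_eq H1 _; ring.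
  by apply: is_derive_eq H2 _; ring.
- move=> t /iu/nbhs_ballP[e e0 He]; apply/nbhs_ballP; exists e => // r tr rt.
  apply: He; last by rewrite eqr_opp.
  by move: tr; rewrite /ball /= -opprD normrN.
Qed.

Lemma traj_shift p u h : traj p u -> traj p (fun t => u (h + t)).
Proof.
move=> [cu du iu]; split.
- exact: continuous_shift.
- by move=> s t zt; apply/is_derive_shift3/du.
- move=> t /iu/nbhs_ballP[e e0 He]; apply/nbhs_ballP; exists e => // r tr rt.
  apply: He; last by rewrite (inj_eq (addrI h)).
  by move: tr; rewrite /ball /= opprD addrACA subrr add0r.
Qed.

Lemma traj_unique2 p u v t0 : traj p u -> traj p v ->
  (forall t, (v t).2 = 0 -> (v t).1.2 != 0) -> u t0 = v t0 -> u = v.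
Proof.
move=> tu tv nofold uv0; apply/funext => t.
have [t0t|tt0] := leP t0 t.
  by apply: (traj_unique tu tv _ uv0 t0t) => r _; exact: nofold.
have H r : - t0 <= r -> (rev v r).2 = 0 -> (rev v r).1.2 != 0.
  by move=> _ /nofold; rewrite /rev /= oppr_eq0.
have E0 : rev u (- t0) = rev v (- t0) by rewrite /rev opprK uv0.
have : rev u (- t) = rev v (- t).
  by apply: (traj_unique (traj_rev tu) (traj_rev tv) H E0); rewrite lerN2 ltW.
rewrite /rev opprK => -[E1 /oppr_inj E2 E3].
exact: space3_eq.
Qed.

(** Replacing x by 0 gives a trajectory of the system with a = b = m = 0, so that
  uniqueness for the planar (y, z) system is a special case. *)
Definition planar_params p : params R :=
  Params (fun=> 0) (fun=> 0) (pc p) (pd p) (fun=> 0).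

Definition planar u t : space3 R := (0, (u t).1.2, (u t).2).

Lemma traj_planar p u : traj p u -> traj (planar_params p) (planar u).
Proof.
move=> [/continuous3P[c1 c2 c3] du iu]; split => //.
- by apply/continuous3P; split => //; move=> t; exact: cvg_cst.
- move=> s t /(du s)/is_derive3P[H1 H2 H3]; apply/is_derive3P; split => //=.
  by rewrite !mul0r !addr0; exact: is_derive_cst.
Qed.

Lemma planar_unique p u v t0 : traj p u -> traj p v ->
  (forall t, t0 <= t -> (v t).2 = 0 -> (v t).1.2 != 0) ->
  (u t0).1.2 = (v t0).1.2 -> (u t0).2 = (v t0).2 ->
  forall t, t0 <= t -> (u t).1.2 = (v t).1.2 /\ (u t).2 = (v t).2.
Proof.
move=> tu tv nofold E1 E2 t t0t.
have H r : t0 <= r -> (planar v r).2 = 0 -> (planar v r).1.2 != 0 by exact: nofold.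
have E0 : planar u t0 = planar v t0 by rewrite /planar E1 E2.
by have [] := traj_unique (traj_planar tu) (traj_planar tv) H E0 t0t.
Qed.

End uniqueness.

(** * Periodic orbits *)

Section periodic.
Variable R : realType.
Implicit Types (s : bool) (t r : R) (p : params R) (u v : R -> space3 R).

Lemma periodicZ (V : Type) (f : R -> V) (T : R) : (forall t, f (t + T) = f t) ->
  forall (n : int) t, f (t + n%:~R * T) = f t.
Proof.
move=> fT; have H (n : nat) t : f (t + n%:R * T) = f t.
  elim: n t => [|n IH] t; first by rewrite mul0r addr0.
  by rewrite -natr1 mulrDl mul1r addrA fT IH.
case=> n t; first exact: H.
by rewrite -(H n.+1) NegzE mulrNz mulNr subrK.
Qed.

Lemma period_reduce (T t0 t : R) : 0 < T ->
  exists n : int, t0 <= t + n%:~R * T < t0 + T.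
Proof.
move=> T0; have /andP[f1 f2] := floor_itv ((t - t0) / T).
exists (- Num.floor ((t - t0) / T)); rewrite mulrNz mulNr.
move: f1 f2; rewrite ler_pdivlMr// ltr_pdivrMr// intrD.
rewrite [(_ + 1%:~R) * T]mulrDl mulr1z mul1r => f1 f2.
by apply/andP; split; lra.
Qed.

(** Launch and landing speeds on the side s. *)
Definition speed p s t := launch (pc p s) (pd p s) t.
Definition speed' p s t := launch (- pc p s) (pd p s) t.
Definition flies p s t := flight (pc p s) (pd p s) t.

(** Flights of durations t1 and t2 on the two sides whose ends match: a cycle of
  the planar (y, z) system, and an invariant cylinder of the system in space. *)
Definition planar_cycle p (t1 t2 : R) :=
  [/\ flies p true t1, flies p false t2,
      speed p true t1 = speed' p false t2 & speed' p true t1 = speed p false t2].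

(** A periodic trajectory over a planar cycle that closes up after one turn,
  started at its upward crossing of z = 0. *)
Definition cycle p v (t1 t2 : R) :=
  [/\ traj p v, forall t, v (t + (t1 + t2)) = v t, planar_cycle p t1 t2,
      forall r, 0 <= r <= t1 -> v r = arc p true (v 0).1.1 (speed p true t1) r &
      forall r, 0 <= r <= t2 ->
        v (t1 + r) = arc p false (v t1).1.1 (- speed p false t2) r].

Lemma speed_inj p s t r : flies p s t -> flies p s r -> speed p s t <= speed p s r -> t <= r.
Proof.
move=> Jt Jr E; rewrite leNgt; apply/negP => rt.
have := launch_lt Jt; move=> /(_ r); rewrite (flight_gt0 Jr) rt => /(_ isT).
by rewrite ltNge -/(speed p s t) -/(speed p s r) E.
Qed.

Lemma speed'_mono p s t r : flies p s t -> flies p s r -> t <= r -> speed' p s t <= speed' p s r.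
Proof.
move=> Jt Jr; rewrite le_eqVlt => /predU1P[->//|tr].
by apply/ltW/launch_lt; [exact: flightN|rewrite (flight_gt0 Jt)].
Qed.

Lemma speed_gt0 p s t : flies p s t -> 0 < speed p s t.
Proof. exact: launch_gt0. Qed.

Lemma speed'_gt0 p s t : flies p s t -> 0 < speed' p s t.
Proof. by move=> Jt; exact: launch_gt0 (flightN Jt). Qed.

Lemma traj_flight p u s t0 t1 : traj p u -> t0 < t1 ->
  (forall t, t0 < t < t1 -> 0 < sgn R s * (u t).2) ->
  (u t0).2 = 0 -> (u t1).2 = 0 ->
  [/\ flies p s (t1 - t0), sgn R s * (u t0).1.2 = speed p s (t1 - t0),
      sgn R s * (u t1).1.2 = - speed' p s (t1 - t0) &
      forall r, 0 <= r <= t1 - t0 -> u (t0 + r) = arc p s (u t0).1.1 (u t0).1.2 r].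
Proof.
by move=> [cu du _] t01 zu; apply: flight_arc => // t /zu; exact: du.
Qed.

Section one_orbit.
Variables (p : params R) (u : R -> space3 R) (T : R).
Hypotheses (tu : traj p u) (T0 : 0 < T) (uT : forall t, u (t + T) = u t).

Let cz := traj_z_continuous tu.
Let iz t := @traj_isolated _ _ _ tu t.

Lemma next_flight t : (u t).2 = 0 -> exists s t1,
  [/\ t < t1 <= t + T, (u t1).2 = 0, 
  flies p s (t1 - t), sgn R s * (u t).1.2 = speed p s (t1 - t) &
      sgn R s * (u t1).1.2 = - speed' p s (t1 - t) /\
      forall r, 0 <= r <= t1 - t -> u (t + r) = arc p s (u t).1.1 (u t).1.2 r].
Proof.
move=> zt; have tT : t < t + T by rewrite ltrDl.
have ztT : (u (t + T)).2 = 0 by rewrite uT.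
have [s [t1 [t1t z1 H]]] := next_zero cz iz tT zt ztT.
have tt1 : t < t1 by case/andP: t1t.
have [H1 H2 H3 H4] := traj_flight tu tt1 H zt z1.
by exists s, t1.
Qed.

Lemma prev_flight t : (u t).2 = 0 -> exists s t1,
  [/\ t1 < t, (u t1).2 = 0, flies p s (t - t1), sgn R s * (u t1).1.2 = speed p s (t - t1) &
      sgn R s * (u t).1.2 = - speed' p s (t - t1)].
Proof.
move=> zt; have tT : t - T < t by rewrite ltrBlDr ltrDl.
have ztT : (u (t - T)).2 = 0 by rewrite -uT subrK.
have [s [t1 [t1t z1 H]]] := prev_zero cz iz tT ztT zt.
have tt1 : t1 < t by case/andP: t1t.
have [H1 H2 H3 H4] := traj_flight tu tt1 H z1 zt.
by exists s, t1.
Qed.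

Lemma periodic_nofold t : (u t).2 = 0 -> (u t).1.2 != 0.
Proof.
move=> /next_flight[s [t1 [_ _ Js E _]]]; apply/eqP => y0.
by have := speed_gt0 Js; rewrite -E y0 mulr0 ltxx.
Qed.

(** The zeros of z form a compact set modulo the period. *)
Lemma highest_crossing t0 : (u t0).2 = 0 -> exists t,
  [/\ (u t).2 = 0, 0 < (u t).1.2 &
     forall r, (u r).2 = 0 -> (u r).1.2 <= (u t).1.2].
Proof.
move=> z0.
have [q [zq yq]] : exists q, (u q).2 = 0 /\ 0 < (u q).1.2.
  have [s [t1 [tt z1 Js E1 [E2 _]]]] := next_flight z0.
  case: s Js E1 E2 => Js; rewrite /sgn ?mul1r ?mulN1r => E1 E2.
    by exists t0; rewrite E1 speed_gt0.
  by exists t1; move/oppr_inj: E2 => ->; rewrite speed'_gt0.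
have /continuous3P[_ cy _] : continuous u by case: tu.
pose K := `[t0, t0 + T] `&` ((fun t => (u t).2) @^-1` [set x | x = 0]).
have K0 : K !=set0.
  by exists t0; split => //=; rewrite in_itv /= lexx lerDl ltW.
have cK : compact K.
  apply: compact_closedI; first exact: segment_compact.
  move: (@closed_eq R 0) => cl0; exact: (iffLR (continuous_closedP _) cz _ cl0).
have [t tK tmax] := compact_EVT_max K0 cK (continuous_subspaceT cy).
have tm r : (u r).2 = 0 -> (u r).1.2 <= (u t).1.2.
  move=> zr; have [n /andP[nr1 nr2]] := @period_reduce T t0 r T0.
  rewrite -(periodicZ uT n r); apply: tmax; rewrite inE; split => /=.
    by rewrite in_itv /= nr1 ltW.
  by rewrite periodicZ.
by exists t; split => //; [move: tK; rewrite inE => -[]|exact: lt_le_trans (tm _ zq)].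
Qed.

(** The return map f of the speed at the upward crossings is increasing. At the
  crossing of highest speed y, f y <= y; and the speed y' at the previous one is
  at most y, so y = f y' <= f y. Hence f y = y. *)
Lemma orbit_planar_cycle t0 : (u t0).2 = 0 -> exists t t1 t2,
  [/\ planar_cycle p t1 t2, (u t).2 = 0, (u t).1.2 = speed p true t1,
      forall r, 0 <= r <= t1 -> u (t + r) = arc p true (u t).1.1 (speed p true t1) r &
      forall r, 0 <= r <= t2 ->
        u (t + t1 + r) = arc p false (u (t + t1)).1.1 (- speed p false t2) r].
Proof.
move=> /highest_crossing[t [zt yt tmax]].
have [s [a [/andP[ta _] za Ja Ea [Ea' arca]]]] := next_flight zt.
case: s Ja Ea Ea' arca => Ja; last first.
  by rewrite mulN1r => E; have := speed_gt0 Ja; rewrite -E oppr_gt0 ltNge (ltW yt).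
rewrite !mul1r => Ea Ea' arca.
have [s [b [/andP[ab _] zb Jb Eb [Eb' arcb]]]] := next_flight za.
have sa' := speed'_gt0 Ja.
case: s Jb Eb Eb' arcb => Jb.
  by rewrite mul1r => E; have := speed_gt0 Jb; rewrite -E Ea' oppr_gt0 ltNge (ltW sa').
rewrite !mulN1r => /eqP; rewrite eqr_oppLR => /eqP Eb /oppr_inj Eb' arcb.
have [s [e [et ze Je Ee Ee']]] := prev_flight zt.
case: s Je Ee Ee' => Je.
  by rewrite !mul1r => _ E; have := speed'_gt0 Je; rewrite -oppr_lt0 -E ltNge (ltW yt).
rewrite !mulN1r => /eqP; rewrite eqr_oppLR => /eqP Ee /oppr_inj Ee'.
have se := speed_gt0 Je.
have [s [f [fe zf Jf Ef Ef']]] := prev_flight ze.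
case: s Jf Ef Ef' => Jf; last first.
  rewrite !mulN1r => _ /oppr_inj; rewrite Ee => E.
  by have := speed'_gt0 Jf; rewrite -E oppr_gt0 ltNge (ltW se).
rewrite !mul1r Ee => Ef /oppr_inj Ef'.
(* the flights of the previous turn are at most as long as those of the next *)
have fa : e - f <= a - t.
  by apply: (speed_inj Jf Ja); rewrite -Ef -Ea; exact: tmax.
have be : t - e <= b - a.
  apply: (speed_inj Je Jb); rewrite Ef'.
  have -> : speed p false (b - a) = speed' p true (a - t).
    by apply: oppr_inj; rewrite -Eb Ea'.
  exact: speed'_mono.
have bt : (u b).1.2 = (u t).1.2.
  apply/eqP; rewrite eq_le tmax// Eb' Ee' /=; exact: speed'_mono.
exists t, (a - t), (b - a); split => //.
- split=> //; first by rewrite -Ea -bt Eb'.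
  by apply: oppr_inj; rewrite -Eb Ea'.
- by move=> r /arca ->; rewrite Ea.
- by move=> r /arcb H; rewrite (addrC t) subrK H Eb.
Qed.

End one_orbit.

End periodic.

Section cycles.
Variable R : realType.
Implicit Types (s : bool) (t r : R) (p : params R) (u v : R -> space3 R).

Lemma turn_crossings p v x0 x1 t1 t2 : planar_cycle p t1 t2 ->
  (forall r, 0 <= r <= t1 -> v r = arc p true x0 (speed p true t1) r) ->
  (forall r, 0 <= r <= t2 -> v (t1 + r) = arc p false x1 (- speed p false t2) r) ->
  [/\ (v 0).2 = 0 /\ (v 0).1.2 = speed p true t1,
      (v (t1 + t2)).2 = 0 /\ (v (t1 + t2)).1.2 = speed p true t1,
      (v t1).2 = 0 /\ (v t1).1.2 = - speed p false t2,
      forall r, 0 < r < t1 -> 0 < (v r).2 &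
      forall r, t1 < r < t1 + t2 -> (v r).2 < 0].
Proof.
move=> [J1 J2 E1 E2] a1 a2.
have t10 := flight_gt0 J1; have t20 := flight_gt0 J2.
have [p1 [z1 y1]] := arc_flight x0 J1; have [p2 [z2 y2]] := arc_flight x1 J2.
rewrite !mul1r in p1 z1 y1; rewrite !mulN1r opprK in p2 z2 y2.
split.
- by rewrite a1 ?lexx ?(ltW t10)// arc0.
- by rewrite a2 ?lexx ?(ltW t20)// z2 y2 mul1r E1.
- by rewrite -[t1]addr0 a2 ?lexx ?(ltW t20)// arc0.
- move=> r /andP[r0 rt]; rewrite a1 ?(ltW r0) ?(ltW rt)//.
  by have := p1 r; rewrite r0 rt mul1r => /(_ isT).
- move=> r /andP[r0 rt]; rewrite -[r](subrK t1) addrC a2; last first.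
    by apply/andP; split; lra.
  have := p2 (r - t1); rewrite mulN1r oppr_gt0; apply.
  by apply/andP; split; lra.
Qed.

Lemma turn_crossing0 p v x0 x1 t1 t2 r : planar_cycle p t1 t2 ->
  (forall r, 0 <= r <= t1 -> v r = arc p true x0 (speed p true t1) r) ->
  (forall r, 0 <= r <= t2 -> v (t1 + r) = arc p false x1 (- speed p false t2) r) ->
  0 <= r < t1 + t2 -> (v r).2 = 0 -> 0 < (v r).1.2 -> r = 0.
Proof.
move=> C a1 a2 /andP[r0 rT] zr yr.
have [_ _ [_ y1] p1 p2] := turn_crossings C a1 a2; have [_ J2 _ _] := C.
move: r0; rewrite le_eqVlt => /predU1P[//|r0].
have [rt|tr|rt] := ltgtP r t1.
- by have := p1 r; rewrite r0 rt zr ltxx => /(_ isT).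
- by have := p2 r; rewrite tr rT zr ltxx => /(_ isT).
- by have := speed_gt0 J2; rewrite -oppr_lt0 -y1 -rt ltNge ltW.
Qed.

(** Distinct trajectories over the same planar motion never meet, so if x changed
  over one turn it would change by an amount of the same sign over each of the
  following turns, and the orbit could not close up after several turns. *)
Lemma orbit_cycle p u T t0 : traj p u -> 0 < T -> (forall t, u (t + T) = u t) ->
  (u t0).2 = 0 -> exists t t1 t2, cycle p (fun r => u (t + r)) t1 t2.
Proof.
move=> tu T0 uT z0.
have [t [t1 [t2 [C zt yt a1 a2]]]] := orbit_planar_cycle tu T0 uT z0.
exists t, t1, t2; pose v r := u (t + r).
have tv : traj p v by exact: traj_shift.
have vT r : v (r + T) = v r by rewrite /v addrA uT.
have fold r : (v r).2 = 0 -> (v r).1.2 != 0 by exact: periodic_nofold tu T0 uT _.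
have a1' : forall r, 0 <= r <= t1 -> v r = arc p true (v 0).1.1 (speed p true t1) r.
  by move=> r /a1; rewrite /v addr0.
have a2' : forall r, 0 <= r <= t2 -> v (t1 + r) = arc p false (v t1).1.1 (- speed p false t2) r.
  by move=> r /a2; rewrite /v addrA.
pose T1 := t1 + t2; pose w r := v (T1 + r).
have tw : traj p w by exact: traj_shift.
have [[z00 y00] [zT yT] _ _ _] := turn_crossings C a1' a2'.
have [J1 J2 _ _] := C.
have T10 : 0 < T1 by rewrite addr_gt0 ?(flight_gt0 J1) ?(flight_gt0 J2).
have planar_w r : 0 <= r -> (w r).1.2 = (v r).1.2 /\ (w r).2 = (v r).2.
  apply: (planar_unique tw tv (fun q _ => @fold q)).
  - by rewrite /w addr0 y00 yT.
  - by rewrite /w addr0 z00 zT.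
suff wv : w = v.
  split=> // r; rewrite [r + _]addrC.
  by have := congr1 (fun f => f r) wv.
apply: contrapT => wv.
pose f r := (w r).1.1 - (v r).1.1.
have f0 r : 0 <= r -> f r != 0.
  move=> r0; apply/eqP => /eqP; rewrite subr_eq0 => /eqP fr.
  apply: wv; apply: (traj_unique2 (t0 := r) tw tv fold).
  by have [E1 E2] := planar_w r r0; exact: space3_eq.
have cf : continuous f.
  have [/continuous3P[cw _ _] _ _] := tw; have [/continuous3P[cv _ _] _ _] := tv.
  by move=> r; apply: cvgB; [exact: cw|exact: cv].
have fpos r : 0 <= r -> 0 < f 0 * f r.
  move=> r0; rewrite lt_neqAle eq_sym mulf_neq0 ?f0//= leNgt; apply/negP => fr.
  have [||q /andP[q0 _] fq] := @IVT_eq0 R (fun q => f 0 * f q) 0 r r0.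
  - by move=> q; apply: cvgM; [exact: cvg_cst|exact: cf].
  - by right; rewrite (ltW fr) -expr2 sqr_ge0.
  - by move/eqP: fq; rewrite mulf_eq0 (negPf (f0 _ (lexx 0))) (negPf (f0 _ q0)).
have vk (k : nat) r : 0 <= r -> (v (k%:R * T1 + r)).1.2 = (v r).1.2 /\
    (v (k%:R * T1 + r)).2 = (v r).2.
  elim: k r => [|k IH] r r0; first by rewrite mul0r add0r.
  rewrite -natr1 mulrDl mul1r -addrA.
  have [-> ->] := IH (T1 + r) (addr_ge0 (ltW T10) r0); exact: planar_w.
have xk (k : nat) : 0 < f 0 * ((v (k.+1%:R * T1)).1.1 - (v 0).1.1).
  elim: k => [|k IH].
    by rewrite mul1r; have := fpos 0 (lexx 0); rewrite {2}/f /w addr0.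
  have H : 0 <= k.+1%:R * T1 by rewrite mulr_ge0// ltW.
  have := addr_gt0 IH (fpos _ H); rewrite -mulrDr /f /w.
  rewrite -[k.+2%:R]natr1 [(_ + 1) * T1]mulrDl mul1r [k.+1%:R * T1 + T1]addrC.
  by congr (0 < _ * _); ring.
have [n /andP[n1 n2]] := @period_reduce R T1 0 T T10; rewrite add0r in n2.
have [k kE] : exists k : nat, n = - k%:Z.
  have n0 : (n < 1)%R.
    rewrite -(ltr_int R) ltNge; apply/negP => n10.
    have : T1 <= n%:~R * T1 by rewrite ler_peMl// ltW.
    by move=> H; lra.
  by exists `|n|%N; rewrite -abszN gez0_abs ?opprK// oppr_ge0 -ltzD1.
set r := T + n%:~R * T1 in n1 n2.
have TE : T = k%:R * T1 + r by rewrite /r kE mulrNz mulNr addrC subrK.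
have [E1 E2] := vk k r n1; rewrite -TE -[T]add0r vT in E1 E2.
have r0 : r = 0.
  apply: (turn_crossing0 C a1' a2').
  - by rewrite n1.
  - by rewrite -E2.
  - by rewrite -E1 y00; exact: speed_gt0.
case: k kE TE {E1 E2} => [|k] kE TE; first by rewrite TE r0 mul0r addr0 ltxx in T0.
have E : v (k.+1%:R * T1) = v 0 by rewrite -(vT 0) add0r [in RHS]TE r0 addr0.
by have := xk k; rewrite E subrr mulr0 ltxx.
Qed.

End cycles.

(** * Invariant cylinders and limit cycles *)

Section no_limit_cycle.
Variable R : realType.
Implicit Types (s : bool) (t r : R) (p : params R) (u v : R -> space3 R).

Definition xshift v (xi : R -> R) (e : R) t : space3 R :=
  ((v t).1.1 + e * xi t, (v t).1.2, (v t).2).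

Lemma traj_xshift p v (xi : R -> R) e : traj p v -> continuous xi ->
  (forall s t, 0 < sgn R s * (v t).2 -> is_derive t 1 xi (pa p s * xi t)) ->
  traj p (xshift v xi e).
Proof.
move=> [/continuous3P[c1 c2 c3] dv iv] cxi dxi; split=> //.
  apply/continuous3P; split=> //= t; apply: cvgD; first exact: c1.
  by apply: cvgM; [exact: cvg_cst|exact: cxi].
move=> s t st; have /is_derive3P[H1 H2 H3] := dv s t st; have H4 := dxi s t st.
apply/is_derive3P; rewrite /field /xshift /= in H1 H2 H3 *; split => //.
by derive_val; ring.
Qed.

Variables ap bp cp dp am bm cm dm m : R.

Let p := Params (fun s => if s then ap else am) (fun s => if s then bp else bm)
  (fun s => if s then cp else cm) (fun s => if s then dp else dm)
  (fun s => if s then 0 else m).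

Let Z : pwfield R := (Xplus ap bp cp dp, Xminus am bm cm dm m).

Lemma Z1E : Z.1 = field p true.
Proof. by apply/funext => -[[x y] z]; rewrite /field /= addr0. Qed.

Lemma Z2E : Z.2 = field p false.
Proof. by apply/funext => -[[x y] z]; rewrite /field /= /sgn opprK. Qed.

Lemma trajectoryE u : trajectory Z u <-> traj p u.
Proof.
rewrite /trajectory Z1E Z2E; split=> [[cu d1 d2 iu]|[cu du iu]]; split=> //.
- by move=> [] t; rewrite /sgn ?mul1r ?mulN1r ?oppr_gt0 => zt; [exact: d1|exact: d2].
- by move=> t zt; apply: (du true); rewrite mul1r.
- by move=> t zt; apply: (du false); rewrite mulN1r oppr_gt0.
Qed.

Lemma derive_height (v q : space3 R) : 'D_v (@height R) q = v.2.
Proof.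
rewrite /derive; apply: lim_near_cst => //; near=> h.
have h0 : h != 0 by near: h; exact: nbhs_dnbhs_neq.
by rewrite /height /= addrK /GRing.scale /= mulKf.
Unshelve. all: by end_near. Qed.

Lemma sewingE q : sewing Z q <-> q.2 = 0 /\ q.1.2 != 0.
Proof.
rewrite /sewing /= !derive_height.
have -> : (Xplus ap bp cp dp q).2 = q.1.2 by case: q => -[].
have -> : (Xminus am bm cm dm m q).2 = q.1.2 by case: q => -[].
rewrite -expr2; split=> -[q0 H]; split=> //.
  by rewrite exprn_even_gt0 in H.
by rewrite exprn_even_gt0.
Qed.

Lemma cycle_crossing v t1 t2 : cycle p v t1 t2 ->
  [/\ 0 < t1 + t2, (v 0).2 = 0, (v 0).1.2 = speed p true t1 &
      forall t, (v t).2 = 0 -> 0 < (v t).1.2 -> v t = v 0].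
Proof.
move=> [tv vT C a1 a2]; have [[z0 y0] _ _ _ _] := turn_crossings C a1 a2.
have [J1 J2 _ _] := C.
have T0 : 0 < t1 + t2 by rewrite addr_gt0 ?(flight_gt0 J1) ?(flight_gt0 J2).
split=> // t zt yt; have [n] := @period_reduce R (t1 + t2) 0 t T0.
rewrite add0r => nT; rewrite -(periodicZ vT n t) in zt yt *.
by rewrite (turn_crossing0 C a1 a2 nT zt yt).
Qed.

Lemma cycle_periodic_orbit v t1 t2 : cycle p v t1 t2 -> periodic_orbit Z (range v).
Proof.
move=> Cv; have [T0 z0 y0 _] := cycle_crossing Cv; have [tv vT [J1 _ _ _] _ _] := Cv.
split; first by exists v, (t1 + t2); split=> //; exact/trajectoryE.
exists (v 0); split; first by exists 0.
by apply/sewingE; split=> //; rewrite y0 gt_eqF// speed_gt0.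
Qed.

Lemma periodic_orbit_cycle gamma : periodic_orbit Z gamma ->
  exists v t1 t2, cycle p v t1 t2 /\ gamma = range v.
Proof.
move=> [[u [T [/trajectoryE tu T0 uT ->]]] [_ [[t0 _ <-] /sewingE[z0 _]]]].
have [t [t1 [t2 C]]] := orbit_cycle tu T0 uT z0.
exists (fun r => u (t + r)), t1, t2; split=> //; apply/seteqP; split=> _ [r _ <-].
  by exists (r - t) => //; rewrite addrC subrK.
by exists (t + r).
Qed.

Lemma turn_in_range v t1 t2 t : cycle p v t1 t2 ->
  exists2 r, 0 <= r < t1 + t2 & v t = v r.
Proof.
move=> Cv; have [T0 _ _ _] := cycle_crossing Cv; have [_ vT _ _ _] := Cv.
have [n] := @period_reduce R (t1 + t2) 0 t T0; rewrite add0r => nT.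
by exists (t + n%:~R * (t1 + t2)); [|rewrite (periodicZ vT)].
Qed.

(** The x equation is affine, so adding to x a small multiple of a periodic
  solution xi of its linear part gives further periodic orbits, as close to the
  given one as desired by compactness. *)
Lemma not_limit_cycle v t1 t2 (xi : R -> R) : cycle p v t1 t2 ->
  continuous xi -> (forall t, xi (t + (t1 + t2)) = xi t) -> xi 0 != 0 ->
  (forall s t, 0 < sgn R s * (v t).2 -> is_derive t 1 xi (pa p s * xi t)) ->
  ~ limit_cycle Z (range v).
Proof.
move=> Cv cxi xiT xi0 dxi [_ [U [oU vU uniqU]]].
have [T0 z0 y0 only0] := cycle_crossing Cv; have [tv vT [J1 _ _ _] _ _] := Cv.
set T := t1 + t2 in vT xiT T0.
have te e := traj_xshift e tv cxi dxi.
have veT e t : xshift v xi e (t + T) = xshift v xi e t by rewrite /xshift vT xiT.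
have cv2 : continuous (fun q : R * R => xshift v xi q.1 q.2).
  have [/continuous3P[c1 c2 c3] _ _] := tv.
  have sn (f : R -> R) : continuous f -> continuous (fun q : R * R => f q.2).
    move=> cf q; apply: (@continuous_comp _ _ _ snd f); last exact: cf.
    exact: cvg_snd.
  apply/continuous3P; split; [|exact: (sn (fun t => (v t).1.2))|exact: (sn (fun t => (v t).2))].
  move=> q; apply: cvgD; first exact: (sn (fun t => (v t).1.1)).
  by apply: cvgM; [exact: cvg_fst|exact: (sn _ cxi)].
have : \forall e \near (0 : R), `[0, T] `<=` [set t | U (xshift v xi e t)].
  have /compact_near_coveringP H := @segment_compact R 0 T.
  apply: (H R (nbhs (0 : R)) (fun e t => U (xshift v xi e t)) _) => t _.
  have U0 : U (xshift v xi 0 t).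
    by apply: vU; exists t => //; rewrite /xshift mul0r addr0 -!surjective_pairing.
  have /= := cv2 (0, t) U (open_nbhs_nbhs (conj oU U0)).
  case=> -[A B] /= [A0 Bt] AB; exists (B, A) => // -[t' e'] /= [Bt' Ae'].
  exact: (AB (e', t')).
move=> /nbhs_ballP[r /= r0 Hr].
pose e := r / 2; have e0 : e != 0 by rewrite gt_eqF// divr_gt0.
have eU t : 0 <= t <= T -> U (xshift v xi e t).
  move=> tT; apply: (Hr e) => /=; last by rewrite in_itv.
  by rewrite /ball /= sub0r normrN gtr0_norm /e; lra.
have eq_range : range (xshift v xi e) = range v.
  apply: uniqU.
    split; first by exists (xshift v xi e), T; split=> //; exact/trajectoryE.
    exists (xshift v xi e 0); split; first by exists 0.
    by apply/sewingE; rewrite /xshift /= z0 y0 gt_eqF ?speed_gt0.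
  move=> _ [t _ <-]; have [n] := @period_reduce R T 0 t T0; rewrite add0r.
  move=> /andP[n1 n2]; rewrite -(periodicZ (veT e) n t); apply: eU.
  by rewrite n1 ltW.
have : range v (xshift v xi e 0) by rewrite -eq_range; exists 0.
move=> [t _ vt]; have : v t = v 0.
  by apply: only0; rewrite vt /xshift /= ?z0 ?y0 ?speed_gt0.
rewrite vt /xshift => /(congr1 (fun q => q.1.1)) /= /eqP.
by rewrite -subr_eq0 addrAC subrr add0r mulf_eq0 (negPf e0) (negPf xi0).
Qed.

Definition cyl t1 t2 : set (space3 R) :=
  arcs Z.1 t1 (speed p true t1) `|` arcs Z.2 t2 (- speed p false t2).

Lemma carries_flight s x (u : R -> space3 R) tau y y' : 0 < tau ->
  integral_curve (field p s) u -> u 0 = (x, y, 0) ->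
  (forall t, 0 < t < tau -> 0 < sgn R s * (u t).2) -> xline y' (u tau) ->
  [/\ flies p s tau, sgn R s * y = speed p s tau & sgn R s * y' = - speed' p s tau].
Proof.
move=> t0 iu u0 pos [y'E z'].
have [] := @flight_arc R p s u 0 tau (integral_curve_continuous iu) t0 (fun t _ => iu t) pos.
- by rewrite u0.
- exact: z'.
by rewrite subr0 u0 y'E => ? ? ? _.
Qed.

Lemma carries_arc s tau : flies p s tau ->
  carries (field p s) [set q | 0 < sgn R s * q.2] tau (sgn R s * speed p s tau)
    (- sgn R s * speed' p s tau).
Proof.
move=> Js [[x y] z] [/= -> ->].
exists (arc p s x (sgn R s * speed p s tau)).
have [H1 [H2 H3]] := arc_flight x Js.
by split; [exact: arc_integral|rewrite arc0|exact: H1|split].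
Qed.

Lemma invariant_cylinderP C : invariant_cylinder Z C <->
  exists t1 t2, planar_cycle p t1 t2 /\ C = cyl t1 t2.
Proof.
rewrite /invariant_cylinder /cyl Z1E Z2E; split.
  move=> [y0 [y1 [t1 [t2 [[y00 y10] [t10 t20] c1 c2 ->]]]]].
  have [|u [iu u0 pu ut]] := c1 (0, y0, 0); first by [].
  have [|w [iw w0 pw wt]] := c2 (0, y1, 0); first by [].
  have [|J1] := carries_flight t10 iu u0 _ ut.
    by move=> t tt; rewrite mul1r; exact: pu.
  rewrite !mul1r => E1 E2.
  have [|J2] := carries_flight t20 iw w0 _ wt.
    by move=> t tt; rewrite mulN1r oppr_gt0; exact: pw.
  rewrite !mulN1r => E3 /oppr_inj E4.
  exists t1, t2; split; last by rewrite -E1 -E3 opprK.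
  by split=> //; [rewrite -E1 E4|rewrite -E3 E2 opprK].
move=> [t1 [t2 [[J1 J2 E1 E2] ->]]].
have H1 := carries_arc J1; have H2 := carries_arc J2.
rewrite !mul1r mulN1r in H1; rewrite !mulN1r mulNr mulN1r opprK in H2.
exists (speed p true t1), (- speed p false t2), t1, t2; split=> //.
- by rewrite oppr_lt0 !speed_gt0.
- by rewrite (flight_gt0 J1) (flight_gt0 J2).
- rewrite -E2 (_ : @SigmaP R = [set q | 0 < sgn R true * q.2])//.
  by apply/seteqP; split=> q; rewrite /SigmaP /= mul1r.
- rewrite E1 (_ : @SigmaM R = [set q | 0 < sgn R false * q.2])//.
  by apply/seteqP; split=> q; rewrite /SigmaM /= mulN1r oppr_gt0.
Qed.

Lemma cycle_cyl v t1 t2 : cycle p v t1 t2 -> range v `<=` cyl t1 t2.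
Proof.
move=> Cv _ [t _ <-]; have [r /andP[r0 rT] ->] := turn_in_range t Cv.
have [_ _ C a1 a2] := Cv; rewrite /cyl Z1E Z2E.
have [rt|tr] := leP r t1; [left|right].
  exists (arc p true (v 0).1.1 (speed p true t1)), r; split.
  - exact: arc_integral.
  - by rewrite arc0.
  - by rewrite r0.
  - by rewrite a1// r0.
exists (arc p false (v t1).1.1 (- speed p false t2)), (r - t1); split.
- exact: arc_integral.
- by rewrite arc0.
- by apply/andP; split; lra.
- rewrite -a2; first by rewrite addrC subrK.
  by apply/andP; split; lra.
Qed.

Lemma arcs_on_Sigma s t q : flies p s t ->
  arcs (field p s) t (sgn R s * speed p s t) q -> q.2 = 0 ->
  q.1.2 = sgn R s * speed p s t \/ q.1.2 = - sgn R s * speed' p s t.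
Proof.
move=> Js [u [r [iu [y0 z0] rt ->]]] zr.
have uE : u r = arc p s (u 0).1.1 (sgn R s * speed p s t) r.
  apply: (@arc_unique _ p s u _ 0 t) => //.
  - exact: integral_curve_continuous iu.
  - exact: integral_curve_continuous (arc_integral _ _ _ _).
  - by move=> ? _; exact: arc_integral.
  - by rewrite arc0; apply: space3_eq.
have [H1 [H2 H3]] := arc_flight (u 0).1.1 Js.
move: rt => /andP[]; rewrite le_eqVlt => /predU1P[r0|r0]; first by left; rewrite -r0.
rewrite le_eqVlt => /predU1P[rt|rt]; first by right; rewrite uE rt.
by have := H1 r; rewrite r0 rt -uE zr mulr0 ltxx => /(_ isT).
Qed.

(** The cylinder meets z = 0 in two lines, which determine both speeds, hence both
  durations. *)
Lemma cyl_inj t1 t2 r1 r2 : planar_cycle p t1 t2 -> planar_cycle p r1 r2 ->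
  cyl t1 t2 = cyl r1 r2 -> t1 = r1 /\ t2 = r2.
Proof.
move=> [J1 J2 E1 E2] [K1 K2 F1 F2] E.
have : cyl t1 t2 (0, speed p true t1, 0).
  left; exists (arc p true 0 (speed p true t1)), 0.
  rewrite arc0 lexx (ltW (flight_gt0 J1)); split=> //.
  by rewrite Z1E; exact: arc_integral.
rewrite E /cyl Z1E Z2E => H.
have y1 : speed p true t1 = speed p true r1.
  case: H => H.
    have := @arcs_on_Sigma true r1 (0, speed p true t1, 0) K1; rewrite !mul1r mulN1r.
    move=> /(_ H erefl) /= [//|H1]; have := speed_gt0 J1.
    by rewrite H1 oppr_gt0 ltNge ltW// speed'_gt0.
  have := @arcs_on_Sigma false r2 (0, speed p true t1, 0) K2.
  rewrite mulN1r mulNr mulN1r opprK => /(_ H erefl) /= [H1|->]; last by rewrite F1.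
  by have := speed_gt0 J1; rewrite H1 oppr_gt0 ltNge ltW// speed_gt0.
have tr : t1 = r1 by exact: launch_inj J1 K1 y1.
by split=> //; apply: launch_inj J2 K2 _; rewrite -/(speed p false t2) -E2 tr F2.
Qed.

(** A periodic orbit lies on a cylinder; and if a vanishes on both sides, it can be
  translated in the direction of x. *)
Lemma no_cylinder_no_limit_cycle :
  ap ^+ 2 + am ^+ 2 = 0 \/ ~ (exists C, invariant_cylinder Z C) ->
  ~ exists gamma, limit_cycle Z gamma.
Proof.
move=> H [gamma lg]; have [v [t1 [t2 [Cv E]]]] := periodic_orbit_cycle lg.1.
case: H => [/eqP a0|]; last first.
  apply; exists (cyl t1 t2); apply/invariant_cylinderP; exists t1, t2; split=> //.
  by case: Cv.
move: a0; rewrite paddr_eq0 ?sqr_ge0// !sqrf_eq0 => /andP[/eqP ap0 /eqP am0].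
rewrite E in lg; apply: (@not_limit_cycle v t1 t2 (cst 1) Cv) lg => //.
- by move=> t; exact: cvg_cst.
- by rewrite oner_eq0.
- move=> s t _; apply: is_derive_eq (is_derive_cst _ _ _) _.
  by case: s; rewrite /= ?ap0 ?am0 mul0r.
Qed.

(** Two periodic orbits on the same cylinder have the same (y, z) motion, and the
  difference of their x coordinates is a periodic solution of the linear part of
  the x equation. *)
Lemma unique_cylinder_limit_cycle : is_subset1 [set C | invariant_cylinder Z C] ->
  forall C, invariant_cylinder Z C ->
    is_subset1 [set gamma | limit_cycle Z gamma /\ gamma `<=` C].
Proof.
move=> uC C _ g g' [lg _] [lg' _].
have [v [t1 [t2 [Cv E]]]] := periodic_orbit_cycle lg.1.
have [v' [r1 [r2 [Cv' E']]]] := periodic_orbit_cycle lg'.1.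
have [tv vT C1 _ _] := Cv; have [tv' vT' C1' _ _] := Cv'.
have [e1 e2] : t1 = r1 /\ t2 = r2.
  apply: cyl_inj => //; apply: uC; apply/invariant_cylinderP;
    by [exists t1, t2|exists r1, r2].
rewrite -{}e1 -{}e2 {r1 r2} in Cv' vT' C1'.
have [T0 z0 y0 _] := cycle_crossing Cv; have [_ z0' y0' _] := cycle_crossing Cv'.
have fold u t : cycle p u t1 t2 -> (u t).2 = 0 -> (u t).1.2 != 0.
  by move=> [tu uT _ _ _]; exact: periodic_nofold tu T0 uT t.
have [x0|x0] := eqVneq (v 0).1.1 (v' 0).1.1.
  rewrite E E'; suff -> : v = v' by []; apply: (traj_unique2 (t0 := 0) tv tv').
    by move=> t; exact: fold.
  by apply: space3_eq; rewrite ?y0 ?z0.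
exfalso; pose xi t := (v' t).1.1 - (v t).1.1.
have pl t : (v' t).1.2 = (v t).1.2 /\ (v' t).2 = (v t).2.
  have [n] := @period_reduce R (t1 + t2) 0 t T0; rewrite add0r => /andP[n0 _].
  rewrite -(periodicZ vT n t) -(periodicZ vT' n t).
  apply: (planar_unique (t0 := 0) tv' tv _ _ _ n0).
  - by move=> q _; exact: fold.
  - by rewrite y0 y0'.
  - by rewrite z0 z0'.
rewrite E in lg; apply: (@not_limit_cycle v t1 t2 xi Cv) lg.
- have [/continuous3P[c1 _ _] _ _] := tv; have [/continuous3P[c1' _ _] _ _] := tv'.
  by move=> t; apply: cvgB; [exact: c1'|exact: c1].
- by move=> t; rewrite /xi vT vT'.
- by rewrite /xi subr_eq0 eq_sym.
- move=> s t zt; have [_ zE] := pl t.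
  have zt' : 0 < sgn R s * (v' t).2 by rewrite zE.
  have [_ dv _] := tv; have [_ dv' _] := tv'.
  have /is_derive3P[H1 _ _] := dv s t zt; have /is_derive3P[H2 _ _] := dv' s t zt'.
  rewrite /field /= zE in H1 H2; rewrite /xi; derive_val; rewrite /=; ring.
Qed.

End no_limit_cycle.

(** * Closing up two arcs *)

Section gluing.
Variable R : realType.
Implicit Types (s : bool) (t r : R) (p : params R) (u v : R -> space3 R).

Section closing_up.
Variables (p : params R) (t1 t2 x0 : R).
Hypothesis C : planar_cycle p t1 t2.

Let U := arc p true x0 (speed p true t1).
Let L := arc p false (U t1).1.1 (- speed p false t2).

Hypothesis closed : (L t2).1.1 = x0.

Let T := t1 + t2.
Let J1 : flies p true t1. Proof. by case: C. Qed.
Let J2 : flies p false t2. Proof. by case: C. Qed.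
Let t10 : 0 < t1. Proof. exact: flight_gt0 J1. Qed.
Let t20 : 0 < t2. Proof. exact: flight_gt0 J2. Qed.
Let T0 : 0 < T. Proof. exact: addr_gt0. Qed.

Let UL : U t1 = L 0.
Proof.
have [_ [z1 y1]] := arc_flight x0 J1; rewrite !mul1r mulN1r in z1 y1.
have z1' : (U t1).2 = 0 by exact: z1.
have y1' : (U t1).1.2 = - speed' p true t1 by exact: y1.
rewrite /L arc0; apply: space3_eq => //.
by rewrite y1'; case: C => _ _ _ ->.
Qed.

Let LU : L t2 = U 0.
Proof.
have [_ [z2 y2]] := arc_flight (U t1).1.1 J2.
rewrite !mulN1r opprK mul1r in z2 y2.
have z2' : (L t2).2 = 0 by exact: z2.
have y2' : (L t2).1.2 = speed' p false t2 by exact: y2.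
rewrite /U arc0; apply: space3_eq => //.
by rewrite y2'; case: C => _ _ ->.
Qed.

Definition turn t := if t <= t1 then U t else L (t - t1).
Definition loop t := turn (t - (Num.floor (t / T))%:~R * T).

Let floor_eq (n : int) t : n%:~R * T <= t < (n + 1)%:~R * T -> Num.floor (t / T) = n.
Proof.
by move=> nt; apply: floor_def; rewrite ler_pdivlMr// ltr_pdivrMr.
Qed.

Let intS (n : int) : (n + 1)%:~R * T = n%:~R * T + T.
Proof. by rewrite intrD mulrDl mulr1z mul1r. Qed.

Let loopU (n : int) r : n%:~R * T <= r <= n%:~R * T + t1 ->
  loop r = U (- (n%:~R * T) + r).
Proof.
move=> /andP[nr rn]; rewrite /loop (@floor_eq n).
  by rewrite /turn lerBlDl rn addrC.
by rewrite nr intS /= (le_lt_trans rn)// ltrD2l ltrDl.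
Qed.

Let loopL (n : int) r : n%:~R * T + t1 <= r <= n%:~R * T + T ->
  loop r = L (- (n%:~R * T + t1) + r).
Proof.
move=> /andP[nr]; rewrite le_eqVlt => /predU1P[->|rn].
  rewrite -intS (@loopU (n + 1)) ?lexx ?lerDl ?(ltW t10)//.
  by rewrite addNr -LU intS; congr L; rewrite /T; ring.
move: nr; rewrite le_eqVlt => /predU1P[<-|nr].
  by rewrite (@loopU n) ?lexx ?lerDl ?(ltW t10)// addKr addNr UL.
rewrite /loop (@floor_eq n); last first.
  by rewrite intS rn andbT (le_trans _ (ltW nr))// lerDl ltW.
by rewrite /turn lerBlDl leNgt nr /=; congr L; ring.
Qed.

Let piece s := if s then U else L.

Let piece_integral s : integral_curve (field p s) (piece s).
Proof. by case: s; exact: arc_integral. Qed.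

Let piece_continuous s : continuous (piece s).
Proof. exact: integral_curve_continuous (piece_integral s). Qed.

Let U_pos r : 0 < r < t1 -> 0 < (U r).2.
Proof.
by have [H _] := arc_flight x0 J1; move=> /H; rewrite !mul1r.
Qed.

Let L_neg r : 0 < r < t2 -> (L r).2 < 0.
Proof.
by have [H _] := arc_flight (U t1).1.1 J2; move=> /H; rewrite !mulN1r oppr_gt0.
Qed.

(** Locally, the loop is one arc to the left of t and one arc to the right, which
  differ only at the crossings. *)
Let local_arcs t : exists s h s' h' (e : R),
  [/\ 0 < e,
      forall r, t - e < r <= t -> loop r = piece s (h + r) /\
         (r < t -> 0 < sgn R s * (loop r).2),
      forall r, t <= r < t + e -> loop r = piece s' (h' + r) /\
         (t < r -> 0 < sgn R s' * (loop r).2) &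
      (loop t).2 != 0 -> (s = s' /\ h = h') /\ 0 < sgn R s * (loop t).2].
Proof.
have TE : T = t1 + t2 by [].
have inU (n : int) r : n%:~R * T < r < n%:~R * T + t1 ->
    0 < sgn R true * (loop r).2.
  move=> /andP[nr rn]; rewrite mul1r (@loopU n) ?(ltW nr) ?(ltW rn)//.
  by apply: U_pos; apply/andP; split; lra.
have inL (n : int) r : n%:~R * T + t1 < r < n%:~R * T + T ->
    0 < sgn R false * (loop r).2.
  move=> /andP[nr rn]; rewrite mulN1r oppr_gt0 (@loopL n) ?(ltW nr) ?(ltW rn)//.
  by apply: L_neg; apply/andP; split; lra.
have /andP[f1 f2] := floor_itv (t / T).
set n := Num.floor (t / T) in f1 f2.
rewrite ler_pdivlMr// in f1; rewrite ltr_pdivrMr// intS in f2.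
have zU (k : int) : (loop (k%:~R * T)).2 = 0.
  by rewrite (@loopU k) ?lexx ?lerDl ?(ltW t10)// addNr /U arc0.
have zL (k : int) : (loop (k%:~R * T + t1)).2 = 0.
  rewrite (@loopL k) ?lexx ?lerD2l ?TE ?lerDl ?(ltW t20)//.
  by rewrite addNr /L arc0.
have N1 : ((n - 1)%:~R : R) * T = n%:~R * T - T.
  by rewrite intrB mulrBl mulr1z mul1r.
move: f1; rewrite le_eqVlt => /predU1P[tE|f1].
  exists false, (- ((n - 1)%:~R * T + t1)), true, (- (n%:~R * T)), (Num.min t1 t2).
  split; first by rewrite lt_min t10.
  - move=> r /andP[tr rt]; rewrite ltrBlDl -ltrBlDr lt_min in tr.
    case/andP: tr => tr1 tr2; split.
      by apply: loopL; rewrite N1; apply/andP; split; lra.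
    by move=> r't; apply: (inL (n - 1)); rewrite N1; apply/andP; split; lra.
  - move=> r /andP[tr rt]; rewrite -ltrBlDl lt_min in rt.
    case/andP: rt => rt1 rt2; split.
      by apply: loopU; apply/andP; split; lra.
    by move=> r't; apply: (inU n); apply/andP; split; lra.
  - by rewrite -tE zU eqxx.
have [tt1|t1t|tE] := ltgtP t (n%:~R * T + t1).
- pose e := Num.min (t - n%:~R * T) (n%:~R * T + t1 - t).
  have lt_e x : x < e -> x < t - n%:~R * T /\ x < n%:~R * T + t1 - t.
    by rewrite lt_min => /andP.
  exists true, (- (n%:~R * T)), true, (- (n%:~R * T)), e.
  split; first by rewrite lt_min; apply/andP; split; lra.
  - move=> r /andP[tr rt]; have [] := lt_e (t - r); first by lra.
    move=> tr1 tr2; split; first by apply: loopU; apply/andP; split; lra.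
    by move=> r't; apply: (inU n); apply/andP; split; lra.
  - move=> r /andP[tr rt]; have [] := lt_e (r - t); first by lra.
    move=> tr1 tr2; split; first by apply: loopU; apply/andP; split; lra.
    by move=> r't; apply: (inU n); apply/andP; split; lra.
  - by move=> _; split=> //; apply: (inU n); rewrite f1.
- pose e := Num.min (t - (n%:~R * T + t1)) (n%:~R * T + T - t).
  have lt_e x : x < e -> x < t - (n%:~R * T + t1) /\ x < n%:~R * T + T - t.
    by rewrite lt_min => /andP.
  exists false, (- (n%:~R * T + t1)), false, (- (n%:~R * T + t1)), e.
  split; first by rewrite lt_min; apply/andP; split; lra.
  - move=> r /andP[tr rt]; have [] := lt_e (t - r); first by lra.
    move=> tr1 tr2; split; first by apply: loopL; apply/andP; split; lra.
    by move=> r't; apply: (inL n); apply/andP; split; lra.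
  - move=> r /andP[tr rt]; have [] := lt_e (r - t); first by lra.
    move=> tr1 tr2; split; first by apply: loopL; apply/andP; split; lra.
    by move=> r't; apply: (inL n); apply/andP; split; lra.
  - by move=> _; split=> //; apply: (inL n); rewrite t1t.
- exists true, (- (n%:~R * T)), false, (- (n%:~R * T + t1)), (Num.min t1 t2).
  split; first by rewrite lt_min t10.
  - move=> r /andP[tr rt]; rewrite ltrBlDl -ltrBlDr lt_min in tr.
    case/andP: tr => tr1 tr2; split.
      by apply: loopU; apply/andP; split; lra.
    by move=> r't; apply: (inU n); apply/andP; split; lra.
  - move=> r /andP[tr rt]; rewrite -ltrBlDl lt_min in rt.
    case/andP: rt => rt1 rt2; split.
      by apply: loopL; apply/andP; split; lra.
    by move=> r't; apply: (inL n); apply/andP; split; lra.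
  - by rewrite tE zL eqxx.
Qed.

Let traj_loop : traj p loop.
Proof.
split.
- move=> t; have [s [h [s' [h' [e [e0 Hl Hr _]]]]]] := local_arcs t.
  apply: (@glue_continuous _ _ (fun r => piece s (h + r))
    (fun r => piece s' (h' + r))).
  + apply/nbhs_ballP; exists e => // r; rewrite /ball /= ltr_norml => /andP[r1 r2].
    split=> rt; [have [] := Hl r|have [] := Hr r] => //; apply/andP; split; lra.
  + by apply: (continuous_shift (u := piece s)); exact: piece_continuous.
  + by apply: (continuous_shift (u := piece s')); exact: piece_continuous.
- move=> s0 t zt; have [s [h [s' [h' [e [e0 Hl Hr]]]]]] := local_arcs t.
  have z0 : (loop t).2 != 0 by apply: contraTneq zt => ->; rewrite mulr0 ltxx.
  move=> /(_ z0) [[es eh] st]; rewrite -{}es -{}eh in Hr.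
  have ss : s0 = s.
    move: zt st {Hl Hr}; case: s0; case: s => //; rewrite /sgn ?mul1r ?mulN1r; lra.
  have E : \forall r \near t, piece s (h + r) = loop r.
    apply/nbhs_ballP; exists e => // r; rewrite /ball /= ltr_norml => /andP[r1 r2].
    have [rt|tr] := leP r t.
      by have [|-> _ //] := Hl r; apply/andP; split; lra.
    by have [|-> _ //] := Hr r; apply/andP; split; lra.
  apply: (near_eq_is_derive E).
  rewrite ss -(nbhs_singleton E); apply: is_derive_shift3; exact: piece_integral.
- move=> t _; have [s [h [s' [h' [e [e0 Hl Hr _]]]]]] := local_arcs t.
  apply/nbhs_ballP; exists e => // r; rewrite /ball /= ltr_norml => /andP[r1 r2].
  move=> rt z0; have [r't|tr|E] := ltgtP r t; last by rewrite E eqxx in rt.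
    have [|_] := Hl r; first by apply/andP; split; lra.
    by rewrite z0 mulr0 ltxx => /(_ r't).
  have [|_] := Hr r; first by apply/andP; split; lra.
  by rewrite z0 mulr0 ltxx => /(_ tr).
Qed.

Lemma cycle_loop : cycle p loop t1 t2 /\ (loop 0).1.1 = x0.
Proof.
have l0 r : 0 <= r <= t1 -> loop r = U r.
  by move=> r1; rewrite (@loopU 0) ?mul0r ?add0r ?oppr0 ?add0r.
have U0 : (U 0).1.1 = x0 by rewrite /U arc0.
split; last by rewrite l0 ?lexx ?(ltW t10).
split=> //.
- move=> t; rewrite /loop -/T mulrDl divff ?gt_eqF//.
  rewrite (_ : Num.floor (t / T + 1) = Num.floor (t / T) + 1); last first.
    apply: floor_def; have := floor_itv (t / T); rewrite !intrD !mulr1z.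
    by move=> /andP[? ?]; apply/andP; split; lra.
  by rewrite intS; congr turn; ring.
- by move=> r r1; rewrite l0// l0 ?U0 ?lexx ?(ltW t10).
- move=> r /andP[r1 r2]; rewrite (l0 t1) ?lexx ?(ltW t10)//.
  rewrite (@loopL 0) ?mul0r ?add0r; first by rewrite addKr.
  by rewrite lerDl r1 lerD2l.
Qed.

End closing_up.
End gluing.

(** * Flights fill the half-plane *)

Section planar_arcs.
Variable R : realType.
Implicit Types c d t r s y z : R.

(** The flow of (y, z)' = (c y + d z - 1, y). *)
Definition flow_y c d y z r :=
  y * (c * phi c d r + chi c d r) + z * (d * phi c d r) - phi c d r.
Definition flow_z c d y z r := y * phi c d r + z * chi c d r - psi c d r.

Definition arc_y c d t r := flow_y c d (launch c d t) 0 r.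
Definition arc_z c d t r := flow_z c d (launch c d t) 0 r.

Lemma is_derive_flow_z c d y z r :
  is_derive r 1 (flow_z c d y z) (flow_y c d y z r).
Proof.
have H1 := is_derive_phi c d r; have H2 := is_derive_psi c d r.
have H3 := is_derive_chi c d r.
by rewrite /flow_z /flow_y; derive_val; ring.
Qed.

Lemma is_derive_flow_y c d y z r :
  is_derive r 1 (flow_y c d y z) (c * flow_y c d y z r + d * flow_z c d y z r - 1).
Proof.
have H1 := is_derive_phi c d r; have H2 := is_derive_psi c d r.
have H3 := is_derive_chi c d r.
by rewrite /flow_z /flow_y; derive_val; rewrite /chi; ring.
Qed.

Lemma flow_y0 c d y z : flow_y c d y z 0 = y.
Proof. by rewrite /flow_y phi0 /chi psi0; ring. Qed.

Lemma flow_z0 c d y z : flow_z c d y z 0 = z.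
Proof. by rewrite /flow_z phi0 /chi psi0; ring. Qed.

Lemma flow_continuous c d :
  continuous (fun q : (R * R) * R => flow_y c d q.1.1 q.1.2 q.2) /\
  continuous (fun q : (R * R) * R => flow_z c d q.1.1 q.1.2 q.2).
Proof.
have c1 : continuous (fun q : (R * R) * R => q.1.1).
  by move=> q; apply: cvg_comp; [exact: cvg_fst|exact: cvg_fst].
have c2 : continuous (fun q : (R * R) * R => q.1.2).
  by move=> q; apply: cvg_comp; [exact: cvg_fst|exact: cvg_snd].
have c3 (f : R -> R) : continuous f -> continuous (fun q : (R * R) * R => f q.2).
  move=> cf q; apply: (@continuous_comp _ _ _ snd f); last exact: cf.
  exact: cvg_snd.
have cph := c3 _ (@continuous_phi _ c d); have cps := c3 _ (@continuous_psi _ c d).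
have cch := c3 _ (@continuous_chi _ c d).
split=> q; rewrite /flow_y /flow_z.
  apply: cvgB; last exact: cph.
  apply: cvgD.
    apply: cvgM; first exact: c1.
    by apply: cvgD; [apply: cvgM; [exact: cvg_cst|exact: cph]|exact: cch].
  by apply: cvgM; [exact: c2|apply: cvgM; [exact: cvg_cst|exact: cph]].
apply: cvgB; last exact: cps.
by apply: cvgD; apply: cvgM; [exact: c1|exact: cph|exact: c2|exact: cch].
Qed.

Lemma flow_add c d y z s r : 0 <= r ->
  flow_y c d y z (s + r) = flow_y c d (flow_y c d y z s) (flow_z c d y z s) r /\
  flow_z c d y z (s + r) = flow_z c d (flow_y c d y z s) (flow_z c d y z s) r.
Proof.
move=> r0; set y1 := flow_y c d y z s; set z1 := flow_z c d y z s.
pose Y q := flow_y c d y z (s + q) - flow_y c d y1 z1 q.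
pose V q := flow_z c d y z (s + q) - flow_z c d y1 z1 q.
have dV (q : R) : is_derive q 1 V (Y q).
  have H1 := is_derive_shiftf (is_derive_flow_z c d y z (s + q)).
  have H2 := is_derive_flow_z c d y1 z1 q.
  by rewrite /V /Y; derive_val.
have dY (q : R) : is_derive q 1 Y (c * Y q + d * V q).
  have H1 := is_derive_shiftf (is_derive_flow_y c d y z (s + q)).
  have H2 := is_derive_flow_y c d y1 z1 q.
  by rewrite /V /Y; derive_val; ring.
have Y0 : Y 0 = 0 by rewrite /Y addr0 flow_y0 subrr.
have V0 : V 0 = 0 by rewrite /V addr0 flow_z0 subrr.
have [/eqP + /eqP] := planar_ode_zero dY dV Y0 V0 r0.
by rewrite /Y /V !subr_eq0 => /eqP -> /eqP ->.
Qed.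

Lemma arc_zE c d t r : flight c d r ->
  arc_z c d t r = phi c d r * (launch c d t - launch c d r).
Proof.
move=> Jr; rewrite /arc_z /flow_z mul0r addr0 [launch c d r]/launch.
by field; rewrite gt_eqF// flight_phi.
Qed.

Lemma arc_z_pos c d t r : flight c d t -> 0 < r < t -> 0 < arc_z c d t r.
Proof.
move=> Jt /andP[r0 rt]; have Jr : flight c d r.
  by apply: (flight_le Jt); rewrite r0 ltW.
by rewrite arc_zE// mulr_gt0 ?flight_phi// subr_gt0 launch_lt// r0.
Qed.

Lemma arc_z_end c d t : flight c d t -> arc_z c d t t = 0.
Proof. by move=> Jt; rewrite arc_zE// subrr mulr0. Qed.

Lemma arc_y_end c d t : flight c d t -> arc_y c d t t = - launch (- c) d t.
Proof.
move=> Jt; rewrite launch_rev// /arc_y /flow_y mul0r addr0 /launch.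
by field; rewrite gt_eqF// flight_phi.
Qed.

(** Time reversal and y -> - y exchange the flights for c and for - c. *)
Lemma arc_rev c d t r : flight c d t -> 0 <= r ->
  arc_y c d t (t - r) = - arc_y (- c) d t r /\
  arc_z c d t (t - r) = arc_z (- c) d t r.
Proof.
move=> Jt r0.
pose Y q := - arc_y c d t (t - q) - arc_y (- c) d t q.
pose V q := arc_z c d t (t - q) - arc_z (- c) d t q.
have dV (q : R) : is_derive q 1 V (Y q).
  have H1 := is_derive_oppv (is_derive_shiftf (is_derive_flow_z c d (launch c d t) 0 (t - q))).
  have H2 := is_derive_flow_z (- c) d (launch (- c) d t) 0 q.
  by rewrite /V /Y; derive_val.
have dY (q : R) : is_derive q 1 Y (- c * Y q + d * V q).
  have H1 := is_derive_oppv (is_derive_shiftf (is_derive_flow_y c d (launch c d t) 0 (t - q))).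
  have H2 := is_derive_flow_y (- c) d (launch (- c) d t) 0 q.
  by rewrite /V /Y; derive_val; rewrite /arc_y /arc_z; ring.
have Y0 : Y 0 = 0 by rewrite /Y subr0 arc_y_end// /arc_y flow_y0; ring.
have V0 : V 0 = 0 by rewrite /V subr0 arc_z_end// /arc_z flow_z0; ring.
have [/eqP + /eqP] := planar_ode_zero dY dV Y0 V0 r0.
rewrite /Y /V !subr_eq0 => /eqP E /eqP ->; split=> //.
by rewrite -E opprK.
Qed.

(** If the flow reaches z = 0 with speed - y' at time r, the reversed flow thrown
  from z = 0 with speed y' is at the mirror image of the initial point at time
  r. *)
Lemma flow_back c d y z r : 0 <= r -> flow_z c d y z r = 0 ->
  y = - flow_y (- c) d (- flow_y c d y z r) 0 r /\
  z = flow_z (- c) d (- flow_y c d y z r) 0 r.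
Proof.
move=> r0; rewrite /flow_y /flow_z /chi.
have [-> ->] := flight_rev c d r0.
have W := wronskian c d r.
have E1 : expR (- c * r) * expR (c * r) = 1 by rewrite mulNr -expRD addNr expR0.
rewrite W /chi in E1; move: E1; rewrite /chi.
set f := phi c d r; set g := psi c d r; set e := expR (- c * r) => E1 zr.
pose k := 1 + d * g; pose E := e * (k ^+ 2 + c * k * f - d * f ^+ 2).
pose L := y * f + z * k - g; pose v := y * (c * f + k) + z * (d * f) - f.
have E0 : 1 - E = 0 by rewrite /E E1 subrr.
have L0 : L = 0 by [].
split; apply/eqP; rewrite -subr_eq0; apply/eqP.
  transitivity ((y - v) * (1 - E) - e * d * f * L); last by rewrite E0 L0; ring.
  by rewrite /E /L /v /k; ring.
transitivity (z * (1 - E) + e * (c * f + k) * L); last by rewrite E0 L0; ring.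
by rewrite /E /L /k; ring.
Qed.

Lemma near_flight_ball c d t : flight c d t ->
  exists2 e, 0 < e & forall r, `|t - r| < e -> flight c d r.
Proof. by move=> /near_flight/nbhs_ballP[e e0 H]; exists e. Qed.

(** Away from the landing: a nearby point also lands, close to the same time and
  with a similar speed, and the landing speed determines the duration of the
  flight, of which the point is part because z >= 0. *)
Let arc_open_fwd c d t0 s0 (e : R) : flight c d t0 -> 0 <= s0 < t0 -> 0 < e ->
  \forall q \near (arc_y c d t0 s0, arc_z c d t0 s0), 0 <= q.2 ->
    exists t s, [/\ flight c d t, 0 <= s <= t, `|t0 - t| < e, `|s0 - s| < e &
      q = (arc_y c d t s, arc_z c d t s)].
Proof.
move=> J0 /andP[s00 s0t] e0; pose r0 := t0 - s0.
have r00 : 0 < r0 by rewrite subr_gt0.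
set Y0 := arc_y c d t0 s0; set V0 := arc_z c d t0 s0.
have [e1 e10 J1] := near_flight_ball J0.
(* durations close to t0 bracket the landing speed *)
pose e2 := Num.min (e1 / 2) (Num.min (e / 4) (t0 / 2)).
have t00 := flight_gt0 J0.
have e20 : 0 < e2 by rewrite !lt_min !divr_gt0.
have e2e1 : e2 < e1 by rewrite gt_min; apply/orP; left; lra.
have e2e : e2 < e / 2.
  by rewrite !gt_min; apply/orP; right; apply/orP; left; lra.
have e2t : e2 < t0 by rewrite !gt_min; apply/orP; right; apply/orP; right; lra.
have Jlo : flight (- c) d (t0 - e2).
  by apply/flightN/J1; rewrite ltr_norml; apply/andP; split; lra.
have Jhi : flight (- c) d (t0 + e2).
  by apply/flightN/J1; rewrite ltr_norml; apply/andP; split; lra.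
have Jn0 := flightN J0.
have lo : launch (- c) d (t0 - e2) < launch (- c) d t0.
  by apply: (launch_lt Jn0); apply/andP; split; lra.
have hi : launch (- c) d t0 < launch (- c) d (t0 + e2).
  by apply: (launch_lt Jhi); apply/andP; split; lra.
pose g := Num.min (launch (- c) d t0 - launch (- c) d (t0 - e2))
  (launch (- c) d (t0 + e2) - launch (- c) d t0).
have g0 : 0 < g by rewrite lt_min !subr_gt0 lo.
have [cy cz] := flow_continuous c d.
have land r : 0 <= r -> flow_y c d Y0 V0 r = arc_y c d t0 (s0 + r) /\
    flow_z c d Y0 V0 r = arc_z c d t0 (s0 + r).
  by move=> r1; have [E1 E2] := flow_add c d (launch c d t0) 0 s0 r1;
    split; [exact: esym E1|exact: esym E2].
have vend : flow_y c d Y0 V0 r0 = - launch (- c) d t0.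
  by have [-> _] := land _ (ltW r00); rewrite /r0 addrC subrK arc_y_end.
have := cy ((Y0, V0), r0); rewrite /= => /cvgrPdist_lt/(_ _ g0).
rewrite /= vend => -[[A B] /= [nA nB] AB].
have /nbhs_ballP[e3 /= e30 HB] := nB.
(* the landing time is bracketed by r1 and r2 *)
pose e4 := Num.min (e3 / 2) (Num.min e2 (r0 / 2)).
have e40 : 0 < e4 by rewrite lt_min divr_gt0//= lt_min e20 divr_gt0.
have e43 : e4 < e3 by rewrite gt_min; apply/orP; left; lra.
have e42 : e4 <= e2 by rewrite ge_min; apply/orP; right; rewrite ge_min lexx.
have e4r : e4 < r0.
  by rewrite gt_min; apply/orP; right; rewrite gt_min; apply/orP; right; lra.
pose r1 := r0 - e4; pose r2 := r0 + e4.
have r12 : r1 <= r2 by rewrite /r1 /r2; lra.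
have r10 : 0 < r1 by rewrite /r1; lra.
have z1 : 0 < flow_z c d Y0 V0 r1.
  have [_ ->] := land _ (ltW r10); apply: arc_z_pos => //.
  by rewrite /r1 /r0; apply/andP; split; lra.
have z2 : flow_z c d Y0 V0 r2 < 0.
  have r20 : 0 <= r2 by rewrite /r2; lra.
  have [_ ->] := land _ r20; have E : s0 + r2 = t0 + e4 by rewrite /r2 /r0; ring.
  have J2 : flight c d (t0 + e4).
    by apply: J1; rewrite ltr_norml; apply/andP; split; lra.
  rewrite E arc_zE// pmulr_rlt0 ?flight_phi// subr_lt0.
  by apply: (launch_lt J2); apply/andP; split; lra.
have cz1 r : continuous (fun q : R * R => flow_z c d q.1 q.2 r).
  move=> q; rewrite /flow_z; apply: cvgB; last exact: cvg_cst.
  by apply: cvgD; apply: cvgM;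
    [exact: cvg_fst|exact: cvg_cst|exact: cvg_snd|exact: cvg_cst].
have n1 : \forall q \near (Y0, V0), 0 < flow_z c d q.1 q.2 r1.
  exact: (cz1 r1 (Y0, V0) [set w | 0 < w] (lt_nbhsr z1)).
have n2 : \forall q \near (Y0, V0), flow_z c d q.1 q.2 r2 < 0.
  exact: (cz1 r2 (Y0, V0) [set w | w < 0] (lt_nbhsl z2)).
near=> q => q0.
have q1 : 0 < flow_z c d q.1 q.2 r1 by near: q.
have q2 : flow_z c d q.1 q.2 r2 < 0 by near: q.
have Aq : A q by near: q.
have czq : continuous (flow_z c d q.1 q.2).
  exact: is_derive_continuous (is_derive_flow_z c d q.1 q.2).
have [|r /andP[r1r rr2] zr] := IVT_eq0 r12 czq.
  by right; rewrite (ltW q1) (ltW q2).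
have rr0 : `|r0 - r| <= e4.
  by rewrite ler_norml /r1 /r2 in r1r rr2 *; apply/andP; split; lra.
have r_gt0 : 0 < r by exact: lt_le_trans r1r.
pose w := - flow_y c d q.1 q.2 r.
have wg : `|launch (- c) d t0 - w| < g.
  have := AB (q, r); rewrite /= => H.
  rewrite /w -normrN opprB addrC; apply: H; split => //=.
  by apply: HB; rewrite /ball /=; exact: le_lt_trans e43.
have [wlo whi] : launch (- c) d (t0 - e2) < w /\ w < launch (- c) d (t0 + e2).
  move: wg; rewrite lt_min !ltr_norml => /andP[/andP[? ?] /andP[? ?]]; split; lra.
have [t Jt [tw thi]] : exists2 t, flight (- c) d t & launch (- c) d t = w /\ t <= t0 + e2.
  apply: launch_onto => //; rewrite (ltW whi) andbT.
  exact: lt_trans (launch_gt0 Jlo) wlo.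
have tlo : t0 - e2 < t.
  rewrite ltNge; apply/negP; rewrite le_eqVlt => /predU1P[E|tl].
    by rewrite -tw E ltxx in wlo.
  have := launch_lt Jlo; move=> /(_ t); rewrite (flight_gt0 Jt) tl tw => /(_ isT).
  by rewrite ltNge (ltW wlo).
have tt0 : `|t0 - t| <= e2 by rewrite ler_norml; apply/andP; split; lra.
have {}Jt : flight c d t by rewrite -[c]opprK; exact: flightN.
have [E1 E2] := flow_back (ltW r_gt0) zr; rewrite -/w -tw in E1 E2.
have Jr : flight (- c) d r.
  apply: (flight_le Jhi); rewrite r_gt0 /=.
  by rewrite /r2 /r0 in rr2; lra.
have rt : r <= t.
  rewrite leNgt; apply/negP => tr.
  have : arc_z (- c) d t r < 0.
    rewrite arc_zE// pmulr_rlt0 ?flight_phi// subr_lt0.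
    by apply: (launch_lt Jr); rewrite tr (flight_gt0 Jt).
  by rewrite /arc_z -E2 ltNge q0.
exists t, (t - r); split => //.
- by rewrite subr_ge0 rt lerBlDr lerDl ltW.
- by apply: le_lt_trans tt0 _; lra.
- have -> : s0 - (t - r) = (t0 - t) - (r0 - r) by rewrite /r0; ring.
  by apply: le_lt_trans (ler_normB _ _) _; lra.
- have [-> ->] := arc_rev Jt (ltW r_gt0).
  by rewrite /arc_y /arc_z -E1 -E2 -surjective_pairing.
Unshelve. all: by end_near. Qed.

(** Flights form an open map from the pairs (duration, time) to the half-plane
  z >= 0. At the landing, which the previous lemma excludes, reverse time. *)
Lemma arc_open c d t0 s0 (e : R) : flight c d t0 -> 0 <= s0 <= t0 -> 0 < e ->
  \forall q \near (arc_y c d t0 s0, arc_z c d t0 s0), 0 <= q.2 ->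
    exists t s, [/\ flight c d t, 0 <= s <= t, `|t0 - t| < e, `|s0 - s| < e &
      q = (arc_y c d t s, arc_z c d t s)].
Proof.
move=> J0 /andP[s00 st0] e0.
move: (st0); rewrite le_eqVlt => /predU1P[->|s0t]; last first.
  by apply: arc_open_fwd => //; rewrite s00.
(* at the landing, reverse time *)
have t00 := flight_gt0 J0; have Jn := flightN J0.
have h2 : 0 < e / 2 by rewrite divr_gt0.
have := arc_open_fwd Jn (_ : 0 <= 0 < t0) h2; rewrite lexx t00 => /(_ isT).
have [E1 E2] := arc_rev J0 (lexx 0); rewrite subr0 in E1 E2.
rewrite E1 E2; set a := arc_y _ _ _ _; set b := arc_z _ _ _ _.
move=> H.
have cn : (fun q : R * R => (- q.1, q.2)) @ (- a, b) --> (a, b).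
  apply: (@cvg_pair _ _ _ _ (nbhs a) (nbhs b)); last exact: cvg_snd.
  have fab : (fun q : R * R => q.1) @ (- a, b) --> - a by exact: cvg_fst.
  by have := cvgN fab; rewrite opprK; apply.
have {}H : \forall q \near (- a, b), 0 <= q.2 ->
    exists t s, [/\ flight (- c) d t, 0 <= s <= t, `|t0 - t| < e / 2,
    `|0 - s| < e / 2 & (- q.1, q.2) = (arc_y (- c) d t s, arc_z (- c) d t s)].
  exact: cn _ H.
near=> q => q0.
have : exists t s, [/\ flight (- c) d t, 0 <= s <= t, `|t0 - t| < e / 2,
    `|0 - s| < e / 2 & (- q.1, q.2) = (arc_y (- c) d t s, arc_z (- c) d t s)].
  by move: q0; near: q; exact: H.
move=> [t [s [Jt /andP[s0' st] tt ss [qy qz]]]].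
have {}Jt : flight c d t by rewrite -[c]opprK; exact: flightN.
exists t, (t - s); split => //.
- by rewrite subr_ge0 st lerBlDr lerDl.
- by apply: lt_trans tt _; lra.
- have -> : t0 - (t - s) = (t0 - t) - (0 - s) by ring.
  by apply: le_lt_trans (ler_normB _ _) _; lra.
- have [-> ->] := arc_rev Jt s0'.
  by rewrite -qy -qz opprK -surjective_pairing.
Unshelve. all: by end_near. Qed.

Lemma arc_y_start_gt0 c d t : flight c d t -> 0 < arc_y c d t 0.
Proof. by move=> Jt; rewrite /arc_y flow_y0 launch_gt0. Qed.

Lemma arc_y_end_lt0 c d t : flight c d t -> arc_y c d t t < 0.
Proof. by move=> Jt; rewrite arc_y_end// oppr_lt0 launch_gt0//; exact: flightN. Qed.

(** If two flights through a point took different times to land, the one that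
  lands first would have z = 0 while the other is still in the air; and the
  landing speed determines the duration. *)
Lemma arc_inj c d t s t' s' : flight c d t -> flight c d t' ->
  0 <= s <= t -> 0 <= s' <= t' ->
  arc_y c d t s = arc_y c d t' s' -> arc_z c d t s = arc_z c d t' s' ->
  t = t' /\ s = s'.
Proof.
suff le_rest t1 s1 t2 s2 : flight c d t1 -> flight c d t2 ->
    0 <= s1 <= t1 -> 0 <= s2 <= t2 ->
    arc_y c d t1 s1 = arc_y c d t2 s2 -> arc_z c d t1 s1 = arc_z c d t2 s2 ->
    ~ t1 - s1 < t2 - s2.
  move=> J J' st st' Ey Ez; pose r := t - s.
  have rE : t' - s' = r.
    have [lt1|lt2|//] := ltgtP (t' - s') (t - s).
      by exfalso; apply: le_rest lt1.
    by exfalso; apply: le_rest lt2.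
  have r0 : 0 <= r by rewrite subr_ge0; case/andP: st.
  have [F _] := flow_add c d (launch c d t) 0 s r0.
  have [F' _] := flow_add c d (launch c d t') 0 s' r0.
  have st_ : s + r = t by rewrite /r addrC subrK.
  have st_' : s' + r = t' by rewrite -rE addrC subrK.
  rewrite st_ in F; rewrite st_' in F'.
  have E : arc_y c d t t = arc_y c d t' t'.
    by move: F F'; rewrite -!/(arc_y _ _ _ _) -!/(arc_z _ _ _ _) Ey Ez => -> ->.
  rewrite !arc_y_end// in E; have tt := launch_inj (flightN J) (flightN J') (oppr_inj E).
  split=> //; apply: (addIr r).
  by rewrite st_ st_'.
move=> J1 J2 /andP[s10 st1] /andP[s20 st2] Ey Ez lt12.
pose r := t1 - s1; have r0 : 0 <= r by rewrite subr_ge0.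
have [_ F] := flow_add c d (launch c d t1) 0 s1 r0.
have [_ F'] := flow_add c d (launch c d t2) 0 s2 r0.
have E : arc_z c d t1 t1 = arc_z c d t2 (s2 + r).
  have E1 : s1 + r = t1 by rewrite /r addrC subrK.
  move: F F'; rewrite E1 -!/(arc_y _ _ _ _) -!/(arc_z _ _ _ _) Ey Ez => -> ->.
  by [].
rewrite arc_z_end// in E.
have := arc_z_pos J2; move=> /(_ (s2 + r)); rewrite -E ltxx.
have rt2 : s2 + r < t2 by move: lt12; rewrite /r; lra.
rewrite rt2 andbT => H.
move: (addr_ge0 s20 r0); rewrite le_eqVlt => /predU1P[s2r|/H//].
have [s2E rE] : s2 = 0 /\ r = 0 by split; lra.
have s1t1 : s1 = t1 by move: rE; rewrite /r; lra.
have := arc_y_start_gt0 J2; have := arc_y_end_lt0 J1.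
by rewrite -{2}s1t1 Ey s2E => /lt_trans H1 /H1; rewrite ltxx.
Qed.

Lemma arc_z_ge0 c d t r : flight c d t -> 0 <= r <= t -> 0 <= arc_z c d t r.
Proof.
move=> Jt /andP[]; rewrite le_eqVlt => /predU1P[<- _|r0].
  by rewrite /arc_z flow_z0.
rewrite le_eqVlt => /predU1P[->|rt]; first by rewrite arc_z_end.
by apply/ltW/arc_z_pos; rewrite ?r0.
Qed.

Lemma arc_z_eq0 c d t r : flight c d t -> 0 <= r <= t -> arc_z c d t r = 0 ->
  r = 0 \/ r = t.
Proof.
move=> Jt /andP[]; rewrite le_eqVlt => /predU1P[<- _|r0]; first by left.
rewrite le_eqVlt => /predU1P[->|rt z0]; first by right.
by have := arc_z_pos Jt; move=> /(_ r); rewrite r0 rt z0 ltxx => /(_ isT).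
Qed.

End planar_arcs.

(** * The surface of periodic orbits *)

(** When every matching pair of launch speeds is a planar cycle, the closed orbits
  of the planar system fill an open annulus. If moreover the return maps of x are
  not translations, exactly one periodic orbit lies over each closed orbit, and
  these orbits form a graph over the annulus. *)

Lemma affine_fixed (R : realType) (f1 f2 : R -> R) (a b k1 k2 : R) :
  (forall x, f1 x = a * x + k1) -> (forall x, f2 x = b * x + k2) ->
  1 - a * b != 0 -> f2 (f1 (f2 k1 / (1 - a * b))) = f2 k1 / (1 - a * b).
Proof. by move=> E1 E2 ab; rewrite !E1 !E2; field. Qed.

Section center.
Variable R : realType.
Implicit Types (s : bool) (t r P : R).
Variable p : params R.

Lemma cvg_compc (T : Type) (F : set_system T) (FF : Filter F) (f : R -> R)
    (h : T -> R) t : {for t, continuous f} -> h @ F --> t ->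
  f (h w) @[w --> F] --> f t.
Proof. exact: continuous_cvg. Qed.

Lemma arc_x_cvg s (T : Type) (F : set_system T) (FF : Filter F) (f g h : T -> R) x y t :
  f @ F --> x -> g @ F --> y -> h @ F --> t ->
  (arc p s (f w) (g w) (h w)).1.1 @[w --> F] --> (arc p s x y t).1.1.
Proof.
move=> fx gy ht; rewrite /arc /=.
have c1 := continuous_egf (geometrically_bounded_forced (pa p s) (phi_geo (pc p s) (pd p s))).
have c2 := continuous_egf (geometrically_bounded_forced (pa p s) (psi_geo (pc p s) (pd p s))).
have c3 := continuous_egf (geometrically_bounded_forced (pa p s) (one_geo R)).
have c4 : continuous (fun t : R => expR (pa p s * t)).
  exact: (is_derive_continuous (fun t => is_derive_expRM t (pa p s))).
apply: cvgD; first (apply: cvgB; first apply: cvgD).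
- by apply: cvgM; [exact: (cvg_compc FF (c4 t) ht)|exact: fx].
- apply: cvgM; last exact: (cvg_compc FF (c1 t) ht).
  by apply: cvgM; [exact: gy|exact: cvg_cst].
- by apply: cvgM; [exact: cvg_cst|exact: (cvg_compc FF (c2 t) ht)].
- by apply: cvgM; [exact: cvg_cst|exact: (cvg_compc FF (c3 t) ht)].
Qed.

Lemma arc_xE s x y t :
  (arc p s x y t).1.1 = expR (pa p s * t) * x + (arc p s 0 y t).1.1.
Proof. by rewrite /arc /=; ring. Qed.

Hypothesis center : forall t1 t2, flies p true t1 -> flies p false t2 ->
  speed p true t1 = speed' p false t2 -> speed' p true t1 = speed p false t2.
Hypothesis hyperbolic : forall t1 t2, 0 < t1 -> 0 < t2 ->
  pa p true * t1 + pa p false * t2 != 0.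

(** Planar cycles are labelled by the speed P of their upward crossing. *)
Definition levels := [set P | exists t1 t2, planar_cycle p t1 t2 /\ P = speed p true t1].
Definition time_up P := launch_inv (pc p true) (pd p true) P.
Definition time_down P := launch_inv (- pc p false) (pd p false) P.

Lemma levels_cycle P : levels P -> planar_cycle p (time_up P) (time_down P) /\
  speed p true (time_up P) = P.
Proof.
move=> [t1 [t2 [C ->]]]; have [J1 J2 E1 _] := C.
have -> : time_up (speed p true t1) = t1 by exact: launch_invK.
have -> : time_down (speed p true t1) = t2.
  by rewrite E1; apply: launch_invK; exact: flightN.
by split.
Qed.

Lemma levels_open P : levels P -> \forall P' \near P, levels P'.
Proof.
move=> [t1 [t2 [[J1 J2 E1 _] PE]]].
have hi c d t : flight c d t -> exists2 u, flight c d u & launch c d t < launch c d u.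
  move=> Jt; have [e e0 H] := near_flight_ball Jt.
  have Ju : flight c d (t + e / 2) by apply: H; rewrite ltr_norml; apply/andP; split; lra.
  by exists (t + e / 2) => //; apply: launch_lt => //; rewrite (flight_gt0 Jt); lra.
have [u1 K1 H1] := hi _ _ _ J1; have [u2 K2 H2] := hi _ _ _ (flightN J2).
have P0 : 0 < P by rewrite PE speed_gt0.
have PE2 : P = launch (- pc p false) (pd p false) t2 by rewrite PE E1.
near=> P'.
have P'0 : 0 < P' by near: P'; exact: lt_nbhsr.
have P'1 : P' < launch (pc p true) (pd p true) u1.
  by near: P'; apply: lt_nbhsl; rewrite PE.
have P'2 : P' < launch (- pc p false) (pd p false) u2.
  by near: P'; apply: lt_nbhsl; rewrite PE2.
have [v1 L1 [F1 _]] := @launch_onto _ _ _ _ P' K1 (introT andP (conj P'0 (ltW P'1))).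
have [v2 L2 [F2 _]] := @launch_onto _ _ _ _ P' K2 (introT andP (conj P'0 (ltW P'2))).
have {}L2 : flies p false v2 by rewrite /flies -[pc p false]opprK; exact: flightN.
exists v1, v2; split=> //.
have E : speed p true v1 = speed' p false v2 by rewrite /speed /speed' F1 F2.
by split=> //; exact: center.
Unshelve. all: by end_near. Qed.

(** x coordinates of the upward and downward crossings of the periodic orbit at
  level P: the return map of x is affine with slope exp (a+ t1 + a- t2), and
  start_up is its fixed point. *)
Definition start_up P : R :=
  (arc p false (arc p true 0 P (time_up P)).1.1 (- speed p false (time_down P))
    (time_down P)).1.1 /
  (1 - expR (pa p true * time_up P + pa p false * time_down P)).
Definition start_down P : R := (arc p true (start_up P) P (time_up P)).1.1.
Definition start s P := if s then start_up P else start_down P.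

Lemma start_up_fixed P : levels P ->
  (arc p false (start_down P) (- speed p false (time_down P)) (time_down P)).1.1
  = start_up P.
Proof.
move=> /levels_cycle[[J1 J2 _ _] _].
have := hyperbolic (flight_gt0 J1) (flight_gt0 J2).
rewrite /start_down /start_up expRD.
set t1 := time_up P; set t2 := time_down P; set y2 := - speed p false t2 => h.
have F1 x := arc_xE true x P t1; have F2 x := arc_xE false x y2 t2.
have ab : 1 - expR (pa p true * t1) * expR (pa p false * t2) != 0.
  rewrite subr_eq0 eq_sym -expRD; apply: contra h => /eqP E.
  by apply/eqP/expR_inj; rewrite E expR0.
exact: (affine_fixed F1 F2 ab).
Qed.

Lemma continuous_time_up P : levels P -> {for P, continuous time_up}.
Proof.
move=> LP; have [[J1 _ _ _] E] := levels_cycle LP.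
apply/differentiable_continuous/derivable1_diffP.
by have := is_derive_launch_inv J1; rewrite -/(speed p true _) E.
Qed.

Lemma continuous_time_down P : levels P -> {for P, continuous time_down}.
Proof.
move=> LP; have [[_ J2 E1 _] E] := levels_cycle LP.
apply/differentiable_continuous/derivable1_diffP.
have := is_derive_launch_inv (flightN J2).
by rewrite -/(speed' p false _) -E1 E.
Qed.

Lemma continuous_start s P : levels P -> {for P, continuous (start s)}.
Proof.
move=> LP; have [[J1 J2 _ _] E] := levels_cycle LP.
have cu := continuous_time_up LP; have cd := continuous_time_down LP.
have cid : (fun w : R => w) @ P --> P by exact: cvg_id.
have c0 (z : R) : (fun=> z) @ P --> z by exact: cvg_cst.
have csp : speed p false (time_down w) @[w --> P] --> speed p false (time_down P).
  exact: cvg_compc _ (continuous_launch J2) cd.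
have c1 : {for P, continuous start_up}.
  rewrite /start_up; apply: cvgM.
    apply: arc_x_cvg; [|exact: cvgN csp|exact: cd].
    by apply: arc_x_cvg; [exact: c0|exact: cid|exact: cu].
  apply: cvgV.
    rewrite subr_eq0 eq_sym; apply: contra (hyperbolic (flight_gt0 J1) (flight_gt0 J2)).
    by move=> /eqP H; apply/eqP/expR_inj; rewrite H expR0.
  apply: cvgB; first exact: c0.
  apply: (cvg_compc _ (@continuous_expR R _)).
  by apply: cvgD; apply: cvgM; [exact: c0|exact: cu|exact: c0|exact: cd].
case: s; first exact: c1.
rewrite /start /start_down.
by apply: arc_x_cvg; [exact: c1|exact: cid|exact: cu].
Qed.

(** The level of the planar cycle whose arc on the side s lasts t. *)
Definition level s t := if s then speed p true t else speed' p false t.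
Definition surf_pt s t r : space3 R :=
  arc p s (start s (level s t)) (sgn R s * speed p s t) r.

Arguments level : simpl never.
Arguments surf_pt : simpl never.

Definition surf : set (space3 R) := [set q | exists s t r,
  [/\ flies p s t, levels (level s t), 0 <= r <= t & q = surf_pt s t r]].

Lemma surf_pt_planar s t r :
  (surf_pt s t r).1.2 = sgn R s * arc_y (pc p s) (pd p s) t r /\
  (surf_pt s t r).2 = sgn R s * arc_z (pc p s) (pd p s) t r.
Proof.
rewrite /surf_pt /arc /arc_y /arc_z /flow_y /flow_z /= /speed.
by split; ring.
Qed.

Lemma surf_pt_crossings P : levels P ->
  [/\ surf_pt true (time_up P) 0 = (start_up P, P, 0),
      surf_pt false (time_down P) (time_down P) = (start_up P, P, 0),
      surf_pt true (time_up P) (time_up P) = surf_pt false (time_down P) 0 &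
      level true (time_up P) = P /\ level false (time_down P) = P].
Proof.
move=> LP; have [[J1 J2 E1 E2] E] := levels_cycle LP.
have L1 : level true (time_up P) = P by rewrite /level E.
have L2 : level false (time_down P) = P by rewrite /level -E1 E.
split; last by split.
- by rewrite /surf_pt L1 E /start arc0 mul1r.
- have [_ [z0 y0]] := arc_flight (start_down P) J2.
  rewrite /surf_pt L2 /start; apply: space3_eq.
  + by rewrite mulN1r start_up_fixed.
  + by rewrite y0 /sgn opprK mul1r -/(speed' p false _) -E1 E.
  + by rewrite z0.
- have [_ [z0 y0]] := arc_flight (start_up P) J1.
  rewrite [in RHS]/surf_pt arc0 /surf_pt L1 L2 /start; apply: space3_eq.
  + by rewrite E mul1r /start_down.
  + rewrite y0 /sgn [LHS]mulN1r -/(speed' p true _) E2 /= mulN1r; reflexivity.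
  + by rewrite z0.
Qed.

Lemma surf_time s t : flies p s t -> levels (level s t) ->
  t = if s then time_up (level s t) else time_down (level s t).
Proof.
case: s => /= Js _; first by rewrite /time_up launch_invK.
by rewrite /time_down launch_invK//; exact: flightN.
Qed.

(** On z = 0 an arc of one side ends where one of the other side starts, so near
  such a point the surface can be described from both sides. *)
Lemma surf_other_side s t r : flies p s t -> levels (level s t) -> 0 <= r <= t ->
  (surf_pt s t r).2 = 0 -> exists t' r', [/\ flies p (~~ s) t',
    levels (level (~~ s) t'), 0 <= r' <= t' & surf_pt (~~ s) t' r' = surf_pt s t r].
Proof.
move=> Js LP rt; have [_ ->] := surf_pt_planar s t r.
move=> /eqP; rewrite mulf_eq0 (negPf (sgn_neq0 R s)) /= => /eqP z0.
have rE := arc_z_eq0 Js rt z0.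
have := surf_time Js LP; move: LP; move: (level s t) => P LP tE.
have [[J1 J2 _ _] _] := levels_cycle LP.
have [H1 H2 H3 [H4 H5]] := surf_pt_crossings LP.
have u0 := ltW (flight_gt0 J1); have d0 := ltW (flight_gt0 J2).
move: rE; rewrite {}tE {Js rt z0 t}.
case: s => /= -[] ->.
- by exists (time_down P), (time_down P); rewrite H5 lexx d0 H2 H1.
- by exists (time_down P), 0; rewrite H5 lexx d0 H3.
- by exists (time_up P), (time_up P); rewrite H4 lexx u0 H3.
- by exists (time_up P), 0; rewrite H4 lexx u0 H2 H1.
Qed.

(** Planar flights are disjoint, and the level determines x. *)
Lemma surf_graph x x' y z : surf (x, y, z) -> surf (x', y, z) -> x = x'.
Proof.
have same s t r t' r' : flies p s t -> flies p s t' -> 0 <= r <= t -> 0 <= r' <= t' ->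
    (x, y, z) = surf_pt s t r -> (x', y, z) = surf_pt s t' r' -> x = x'.
  move=> Jt Jt' rt rt' E E'.
  have [E1 E2] := surf_pt_planar s t r; have [E1' E2'] := surf_pt_planar s t' r'.
  rewrite -E /= in E1 E2; rewrite -E' /= in E1' E2'.
  have [||tt rr] := arc_inj Jt Jt' rt rt'.
  - by apply: (mulfI (sgn_neq0 R s)); rewrite -E1 -E1'.
  - by apply: (mulfI (sgn_neq0 R s)); rewrite -E2 -E2'.
  by move: E'; rewrite -tt -rr -E => -[].
move=> [s [t [r [Js Ls rt E]]]] [s' [t' [r' [Js' Ls' rt' E']]]].
have [ss|ss] := eqVneq s s'.
  by rewrite -{}ss in Js' E'; exact: same Js Js' rt rt' E E'.
have z0 : z = 0.
  have [_ E2] := surf_pt_planar s t r; have [_ E2'] := surf_pt_planar s' t' r'.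
  rewrite -E /= in E2; rewrite -E' /= in E2'.
  have p1 := arc_z_ge0 Js rt; have p2 := arc_z_ge0 Js' rt'.
  move: ss E2 E2' p1 p2 {E E' rt rt' Ls Ls' Js Js'}; case: s; case: s' => //= _;
    rewrite /sgn ?mul1r ?mulN1r.
    by move=> E2 E2'; rewrite -E2 -oppr_le0 => z1; rewrite -oppr_le0 -E2' => z2; lra.
  by move=> E2 E2'; rewrite -E2' -oppr_le0 -E2 => z1 z2; lra.
have [|t'' [r'' [J'' L'' rt'' E'']]] := surf_other_side Js' Ls' rt'.
  by rewrite -E' /= z0.
have sE : ~~ s' = s by case: (s) (s') ss => -[].
rewrite sE in J'' E''.
by apply: same Js J'' rt rt'' E _; rewrite E''.
Qed.

Lemma continuous_level s t : flies p s t -> {for t, continuous (level s)}.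
Proof.
case: s => Js; first exact: continuous_launch Js.
exact: continuous_launch (flightN Js).
Qed.

(** Flights form an open map and the level set is open, so nearby points of the
  half-plane are on nearby arcs, at nearby times; x is continuous in both. *)
Lemma surf_near_side s t0 r0 (e : R) : flies p s t0 -> levels (level s t0) ->
  0 <= r0 <= t0 -> 0 < e ->
  \forall q \near ((surf_pt s t0 r0).1.2, (surf_pt s t0 r0).2),
    0 <= sgn R s * q.2 -> exists2 x, surf (x, q.1, q.2) & `|(surf_pt s t0 r0).1.1 - x| < e.
Proof.
move=> J0 L0 rt0 e0.
have cl := continuous_level J0.
have nl : \forall t \near t0, levels (level s t).
  exact: (cl _ (levels_open L0)).
have /nbhs_ballP[e1 e10 H1] := nl.
have cx : (surf_pt s w.1 w.2).1.1 @[w --> (t0, r0)] --> (surf_pt s t0 r0).1.1.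
  have c1 : (fun w : R * R => w.1) @ (t0, r0) --> t0 by exact: cvg_fst.
  rewrite /surf_pt; apply: arc_x_cvg; last exact: cvg_snd.
  - by apply: cvg_compc; [exact: continuous_start|exact: cvg_compc _ cl c1].
  - apply: cvgM; first exact: cvg_cst.
    exact: cvg_compc _ (continuous_launch J0) c1.
have /cvgrPdist_lt/(_ _ e0) := cx => -[[A B] [nA nB] AB].
have /nbhs_ballP[e2 e20 H2] := nA; have /nbhs_ballP[e3 e30 H3] := nB.
rewrite /= in e10 e20 e30.
pose e4 := Num.min e1 (Num.min e2 e3).
have e40 : 0 < e4 by rewrite !lt_min e10 e20.
have [E1 E2] := surf_pt_planar s t0 r0; rewrite E1 E2.
have H := arc_open J0 rt0 e40.
set a := arc_y _ _ _ _ in H *; set b := arc_z _ _ _ _ in H *.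
have cn : (fun q : R * R => (sgn R s * q.1, sgn R s * q.2)) @ (sgn R s * a, sgn R s * b) --> (a, b).
  apply: (@cvg_pair _ _ _ _ (nbhs a) (nbhs b)).
    have f1 : (fun q : R * R => q.1) @ (sgn R s * a, sgn R s * b) --> sgn R s * a by exact: cvg_fst.
    by have := cvgM (cvg_cst (sgn R s)) f1; rewrite sgnK; apply.
  have f1 : (fun q : R * R => q.2) @ (sgn R s * a, sgn R s * b) --> sgn R s * b by exact: cvg_snd.
  by have := cvgM (cvg_cst (sgn R s)) f1; rewrite sgnK; apply.
have {}H : \forall q \near (sgn R s * a, sgn R s * b), 0 <= sgn R s * q.2 ->
    exists t r, [/\ flies p s t, 0 <= r <= t, `|t0 - t| < e4, `|r0 - r| < e4 &
      (sgn R s * q.1, sgn R s * q.2) = (arc_y (pc p s) (pd p s) t r, arc_z (pc p s) (pd p s) t r)].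
  exact: cn _ H.
apply: filterS H => -[y z] /= H z0; have [t [r [Jt rt tt rr [yE zE]]]] := H z0.
move: tt rr; rewrite !lt_min => /and3P[tt1 tt2 _] /and3P[_ _ rr3].
exists (surf_pt s t r).1.1; last first.
  by have := AB (t, r); apply; split; [exact: H2|exact: H3].
have [F1 F2] := surf_pt_planar s t r.
exists s, t, r; split=> //; first exact: H1.
apply: space3_eq; first by reflexivity.
  by rewrite F1 -yE sgnK.
by rewrite F2 -zE sgnK.
Qed.

Lemma surf_near x y z (e : R) : surf (x, y, z) -> 0 < e ->
  \forall q \near (y, z), exists2 x', surf (x', q.1, q.2) & `|x - x'| < e.
Proof.
move=> [s [t [r [Js Ls rt E]]]] e0.
have H1 := surf_near_side Js Ls rt e0; rewrite -E /= in H1.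
have cz : (fun q : R * R => q.2) @ (y, z) --> z by exact: cvg_snd.
have [z0|z0] := eqVneq z 0.
  have [|t' [r' [Js' Ls' rt' E']]] := surf_other_side Js Ls rt; first by rewrite -E.
  have H2 := surf_near_side Js' Ls' rt' e0; rewrite E' -E /= in H2.
  near=> q.
  have [sq|sq] := leP 0 (sgn R s * q.2).
    by move: sq; near: q; exact: H1.
  have {}sq : 0 <= sgn R (~~ s) * q.2.
    by move: sq; case: (s); rewrite /sgn ?mul1r ?mulN1r; lra.
  by move: sq; near: q; exact: H2.
have sz : 0 < sgn R s * z.
  have [_ F] := surf_pt_planar s t r; rewrite -E /= in F.
  rewrite lt_neqAle eq_sym mulf_neq0 ?sgn_neq0//= F sgnK; exact: arc_z_ge0.
have csz : (fun q : R * R => sgn R s * q.2) @ (y, z) --> sgn R s * z.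
  exact: cvgM (cvg_cst _) cz.
have npos : \forall q \near (y, z), 0 < sgn R s * q.2.
  exact: (csz [set w | 0 < w] (lt_nbhsr sz)).
near=> q.
have sq : 0 <= sgn R s * q.2 by apply/ltW; near: q; exact: npos.
by move: sq; near: q; exact: H1.
Unshelve. all: by end_near. Qed.

(** The projection to the (y, z) plane is a global chart. *)
Lemma surf_surface : (exists t1 t2, planar_cycle p t1 t2) -> surface surf.
Proof.
move=> [t1 [t2 C]]; split.
  have [J1 _ _ _] := C.
  exists (surf_pt true t1 0), true, t1, 0; split=> //; first by exists t1, t2.
  by rewrite lexx ltW// (flight_gt0 J1).
move=> q0 _.
pose V := [set q : R * R | exists x, surf (x, q.1, q.2)].
pose xi (q : R * R) := xget 0 [set x | surf (x, q.1, q.2)].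
have xiE x q : surf (x, q.1, q.2) -> xi q = x.
  by move=> Sx; rewrite /xi; case: xgetP => [x' _ Sx'|/(_ x)//]; exact: surf_graph Sx' Sx.
exists setT, V, (fun q => (xi q, q.1, q.2)), (fun w => (w.1.2, w.2)).
split.
- by split=> //; exact: openT.
- rewrite openE => -[y z] /= [x Sx]; rewrite /interior.
  by apply: filterS (surf_near Sx ltr01) => q [x' Sx' _]; exists x'.
- apply: continuous_in_subspaceT => -[y z]; rewrite inE => -[x Sx].
  apply/cvg_pairP; split; last exact: cvg_snd.
  apply/cvg_pairP; split; last exact: cvg_fst.
  rewrite /= (xiE x)//; apply/cvgrPdist_lt => e e0.
  by apply: filterS (surf_near Sx e0) => q [x' Sx' xx']; rewrite (xiE x').
- apply: continuous_subspaceT => w; apply/cvg_pairP; split.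
    by have /cvg_pairP[/cvg_pairP[]] : (fun w : space3 R => w) @ w --> w by exact: cvg_id.
  exact: cvg_snd.
- split; last by case.
  rewrite setIT; apply/seteqP; split=> [_ [q [x Sx] <-]|[[x y] z] Sx].
    by rewrite (xiE x).
  by exists (y, z); [exists x|rewrite (xiE x)].
Qed.

Definition level_orbit P v :=
  cycle p v (time_up P) (time_down P) /\ v 0 = (start_up P, P, 0).

Lemma level_orbit_exists P : levels P -> exists v, level_orbit P v.
Proof.
move=> LP; have [C E] := levels_cycle LP.
have [|Cv x0] := @cycle_loop R p (time_up P) (time_down P) (start_up P) C.
  by rewrite E; exact: start_up_fixed.
exists (loop p (time_up P) (time_down P) (start_up P)); split=> //.
have [tv vT _ a1 a2] := Cv; have [[z0 y0] _ _ _ _] := turn_crossings C a1 a2.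
by apply: space3_eq; rewrite ?x0 ?y0 ?z0 ?E.
Qed.

Lemma level_orbit_arcs P v : levels P -> level_orbit P v ->
  (forall r, 0 <= r <= time_up P -> v r = surf_pt true (time_up P) r) /\
  (forall r, 0 <= r <= time_down P ->
     v (time_up P + r) = surf_pt false (time_down P) r).
Proof.
move=> LP [[tv vT C a1 a2] v0]; have [[J1 J2 _ _] E] := levels_cycle LP.
have [_ _ _ [L1 L2]] := surf_pt_crossings LP.
rewrite v0 /= in a1.
split=> r rt; first by rewrite a1// /surf_pt L1 mul1r.
rewrite a2// /surf_pt L2 mulN1r a1 ?lexx ?(ltW (flight_gt0 J1))//.
by rewrite E.
Qed.

Lemma surf_orbits : surf =
  \bigcup_(gamma in [set gamma | exists P v,
     [/\ levels P, level_orbit P v & gamma = range v]]) gamma.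
Proof.
apply/seteqP; split=> [_ [s [t [r [Js LP rt ->]]]]|q [_ [P [v [LP ov ->]]] [t _ <-]]].
  have [v ov] := level_orbit_exists LP.
  have [H1 H2] := level_orbit_arcs LP ov.
  exists (range v); first by exists (level s t), v.
  have := surf_time Js LP; case: s {Js} LP ov H1 H2 => LP ov H1 H2 tE.
    by exists r => //; rewrite H1 -tE.
  by exists (time_up (level false t) + r) => //; rewrite H2 -tE.
have [H1 H2] := level_orbit_arcs LP ov; have [[_ vT _ _ _] _] := ov.
have [[J1 J2 _ _] E] := levels_cycle LP.
have [_ _ _ [L1 L2]] := surf_pt_crossings LP.
have t10 := flight_gt0 J1; have t20 := flight_gt0 J2.
have [n /andP[]] := @period_reduce R (time_up P + time_down P) 0 t (addr_gt0 t10 t20).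
rewrite add0r -(periodicZ vT n t); set r := t + _ => r0 rT.
have [rt|tr] := leP r (time_up P).
  exists true, (time_up P), r; split=> //; first by rewrite L1.
    by rewrite r0.
  by rewrite H1// r0.
exists false, (time_down P), (r - time_up P).
have rr : 0 <= r - time_up P <= time_down P.
  by rewrite subr_ge0 (ltW tr) lerBlDl ltW.
split=> //; first by rewrite L2.
by rewrite -H2// addrC subrK.
Qed.

(** Uniqueness of trajectories, since cycles avoid the fold line. *)
Lemma surf_invariant u : traj p u -> surf (u 0) -> forall t, surf (u t).
Proof.
move=> tu; rewrite surf_orbits => -[_ [P [v [LP ov ->]]] [r _ vr]] t.
have [[tv vT C _ _] _] := ov; have [J1 J2 _ _] := C.
have T0 := addr_gt0 (flight_gt0 J1) (flight_gt0 J2).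
have fold q : (v (r + q)).2 = 0 -> (v (r + q)).1.2 != 0.
  exact: periodic_nofold tv T0 vT _.
have E : u = (fun q => v (r + q)).
  apply: (traj_unique2 (t0 := 0) tu (traj_shift r tv)) => //.
  by rewrite addr0 vr.
exists (range v); first by exists P, v.
by rewrite E; exists (r + t).
Qed.

End center.

(** * Infinitely many cylinders *)

Section infinitely_many_cylinders.
Variable R : realType.
Variables ap bp cp dp am bm cm dm m : R.

Let p := Params (fun s => if s then ap else am) (fun s => if s then bp else bm)
  (fun s => if s then cp else cm) (fun s => if s then dp else dm)
  (fun s => if s then 0 else m).

Let Z : pwfield R := (Xplus ap bp cp dp, Xminus am bm cm dm m).

Lemma planar_cycle_common t1 t2 : planar_cycle p t1 t2 ->
  common_flight cp dp (- cm) dm t1 /\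
  t2 = launch_inv (- cm) dm (launch cp dp t1).
Proof.
move=> [J1 J2 E1 E2]; have K2 : flight (- cm) dm t2 by exact: flightN.
split; first by split=> //; exists t2; split=> //; rewrite opprK.
have -> : launch cp dp t1 = launch (- cm) dm t2 by exact: E1.
by rewrite launch_invK.
Qed.

(** In terms of (launch, landing) speeds, the half-returns of the two sides are the
  flight curves of (c+, d+) and of (- c-, d-), and cylinders are their common
  points. If there are infinitely many, the curves are either both the diagonal
  or equal, so that the matching of the launch speeds implies that of the landing
  speeds. *)
Lemma infinite_cylinders_center : infinite_set [set C | invariant_cylinder Z C] ->
  (exists t1 t2, planar_cycle p t1 t2) /\
  forall t1 t2, flies p true t1 -> flies p false t2 ->
    speed p true t1 = speed' p false t2 -> speed' p true t1 = speed p false t2.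
Proof.
move=> inf; split.
  apply: contrapT => no; apply: inf.
  rewrite (_ : [set C | _] = set0); first exact: finite_set0.
  apply/seteqP; split=> // C /invariant_cylinderP[t1 [t2 [C12 _]]].
  by apply: no; exists t1, t2.
have [fin|[[c1 c2]|[ec ed]]] := common_flight_finite cp dp (- cm) dm.
- exfalso; apply: inf.
  apply: sub_finite_set (finite_image (fun t => cyl ap bp cp dp am bm cm dm m t
    (launch_inv (- cm) dm (launch cp dp t))) fin).
  move=> C /invariant_cylinderP[t1 [t2 [C12 ->]]].
  have [Ct tE] := planar_cycle_common C12.
  by exists t1 => //; rewrite -tE.
- move=> t1 t2 _ _; rewrite /speed /speed' /= c1 c2 oppr0.
  by have -> : cm = 0 by apply/eqP; rewrite -oppr_eq0 c2.
- move=> t1 t2 J1 J2; rewrite /flies /speed /speed' /= -ec -ed => E.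
  have J2' : flight cp dp t2 by rewrite ec ed; exact: flightN.
  rewrite (launch_inj J1 J2' E).
  by have -> : cm = - cp by rewrite ec opprK.
Qed.

(** As a+ and a- do not have opposite signs and are not both zero, the slope
  exp (a+ t1 + a- t2) of the return map of x is never 1. *)
Lemma periodic_surface : ap ^+ 2 + am ^+ 2 <> 0 -> 0 <= ap * am ->
  infinite_set [set C | invariant_cylinder Z C] ->
  exists S : set (space3 R), [/\ surface S, invariant_set Z S &
    exists F : set (set (space3 R)),
      [/\ forall gamma, F gamma -> periodic_orbit Z gamma,
          S = \bigcup_(gamma in F) gamma &
          forall gamma, F gamma -> exists C : set (space3 R),
            invariant_cylinder Z C /\ gamma `<=` C]].
Proof.
move=> a0 aa /infinite_cylinders_center[ne center].
have hyp t1 t2 : 0 < t1 -> 0 < t2 -> pa p true * t1 + pa p false * t2 != 0.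
  move=> t10 t20; apply/eqP => /= E; apply: a0.
  have : (ap * t1) ^+ 2 + (ap * am) * (t1 * t2) = 0.
    by transitivity (ap * t1 * (ap * t1 + am * t2)); [ring|rewrite E mulr0].
  have aat : 0 <= ap * am * (t1 * t2) by rewrite mulr_ge0// mulr_ge0// ltW.
  move=> /eqP; rewrite paddr_eq0 ?sqr_ge0//.
  rewrite sqrf_eq0 mulf_eq0 [t1 == 0]gt_eqF// orbF => /andP[/eqP ap0 _].
  move: E; rewrite ap0 mul0r add0r => /eqP; rewrite mulf_eq0 [t2 == 0]gt_eqF// orbF.
  by move=> /eqP ->; rewrite expr0n /= addr0.
exists (surf p); split; first exact: surf_surface.
  move=> u /trajectoryE tu; exact: surf_invariant.
exists [set gamma | exists P v,
  [/\ levels p P, level_orbit p P v & gamma = range v]]; split.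
- by move=> _ [P [v [_ [Cv _] ->]]]; exact: cycle_periodic_orbit Cv.
- exact: surf_orbits.
- move=> _ [P [v [LP [Cv _] ->]]]; 
  exists (cyl ap bp cp dp am bm cm dm m (time_up p P) (time_down p P)).
  split; last exact: cycle_cyl.
  by apply/invariant_cylinderP; exists (time_up p P), (time_down p P); case: Cv.
Qed.

End infinitely_many_cylinders.

Theorem theorem3 (R : realType) (ap bp cp dp am bm cm dm m : R) :
  let Z : pwfield R := (Xplus ap bp cp dp, Xminus am bm cm dm m) in
  [/\ (ap ^+ 2 + am ^+ 2 = 0 \/ ~ (exists C, invariant_cylinder Z C)) ->
      ~ (exists gamma, limit_cycle Z gamma),
      ap ^+ 2 + am ^+ 2 <> 0 ->
      is_subset1 [set C | invariant_cylinder Z C] ->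
      forall C, invariant_cylinder Z C ->
        is_subset1 [set gamma | limit_cycle Z gamma /\ gamma `<=` C] &
      ap ^+ 2 + am ^+ 2 <> 0 ->
      0 <= ap * am ->
      infinite_set [set C | invariant_cylinder Z C] ->
      exists S : set (space3 R),
        [/\ surface S, invariant_set Z S &
            exists F : set (set (space3 R)),
              [/\ forall gamma, F gamma -> periodic_orbit Z gamma,
                  S = \bigcup_(gamma in F) gamma &
                  forall gamma, F gamma -> exists C : set (space3 R),
                    invariant_cylinder Z C /\ gamma `<=` C]]].
Proof.
split.
- exact: no_cylinder_no_limit_cycle.
- by move=> _; exact: unique_cylinder_limit_cycle.
- exact: periodic_surface.
Qed.
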